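(* Let $n\ge 1$ be an integer and let $\pi_1,\pi_2\in S_n$ be any permutations. Let $\delta_n=\mathrm{br}(c_n)$, where $c_n\in S_n$ is the cyclic permutation with $c_n(i)=i+1$ for $1\le i\le n-1$ and $c_n(n)=1$. Then the petal number of the closure of the braid \[\delta_n\,\mathrm{br}(\pi_1)^{-1}\,\mathrm{br}(\pi_1^{-1})^{-1}\,\mathrm{br}(\pi_2^{-1})\,\mathrm{br}(\pi_2)\] is at most $2n+1$.
   Context: Braids. $B_n$ is the braid group on $n$ strands with standard (positive) generators $\sigma_1,\dots,\sigma_{n-1}$. A (positive) simple braid (also called permutation braid) is a positive braid in which each pair of strands crosses at most once. Simple braids on $n$ strands are in bijection with permutations in $S_n$; $\mathrm{br}(\pi)$ denotes the simple braid whose strands are permuted according to $\pi$ (the strand starting at position $i$ ends at position $\pi(i)$). The convention is that a braid product $ab$ starts with $b$, and permutations are composed as functions ($\pi\pi'$ means apply $\pi'$ first). Equivalently, if $\pi=s_{i_1}\cdots s_{i_\ell}$ is any reduced expression in the adjacent transpositions $s_i=(i\ i+1)$, then $\mathrm{br}(\pi)=\sigma_{i_1}\cdots\sigma_{i_\ell}$. The underlying permutation of the braid in the claim is the $n$-cycle $c_n$, so its closure is a knot. Petal number. A multi-crossing of a diagram is a point of the projection plane at which several strands of the diagram intersect, each passing straight through the point so that every two of them cross transversally there, with the strands at pairwise distinct heights ($z$-coordinates). A petal diagram of a knot is a diagram of the knot having exactly one multi-crossing and no other crossing, such that the projection is a topological rose: the loops (petals) into which the multi-crossing point divides the projection are pairwise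 non-nested, i.e. they bound discs with pairwise disjoint interiors. The number of petals equals the number of strands passing through the multi-crossing. Every knot admits a petal diagram, and the petal number of a knot is the minimum number of petals over all its petal diagrams. *)

(* Defs.v *)
From HB Require Import structures.
From mathcomp Require Import all_boot all_order all_fingroup all_algebra.
From mathcomp Require Import generic_quotient.
From mathcomp Require Import all_classical all_reals all_analysis.

Set Implicit Arguments.
Unset Strict Implicit.
Unset Printing Implicit Defensive.

Import Order.TTheory GRing.Theory Num.Theory numFieldNormedType.Exports.

Local Open Scope ring_scope.
Local Open Scope classical_set_scope.

(* The strands of n-strand braids sit at the positions 0, ..., n-1 of 'I_n, so
   sigma_1, ..., sigma_(n-1) are indexed by 0, ..., n-2 in 'I_n.-1.  The letter
   (i, true) is the generator of index i and (i, false) its inverse.  In a word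
   the rightmost letter comes first, as in a product of functions; beware that
   the product of perm.v goes the other way: (s * t) x = t (s x). *)

Notation braid_letter n := ('I_n.-1 * bool)%type.
Notation braid_word n := (seq (braid_letter n)).

Lemma succ_pred_ltn n (i : 'I_n.-1) : (i.+1 < n)%N.
Proof. by case: n i => [[]|n] //= i; rewrite ltnS. Qed.

Definition pos_left n (i : 'I_n.-1) : 'I_n := widen_ord (leq_pred n) i.
Definition pos_right n (i : 'I_n.-1) : 'I_n := Ordinal (succ_pred_ltn i).

Definition adj_transp n (i : 'I_n.-1) : 'S_n := tperm (pos_left i) (pos_right i).

Section BraidGroup.
Variable n : nat.
Implicit Types u v w : braid_word n.

Definition sigma_word (i : 'I_n.-1) : braid_word n := [:: (i, true)].

Definition word_inv w : braid_word n := rev [seq (a.1, ~~ a.2) | a <- w].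

Inductive braid_equiv : braid_word n -> braid_word n -> Prop :=
| braid_equiv_refl u : braid_equiv u u
| braid_equiv_sym u v : braid_equiv u v -> braid_equiv v u
| braid_equiv_trans u v w :
    braid_equiv u v -> braid_equiv v w -> braid_equiv u w
| braid_equiv_cat u u' v v' :
    braid_equiv u u' -> braid_equiv v v' -> braid_equiv (u ++ v) (u' ++ v')
| braid_equiv_cancel i b : braid_equiv [:: (i, b); (i, ~~ b)] [::]
| braid_equiv_far (i j : 'I_n.-1) : (i.+1 < j)%N ->
    braid_equiv (sigma_word i ++ sigma_word j) (sigma_word j ++ sigma_word i)
| braid_equiv_near (i j : 'I_n.-1) : j = i.+1 :> nat ->
    braid_equiv (sigma_word i ++ sigma_word j ++ sigma_word i)
                (sigma_word j ++ sigma_word i ++ sigma_word j).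

Definition braid_eqb : rel (braid_word n) := fun u v => `[< braid_equiv u v >].

Lemma braid_eqb_refl : reflexive braid_eqb.
Proof. by move=> u; apply/asboolP; exact: braid_equiv_refl. Qed.

Lemma braid_eqb_sym : symmetric braid_eqb.
Proof. by move=> u v; apply/asboolP/asboolP; exact: braid_equiv_sym. Qed.

Lemma braid_eqb_trans : transitive braid_eqb.
Proof.
by move=> v u w /asboolP uv /asboolP vw; apply/asboolP; exact: braid_equiv_trans vw.
Qed.

Canonical braid_equiv_rel :=
  EquivRel braid_eqb braid_eqb_refl braid_eqb_sym braid_eqb_trans.

Definition braid : Type := {eq_quot braid_eqb}%qT.
HB.instance Definition _ := Choice.on braid.
HB.instance Definition _ := EqQuotient.on braid.

Definition braid_of (w : braid_word n) : braid := (\pi_braid w)%qT.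

Lemma braid_ofP u v : reflect (braid_of u = braid_of v) `[< braid_equiv u v >].
Proof. exact: (@eqquotP _ braid_eqb braid). Qed.

Lemma braid_of_repr (x : braid) : braid_of (repr x) = x.
Proof. exact: reprK. Qed.

Lemma word_inv_cat u v : word_inv (u ++ v) = word_inv v ++ word_inv u.
Proof. by rewrite /word_inv map_cat rev_cat. Qed.

Lemma word_invK : involutive word_inv.
Proof.
move=> w; rewrite /word_inv map_rev revK -map_comp -[RHS]map_id.
by apply: eq_map => -[i b] /=; rewrite negbK.
Qed.

Lemma word_mulV w : braid_equiv (w ++ word_inv w) [::].
Proof.
elim: w => [|[i b] w IHw]; first exact: braid_equiv_refl.
rewrite -cat1s word_inv_cat -catA [w ++ _]catA.
apply: (@braid_equiv_trans _ ([:: (i, b)] ++ [::] ++ word_inv [:: (i, b)])).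
  apply: braid_equiv_cat; first exact: braid_equiv_refl.
  by apply: braid_equiv_cat => //; exact: braid_equiv_refl.
exact: braid_equiv_cancel.
Qed.

Lemma word_inv_equiv u v :
  braid_equiv u v -> braid_equiv (word_inv u) (word_inv v).
Proof.
move=> uv.
apply: (@braid_equiv_trans _ (word_inv u ++ (v ++ word_inv v))).
  rewrite -{1}[word_inv u]cats0; apply: braid_equiv_cat.
    exact: braid_equiv_refl.
  exact/braid_equiv_sym/word_mulV.
rewrite catA -{2}[word_inv v]cat0s; apply: braid_equiv_cat; last exact: braid_equiv_refl.
apply: (@braid_equiv_trans _ (word_inv u ++ u)).
  by apply: braid_equiv_cat; [exact: braid_equiv_refl|exact: braid_equiv_sym].
by rewrite -{2}[u]word_invK; exact: word_mulV.
Qed.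

Definition braid_mul (x y : braid) : braid := braid_of (repr x ++ repr y).
Definition braid_one : braid := braid_of [::].
Definition braid_inv (x : braid) : braid := braid_of (word_inv (repr x)).

Lemma braid_mulE u v : braid_mul (braid_of u) (braid_of v) = braid_of (u ++ v).
Proof.
apply/braid_ofP/asboolP; apply: braid_equiv_cat.
  by apply/asboolP/braid_ofP; rewrite braid_of_repr.
by apply/asboolP/braid_ofP; rewrite braid_of_repr.
Qed.

Lemma braid_invE u : braid_inv (braid_of u) = braid_of (word_inv u).
Proof.
apply/braid_ofP/asboolP; apply: word_inv_equiv.
by apply/asboolP/braid_ofP; rewrite braid_of_repr.
Qed.

Lemma braid_mulA : associative braid_mul.
Proof.
move=> x y z; rewrite -[x]braid_of_repr -[y]braid_of_repr -[z]braid_of_repr.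
by rewrite !braid_mulE catA.
Qed.

Lemma braid_mul1g : left_id braid_one braid_mul.
Proof. by move=> x; rewrite -[x]braid_of_repr braid_mulE. Qed.

Lemma braid_mulg1 : right_id braid_one braid_mul.
Proof. by move=> x; rewrite -[x]braid_of_repr braid_mulE cats0. Qed.

Lemma braid_mulgV : right_inverse braid_one braid_inv braid_mul.
Proof.
move=> x; rewrite -[x]braid_of_repr braid_invE braid_mulE.
by apply/braid_ofP/asboolP; exact: word_mulV.
Qed.

Lemma braid_mulVg : left_inverse braid_one braid_inv braid_mul.
Proof.
move=> x; rewrite -[x]braid_of_repr braid_invE braid_mulE.
by apply/braid_ofP/asboolP; rewrite -{2}[repr x]word_invK; exact: word_mulV.
Qed.

HB.instance Definition _ :=
  isGroup.Build braid braid_mulA braid_mul1g braid_mulg1 braid_mulVg braid_mulgV.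

Definition word_perm w : 'S_n :=
  foldr (fun a s => (s * adj_transp a.1)%g) 1%g w.

(* The pairs of strands, named by their starting positions, that meet at the
   successive letters of a word. *)
Fixpoint word_crossings w : seq {set 'I_n} :=
  if w is a :: w' then
    [set ((word_perm w')^-1)%g (pos_left a.1);
         ((word_perm w')^-1)%g (pos_right a.1)]%SET :: word_crossings w'
  else [::].

Definition simple_word w : bool :=
  all (fun a : braid_letter n => a.2) w && uniq (word_crossings w).

End BraidGroup.

Lemma perm_homo1 n (s : 'S_n) :
  (forall i : 'I_n.-1, s (pos_left i) < s (pos_right i))%N -> s = 1%g.
Proof.
move=> lts; have mono (i j : 'I_n) : (i < j)%N -> (s i < s j)%N.
  case: j => j; elim: j => //= j IH jn; rewrite ltnS leq_eqVlt.
  have jn' : (j < n)%N by exact: ltnW.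
  have jp : (j < n.-1)%N by rewrite ltn_predRL.
  have := lts (Ordinal jp).
  have -> : pos_left (Ordinal jp) = Ordinal jn' by apply/val_inj.
  have -> : pos_right (Ordinal jp) = Ordinal jn by apply/val_inj.
  move=> ltj /orP[/eqP ij|/(IH jn') /ltn_trans]; last exact.
  by have -> : i = Ordinal jn' by apply/val_inj.
have ge (i : 'I_n) : (i <= s i)%N.
  case: i => i; elim: i => //= i IH hi.
  have hi' : (i < n)%N by exact: ltnW.
  by apply: leq_ltn_trans (IH hi') _; exact: mono.
have sum : (\sum_(i < n) s i = \sum_(i < n) i)%N.
  by rewrite [RHS](reindex_inj (@perm_inj _ s)).
apply/permP => i; rewrite perm1; apply/val_inj/eqP; rewrite eqn_leq ge andbT.
rewrite leqNgt; apply/negP => lt_i.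
have : (\sum_(i < n) i < \sum_(i < n) s i)%N.
  rewrite (bigD1 i) //= [ltnRHS](bigD1 i) //= -addSn leq_add //.
  exact: leq_sum.
by rewrite sum ltnn.
Qed.

Lemma adj_transp_lt n (i : 'I_n.-1) (a b : 'I_n) : (a < b)%N ->
  ~~ ((a == pos_left i) && (b == pos_right i)) ->
  (adj_transp i a < adj_transp i b)%N.
Proof.
move=> ab nab; rewrite /adj_transp.
have el : val (pos_left i) = i by [].
have er : val (pos_right i) = i.+1 by [].
case: tpermP => [ea|ea|/eqP na /eqP na'];
  case: tpermP => [eb|eb|/eqP nb /eqP nb'];
  move: ab nab; rewrite ?ea ?eb ?eqxx //= => ab nab; try by rewrite ltnn in ab.
- rewrite ltn_neqAle ab andbT; apply: contra nb' => /eqP e.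
  by apply/eqP/val_inj.
- exact: ltnW.
- exact: ltnW.
- rewrite ltn_neqAle -ltnS ab andbT; apply: contra na => /eqP e.
  by apply/eqP/val_inj.
Qed.

Lemma exists_simple_word n (s : 'S_n) :
  exists w : braid_word n, simple_word w && (word_perm w == s).
Proof.
pose invs (t : 'S_n) := [set x : 'I_n * 'I_n | (x.1 < x.2)%N && (t x.2 < t x.1)%N]%SET.
pose crossed (t : 'S_n) (w : braid_word n) := forall X, X \in word_crossings w ->
  exists2 x, x \in invs t & X = [set x.1; x.2]%SET.
suff [w [w1 w2 _]] : exists w : braid_word n,
    [/\ simple_word w, word_perm w = s & crossed s w].
  by exists w; rewrite w1 w2 eqxx.
have [m] := ubnP #|invs s|; elim: m s => // m IHm s; rewrite ltnS => les.
have [/existsP[i lti]|/existsPn noi] :=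
  boolP [exists i : 'I_n.-1, (s^-1)%g (pos_right i) < (s^-1)%g (pos_left i)]%N; last first.
  have s1 : s = 1%g.
    apply/invg_inj; rewrite invg1; apply: perm_homo1 => i.
    have := noi i; rewrite -leqNgt leq_eqVlt => /orP[/eqP/val_inj/perm_inj/(congr1 val)|//].
    by move=> /= /n_Sn.
  by exists [::]; split => //; rewrite s1.
pose t := (s * adj_transp i)%g.
have tr x : adj_transp i (adj_transp i x) = x by rewrite /adj_transp tpermK.
have st x : s x = adj_transp i (t x) by rewrite /t permM tr.
have tVl : (t^-1)%g (pos_left i) = (s^-1)%g (pos_right i).
  by apply: (@perm_inj _ t); rewrite permKV /t permM permKV /adj_transp tpermR.
have tVr : (t^-1)%g (pos_right i) = (s^-1)%g (pos_left i).
  by apply: (@perm_inj _ t); rewrite permKV /t permM permKV /adj_transp tpermL.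
pose x0 := ((t^-1)%g (pos_left i), (t^-1)%g (pos_right i)).
have x0s : x0 \in invs s.
  by rewrite inE /x0 /= tVl tVr lti /= !permKV /=.
have x0t : x0 \notin invs t.
  by rewrite inE /x0 /= !permKV /= [(i.+1 < i)%N]ltnNge leqnSn andbF.
have sub : invs t \subset invs s.
  apply/fintype.subsetP => -[x y]; rewrite !inE /= => /andP[xy tyx]; rewrite xy /= !st.
  apply: adj_transp_lt => //; apply/negP => /andP[/eqP ty /eqP tx].
  move: lti; rewrite -tVl -tVr -ty -tx !permK => /ltn_trans/(_ xy).
  by rewrite ltnn.
have ltinv : (#|invs t| < #|invs s|)%N.
  by apply: proper_card; apply/properP; split=> //; exists x0.
have [w [/andP[w1 w1'] w2 w3]] := IHm t (leq_trans ltinv les).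
exists ((i, true) :: w); split.
- rewrite /simple_word /= w1 w1' w2 andbT /=; apply/negP => /w3[[x y]].
  move=> xy /setP /= eX; move: (xy); rewrite inE /= => /andP[ltxy _].
  have := eX x; have := eX y; rewrite !inE !eqxx orbT /= tVl tVr.
  move=> /orP[]/eqP ey /orP[]/eqP ex; subst x y; rewrite ?ltnn // in ltxy.
    by move: lti; rewrite ltnNge ltnW.
  by move: xy x0t; rewrite /x0 tVl tVr => ->.
- by rewrite /= w2 /t; apply/permP => x; rewrite !permM tr.
- move=> X /=; rewrite inE => /orP[/eqP ->|/w3[x xt ->]].
    by exists x0; rewrite ?w2.
  by exists x => //; exact: (fintype.subsetP sub).
Qed.

Definition br n (s : 'S_n) : braid n := braid_of (xchoose (exists_simple_word s)).

Definition cyc_perm n : 'S_n := perm (@ordS_inj n).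

Definition delta n : braid n := br (cyc_perm n).

(* The point ((x, y), z) lies above (x, y), at height z. *)
Notation plane R := (R * R)%type.
Notation space R := (R * R * R)%type.

Section Curves.
Variable R : realType.

Definition homeomorphism (f : space R -> space R) : Prop :=
  continuous f /\
  exists g : space R -> space R, [/\ continuous g, cancel f g & cancel g f].

Definition ambient_isotopic (K K' : set (space R)) : Prop :=
  exists H : R * space R -> space R,
    [/\ {within `[0, 1] `*` setT, continuous H},
        forall t, t \in `[0, 1] -> homeomorphism (fun x => H (t, x)),
        forall x, H (0, x) = x &
        [set H (1, x) | x in K] = K'].

(* A closed curve is given as a map of period 1. *)
Definition simple_closed_curve (g : R -> space R) : Prop :=
  [/\ continuous g,
      forall s, g (s + 1) = g s &
      {in `[0, 1[ &, injective g}].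

(* For a Jordan curve L this is the interior of the disc that L bounds. *)
Definition inside (L : set (plane R)) : set (plane R) :=
  [set x | ~ L x /\ bounded_set (connected_component (~` L) x)].

(* The curve g passes over the multi-crossing O at the times
   t 0 < ... < t p.-1 of the period [t 0, t p[, with projected velocities v;
   the k-th petal is the loop projected from [t k, t k.+1].  A single strand is
   not a crossing, hence 2 <= p. *)
Definition petal_diagram (p : nat) (g : R -> space R) : Prop :=
  simple_closed_curve g /\ (2 <= p)%N /\
  exists (O : plane R) (t : nat -> R) (v : nat -> plane R),
    [/\ t p = t 0%N + 1 /\ (forall k, (k < p)%N -> t k < t k.+1),
        (forall s, s \in `[t 0%N, t p[ ->
           (g s).1 = O <-> exists2 k, (k < p)%N & s = t k),
        {in `[t 0%N, t p[ &, forall s s', (g s).1 = (g s').1 ->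
           (g s).1 <> O -> s = s'},
        (forall k, (k < p)%N -> is_derive (t k) 1 (fun s => (g s).1) (v k)) &
        forall k l, (k < p)%N -> (l < p)%N -> k <> l ->
          [/\ (v k).1 * (v l).2 - (v k).2 * (v l).1 != 0,
              (g (t k)).2 != (g (t l)).2 &
              inside [set (g s).1 | s in `[t k, t k.+1]] `&`
              inside [set (g s).1 | s in `[t l, t l.+1]] = set0]].

Definition has_petal_diagram (K : set (space R)) (p : nat) : Prop :=
  exists2 g, petal_diagram p g & ambient_isotopic K (range g).

Definition is_petal_number (K : set (space R)) (p : nat) : Prop :=
  has_petal_diagram K p /\ forall q, has_petal_diagram K q -> (p <= q)%N.

Definition segment (a b : space R) : set (space R) :=
  [set a + s *: (b - a) | s in `[0, 1]].

Fixpoint polyline (s : seq (space R)) : set (space R) :=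
  if s is a :: s' then
    if s' is b :: _ then segment a b `|` polyline s' else set0
  else set0.

Definition pt (x y z : R) : space R := ((x, y), z).

(* The letter a, drawn between the levels y = k and y = k + 1, moves position
   j to position q; q - j is 1, -1 or 0.  For a generator the strand going from
   left to right passes over. *)
Definition letter_strand n (a : braid_letter n) (k : nat) (j : 'I_n) :
    set (space R) :=
  let q := adj_transp a.1 j in
  polyline [:: pt j%:R k%:R 0;
               pt ((j%:R + q%:R) / 2) (k%:R + 1 / 2)
                  ((if a.2 then 1 else -1) * (q%:R - j%:R));
               pt q%:R (k%:R + 1) 0].

Fixpoint word_strands n (w : braid_word n) : set (space R) :=
  if w is a :: w' then
    (\bigcup_(j in [set: 'I_n]) letter_strand a (size w') j) `|` word_strands w'
  else set0.

(* The planar arc joining position j at level L to position j at level 0 around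
   the right of the braid; the arcs of smaller j are the outer ones. *)
Definition closing_arc n (L : nat) (j : 'I_n) : set (space R) :=
  let d : R := n%:R - j%:R in
  polyline [:: pt j%:R L%:R 0;
               pt j%:R (L%:R + d) 0;
               pt (n%:R + d) (L%:R + d) 0;
               pt (n%:R + d) (- d) 0;
               pt j%:R (- d) 0;
               pt j%:R 0 0].

Definition word_closure n (w : braid_word n) : set (space R) :=
  word_strands w `|` \bigcup_(j in [set: 'I_n]) closing_arc (size w) j.

(* repr picks an arbitrary word of the braid; another word gives an ambient
   isotopic closure. *)
Definition braid_closure n (b : braid n) : set (space R) :=
  word_closure (repr b).

End Curves.

Arguments braid_closure R {n} b.
Arguments word_closure R {n} w.

(* Main.v *)
Require Import Defs.
From HB Require Import structures.
From mathcomp Require Import all_boot all_order all_fingroup all_algebra.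
From mathcomp Require Import all_classical all_reals all_analysis.
From mathcomp Require Import zify ring lra.
Require Import Defs.

(* Cut space into half-planes, the pages p in [0, 8], around the axis of the closed
   braid.  A closed braid is then a closed path of configurations of n points in a
   plane with coordinates x (the position) and z (the height), and an isotopy is a
   homotopy of such paths in which the points stay distinct.  A word in which every
   crossing agrees with given heights of the strands may be replaced by stacking
   the strands at these heights and laying them down again in their new order.
   For the five factors of the braid the heights can be chosen so that strands which
   return to their initial order stay stacked: the braid becomes the path that
   takes strand j through position j, height -j, position pi2 j, height j,
   position pi1 j, height -j and position c_n j.

   Stacked strands are disjoint as seen along the x-axis.  Let the height of
   strand k be s times the signed distance y to a fixed line parallel to the x-axis,
   the slope s increasing from 2 k to 2 k + 2 during one turn.  In the projection
   along the x-axis all strands run through one point, on the pages where they are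
   ordered by position, and there they are separated by pi2 k, respectively by
   2 n - pi1 k.  The petals between consecutive passages lie in the sectors between
   the lines of slopes 0, ..., 2 n, hence are not nested.  Strand n - 1 ends on the
   line of slope 2 n, and one more passage, in front of all others, leads it back
   to slope 0; this makes 2 n + 1 petals.

   Isotopies come from displacements that are Lipschitz with respect to the
   positions at all times: such a displacement extends to space by McShane's
   formula, and the identity plus a contraction is a homeomorphism. *)

Set Implicit Arguments.
Unset Strict Implicit.
Unset Printing Implicit Defensive.

Import Order.TTheory GRing.Theory Num.Theory numFieldNormedType.Exports.

Local Open Scope ring_scope.
Local Open Scope classical_set_scope.

(** * Lipschitz displacements *)

(* Joins the structures of [prod] inherited from different files. *)
HB.saturate prod.

(** A simple braid can be layered in two ways: at each crossing the strand on top is the one that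
    starts further left, and as crossed strands end in reverse order it is also the one that ends
    further right. So [br s2] is layered by starting positions and [br (s2^-1)] by final positions,
    which are the starting positions of the product; inverses are layered by the same heights, read
    backwards. Grouped as [delta * (br s1)^-1], [(br (s1^-1))^-1 * br (s2^-1)] and [br s2], each
    group needs a single stack. The group with [delta] needs no arrangement by c_n in the end: c_n
    renames the stacked strands cyclically, and the growth of the slopes by 2 performs this
    renaming. What remains is the jump from strand n - 1 to strand 0; leading it around the others
    costs the odd passage. Distinctness of strands is checked by lexicographic orders: convex
    combinations of positive vectors are positive, so the vertices of a homotopy suffice, and
    compactness yields the uniform gap from which the Lipschitz constants come. *)

Section ProdComplete.
Variables U V : completeType.

(** Banach's fixed point theorem will be applied in [space R], an iterated product, which has to be
    complete. *)
Lemma prod_complete (F : set_system (U * V)) :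
  ProperFilter F -> cauchy F -> cvg F.
Proof.
move=> FF Fc.
have /cauchy_cvg c1 : cauchy (fst @ F).
  move=> A entA; rewrite near_simpl -near2E near_map2.
  by apply: Fc; apply: filterS (prod_entP entA (@entourageT V)) => x [].
have /cauchy_cvg c2 : cauchy (snd @ F).
  move=> A entA; rewrite near_simpl -near2E near_map2.
  by apply: Fc; apply: filterS (prod_entP (@entourageT U) entA) => x [].
apply/cvg_ex; exists (lim (fst @ F), lim (snd @ F)).
have -> : F = (fun x => (x.1, x.2)) @ F.
  rewrite predeqE => A; rewrite /fmap /=.
  by rewrite (_ : (fun x => (x.1, x.2)) = id) //; apply/funext => -[].
exact: cvg_pair.
Qed.

HB.instance Definition _ := Uniform_isComplete.Build (U * V)%type prod_complete.
End ProdComplete.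

HB.instance Definition _ (K : numFieldType) (U V : completeNormedModType K) :=
  Complete.on (U * V)%type.

Section Isotopy.
Variable R : realType.
Implicit Types K : set (space R).

Lemma lip_continuous (V W : normedModType R) (f : V -> W) (k : R) :
  (forall x y, `|f x - f y| <= k * `|x - y|) -> continuous f.
Proof.
move=> lf x; have k0 : 0 < `|k| + 1 by rewrite ltr_wpDl.
apply/cvgrPdist_lt => e e0; near=> y.
apply: le_lt_trans (lf x y) _.
apply: (@le_lt_trans _ _ ((`|k| + 1) * `|x - y|)).
  by rewrite ler_wpM2r // (le_trans (ler_norm _)) // lerDl.
rewrite mulrC -ltr_pdivlMr //; near: y.
by apply: cvgr_dist_lt; rewrite ?divr_gt0.
Unshelve. all: by end_near. Qed.

(** A solution of [x + D x = y] is a fixed point of the contraction [y - D x]. The lower bound [lb]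
    gives uniqueness and makes the inverse Lipschitz with constant 1 / (1 - q). *)
Lemma contraction_homeo (D : space R -> space R) (q : R) : 0 <= q < 1 ->
  (forall x y, `|D x - D y| <= q * `|x - y|) ->
  homeomorphism (fun x => x + D x).
Proof.
move=> /andP[q0 q1] lD.
have cD := lip_continuous lD.
have lb x y : (1 - q) * `|x - y| <= `|(x + D x) - (y + D y)|.
  rewrite mulrBl mul1r; have -> : x + D x - (y + D y) = (x - y) - (D y - D x).
    by rewrite opprB opprD addrACA.
  apply: le_trans (lerB_dist _ _); rewrite lerB // (le_trans (lD y x)) //.
  by rewrite (distrC y x).
have q1' : 0 < 1 - q by rewrite subr_gt0.
split; first by move=> x; apply: cvgD => //; exact: cD.
have surj y : exists x, x + D x = y.
  have ff : set_fun setT setT (fun x => y - D x) by [].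
  pose f : {fun [set: space R] >-> [set: space R]} := HB.pack (fun x => y - D x)
    (isFun.Build _ _ _ _ _ ff).
  have cf : is_contraction f.
    exists (NngNum q0); split => //=.
    move=> [a b] _ /=; rewrite opprB addrC addrA subrK.
    by rewrite (le_trans (lD b a)) // distrC.
  have [x _ /= xE] := @banach_fixed_point R (space R) setT f cf closedT (ex_intro _ (0 : space R) I).
  by exists x; rewrite {1}xE subrK.
have [g gK] := choice surj; exists g; split => //.
  apply: (@lip_continuous _ _ _ (1 - q)^-1) => y z.
  rewrite mulrC ler_pdivlMr // mulrC.
  by apply: le_trans (lb _ _) _; rewrite !gK.
move=> x; apply/eqP; rewrite -subr_eq0 -normr_eq0; apply/eqP/le_anti.
rewrite normr_ge0 andbT -(ler_pM2l q1') mulr0 (le_trans (lb _ _)) //.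
by rewrite gK subrr normr0.
Qed.

(* McShane's extension. *)
Lemma lip_extension (S : Type) (s0 : S) (A : S -> space R) (d : S -> R) (q : R) :
  0 <= q ->
  (forall a b, `|d a - d b| <= q * `|A a - A b|) ->
  exists2 D : space R -> R, (forall x y, `|D x - D y| <= q * `|x - y|) &
    forall a, D (A a) = d a.
Proof.
move=> q0 ld.
pose E x := [set d a + q * `|x - A a| | a in [set: S]].
have lbE x : lbound (E x) (d s0 - q * `|x - A s0|).
  move=> _ [a _ <-].
  have h : d s0 - d a <= q * `|A s0 - A a| by apply: le_trans (ler_norm _) (ld _ _).
  have : q * `|A s0 - A a| <= q * (`|x - A s0| + `|x - A a|).
    by rewrite ler_wpM2l // (distrC x (A s0)) ler_distD.
  by rewrite mulrDr; lra.
have infE x : has_inf (E x).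
  by split; [exists (d s0 + q * `|x - A s0|), s0|exists (d s0 - q * `|x - A s0|)].
have half x y : inf (E x) <= inf (E y) + q * `|x - y|.
  rewrite -lerBlDr; apply: lb_le_inf; first by case: (infE y).
  move=> _ [a _ <-].
  have : inf (E x) <= d a + q * `|x - A a|.
    by apply: ge_inf; [case: (infE x)|exists a].
  have : q * `|x - A a| <= q * (`|x - y| + `|y - A a|) by rewrite ler_wpM2l // ler_distD.
  by rewrite mulrDr; lra.
exists (fun x => inf (E x)).
  move=> x y; rewrite ler_norml; have := half x y; have := half y x.
  by rewrite (distrC y x); lra.
move=> a; apply/le_anti/andP; split.
  apply: le_trans (_ : _ <= d a + q * `|A a - A a|) _.
    by apply: ge_inf; [case: (infE (A a))|exists a].
  by rewrite subrr normr0 mulr0 addr0.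
apply: lb_le_inf; first by case: (infE (A a)).
move=> _ [b _ <-]; rewrite -lerBlDl; exact: le_trans (ler_norm _) (ld _ _).
Qed.

Lemma norm3E (a b c : R) : `|((a, b), c) : space R| = Num.max (Num.max `|a| `|b|) `|c|.
Proof. by rewrite !prod_normE. Qed.

Lemma norm3_le (x : space R) (m : R) :
  (`|x| <= m) = [&& `|x.1.1| <= m, `|x.1.2| <= m & `|x.2| <= m].
Proof. by case: x => [[a b] c]; rewrite norm3E !ge_max /= andbA. Qed.

(** The hypothesis makes [B a - A a] a Lipschitz function of the point [A a]. The norm is the
    maximum of the coordinates, so extending each coordinate separately keeps the constant q < 1, as
    do the multiples by times in [0, 1]. *)
Lemma lip_isotopy_step (S : Type) (A B : S -> space R) (q : R) : 0 <= q < 1 ->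
  (forall a b, `|(B a - A a) - (B b - A b)| <= q * `|A a - A b|) ->
  ambient_isotopic (range A) (range B).
Proof.
move=> /andP[q0 q1] lAB.
have [D lD DA] : exists2 D : space R -> space R,
    (forall x y, `|D x - D y| <= q * `|x - y|) & forall a, D (A a) = B a - A a.
  have [[s0]|S0] := pselect (inhabited S); last first.
    exists (fun=> 0) => [x y|s]; first by rewrite subrr normr0 mulr_ge0.
    by case: S0; exists.
  have l1 a b : `|(B a - A a).1.1 - (B b - A b).1.1| <= q * `|A a - A b|.
    by have := lAB a b; rewrite norm3_le => /and3P[].
  have l2 a b : `|(B a - A a).1.2 - (B b - A b).1.2| <= q * `|A a - A b|.
    by have := lAB a b; rewrite norm3_le => /and3P[].
  have l3 a b : `|(B a - A a).2 - (B b - A b).2| <= q * `|A a - A b|.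
    by have := lAB a b; rewrite norm3_le => /and3P[].
  have [D1 lD1 D1A] := lip_extension s0 q0 l1.
  have [D2 lD2 D2A] := lip_extension s0 q0 l2.
  have [D3 lD3 D3A] := lip_extension s0 q0 l3.
  exists (fun x => ((D1 x, D2 x), D3 x)).
    by move=> x y; rewrite norm3_le /= lD1 lD2 lD3.
  by move=> a; rewrite D1A D2A D3A; case: (B a - A a) => [[]].
have cD := lip_continuous lD.
exists (fun tx => tx.2 + tx.1 *: D tx.2); split.
- apply: continuous_subspaceT => -[t x]; apply: cvgD; first exact: cvg_snd.
  apply: cvgZ; first exact: cvg_fst.
  have h := @cvg_comp _ _ _ (@snd R (space R)) D (nbhs (t, x)) (nbhs x) (nbhs (D x)) cvg_snd (cD x).
  exact: h.
- move=> t; rewrite inE /= in_itv /= => /andP[t0 t1].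
  apply: (@contraction_homeo (fun x => t *: D x) q); first by rewrite q0.
  move=> x y; rewrite -scalerBr normrZ ger0_norm //.
  by apply: le_trans (lD x y); rewrite ler_piMl.
- by move=> x; rewrite scale0r addr0.
- rewrite predeqE => z; split.
    by move=> [_ [a _ <-] <-] /=; exists a => //; rewrite DA scale1r addrC subrK.
  by move=> [a _ <-]; exists (A a); [exists a|rewrite /= DA scale1r addrC subrK].
Qed.

End Isotopy.

(** * Composition of ambient isotopies *)

Section Isotopy2.
Variable R : realType.
Implicit Types K : set (space R).

Lemma ambient_isotopic_refl K : ambient_isotopic K K.
Proof.
exists snd; split => //.
- by apply: continuous_subspaceT => x; exact: cvg_snd.
- move=> t _; split; first by move=> x; exact: cvg_id.
  by exists id; split=> // x; exact: cvg_id.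
- by rewrite predeqE => x; split; [move=> [y Ky <-]|move=> Kx; exists x].
Qed.

Lemma continuous_pair (X Y Z : topologicalType) (f : X -> Y) (g : X -> Z) :
  continuous f -> continuous g -> continuous (fun x => (f x, g x)).
Proof. by move=> cf cg x; exact: (cvg_pair (cf x) (cg x)). Qed.

Lemma within_continuous_comp (X Y Z : topologicalType) (B : set Y)
  (f : Y -> Z) (phi : X -> Y) :
  {within B, continuous f} -> continuous phi -> (forall x, B (phi x)) ->
  continuous (f \o phi).
Proof.
move=> /subspace_continuousP cf cphi Bphi x.
apply: (@cvg_comp _ _ _ phi f _ (within B (nbhs (phi x)))); last exact: cf.
move=> P; rewrite /within /= => /cphi; rewrite /nbhs /=.
by apply: filterS => y; apply.
Qed.

Lemma ambient_isotopic_trans K1 K2 K3 :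
  ambient_isotopic K1 K2 -> ambient_isotopic K2 K3 -> ambient_isotopic K1 K3.
Proof.
move=> [H1 [c1 h1 i1 e1]] [H2 [c2 h2 i2 e2]].
(* With times clamped into [0, 1], [H1] runs during the first half and [H2] during the second, and
   the composite is continuous on the whole line without pasting. *)
pose cl (t : R) : R := Num.max 0 (Num.min 1 t).
have cl01 t : 0 <= cl t <= 1.
  by rewrite /cl le_max lexx /= ge_max ler01 /= ge_min lexx.
have clc : continuous cl.
  move=> t; apply: continuous_max; first exact: cst_continuous.
  by apply: continuous_min; [exact: cst_continuous|exact: cvg_id].
have lin (a b : R) : continuous (fun t => cl (a * t + b)).
  move=> t; apply: (@continuous_comp _ _ _ (fun t => a * t + b) cl); last exact: clc.
  by apply: cvgD; [exact: mulrl_continuous|exact: cvg_cst].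
have mono (H : R * space R -> space R) (a b : R) :
    {within `[0, 1] `*` setT, continuous H} ->
    continuous (fun tx => H (cl (a * tx.1 + b), tx.2)).
  move=> cH; apply: (@within_continuous_comp _ _ _ _ H
    (fun tx : R * space R => (cl (a * tx.1 + b), tx.2)) cH).
    apply: continuous_pair => -[t x]; last exact: cvg_snd.
    have h := @cvg_comp _ _ _ (@fst R (space R)) (fun t => cl (a * t + b))
      (nbhs (t, x)) (nbhs t) (nbhs (cl (a * t + b))) cvg_fst (lin a b t).
    exact: h.
  by move=> -[t x]; split => //=; rewrite in_itv /= cl01.
have clE0 t : t <= 0 -> cl t = 0.
  by move=> t0; rewrite /cl; apply: max_l; rewrite ge_min t0 orbT.
have clE1 t : 1 <= t -> cl t = 1.
  by move=> t1; rewrite /cl min_l // max_r.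
exists (fun tx => H2 (cl (2 * tx.1 - 1), H1 (cl (2 * tx.1 + 0), tx.2))); split.
- apply: continuous_subspaceT => -[t x].
  have m1 := mono H1 2 0 c1; have m2 := mono H2 2 (- 1) c2.
  pose phi (tx : R * space R) := (tx.1, H1 (cl (2 * tx.1 + 0), tx.2)).
  have cphi : continuous phi.
    by apply: continuous_pair => y; [exact: cvg_fst|exact: m1].
  exact: (@cvg_comp _ _ _ phi (fun tx => H2 (cl (2 * tx.1 - 1), tx.2)) _
    (nbhs (phi (t, x))) _ (cphi (t, x)) (m2 _)).
- move=> t _ /=.
  have cl01' s : cl s \in `[0, 1]%classic by rewrite inE /= in_itv /= cl01.
  have [g1 [k1 [l1 m1 n1]]] := h1 _ (cl01' (2 * t + 0)).
  have [g2 [k2 [l2 m2 n2]]] := h2 _ (cl01' (2 * t - 1)).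
  split.
    by move=> x; apply: (@continuous_comp _ _ _ _ (fun y => H2 (cl (2 * t - 1), y)));
      [exact: g1|exact: g2].
  exists (k1 \o k2); split.
  + by move=> x; apply: continuous_comp; [exact: l2|exact: l1].
  + by move=> x /=; rewrite m2 m1.
  + by move=> x /=; rewrite n1 n2.
- by move=> x /=; rewrite clE0 ?i2; [rewrite clE0 ?i1 //|]; lra.
- rewrite predeqE => z /=; rewrite clE1 ?[cl (2 * 1 + 0)]clE1; [|lra|lra].
  split; first by move=> [x K1x <-]; rewrite -e2; exists (H1 (1, x)) => //; rewrite -e1; exists x.
  by rewrite -e2 -e1 => -[_ [x K1x <-] <-]; exists x.
Qed.

Lemma ambient_isotopic_chain (K : nat -> set (space R)) N :
  (forall i, (i < N)%N -> ambient_isotopic (K i) (K i.+1)) ->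
  ambient_isotopic (K 0%N) (K N).
Proof.
elim: N => [|N IH] h; first exact: ambient_isotopic_refl.
apply: ambient_isotopic_trans (IH _) (h N _) => // i iN; apply: h.
exact: ltnW.
Qed.

(* The displacement is Lipschitz with respect to every intermediate position, so
   for large N it moves in N steps by a contraction each. *)
Lemma lip_isotopy (S : Type) (A D : S -> space R) (C : R) :
  (forall t a b, 0 <= t <= 1 ->
     `|D a - D b| <= C * `|(A a + t *: D a) - (A b + t *: D b)|) ->
  ambient_isotopic (range A) (range (fun a => A a + D a)).
Proof.
move=> lD; pose N := (Num.truncn `|C|).+1.
have NC : `|C| < N%:R by rewrite /N truncnS_gt.
have N0 : 0 < N%:R :> R by rewrite ltr0n.
pose F i (a : S) := A a + (i%:R / N%:R) *: D a.
have F0 : F 0%N = A by apply/funext => a; rewrite /F mul0r scale0r addr0.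
have FN : F N = fun a => A a + D a.
  by apply/funext => a; rewrite /F divff ?scale1r // gt_eqF.
have <- : range (F 0%N) = range A by rewrite F0.
have <- : range (F N) = range (fun a => A a + D a) by rewrite FN.
apply: (@ambient_isotopic_chain (fun i => range (F i))) => i iN.
apply: (@lip_isotopy_step _ _ _ _ (`|C| / N%:R)).
  by rewrite divr_ge0 //= ltr_pdivrMr // mul1r.
move=> a b.
have E c : F i.+1 c - F i c = N%:R^-1 *: D c.
  by rewrite /F opprD addrACA subrr add0r -scalerBl -mulrBl -natrB // subSnn mul1r.
rewrite !E -scalerBr normrZ ger0_norm ?invr_ge0 ?ler0n // [leRHS]mulrAC [leRHS]mulrC.
rewrite ler_pM2l ?invr_gt0 //.
have ti : 0 <= (i%:R / N%:R : R) <= 1.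
  by rewrite divr_ge0 //= ler_pdivrMr // mul1r ler_nat ltnW.
apply: le_trans (lD _ a b ti) _; rewrite ler_wpM2r // ler_norm //.
Qed.

End Isotopy2.

(** * The open book *)

Section Pages.
Variable R : realType.
Implicit Types (p q t u x z m : R).

(** Piecewise linear functions are written as combinations of clamps: they are visibly Lipschitz,
    and the cases of [clampP] leave linear arithmetic. *)
Definition clamp u : R := Num.max 0 (Num.min 1 u).

Lemma clamp_ge0 u : 0 <= clamp u. Proof. by rewrite /clamp le_max lexx. Qed.

Lemma clamp_le1 u : clamp u <= 1.
Proof. by rewrite /clamp ge_max ler01 ge_min lexx. Qed.

Lemma clamp0 u : u <= 0 -> clamp u = 0.
Proof. by move=> u0; rewrite /clamp max_l // ge_min u0 orbT. Qed.

Lemma clamp1 u : 1 <= u -> clamp u = 1.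
Proof. by move=> u1; rewrite /clamp min_l // max_r. Qed.

Lemma clamp_id u : 0 <= u <= 1 -> clamp u = u.
Proof. by move=> /andP[u0 u1]; rewrite /clamp min_r // max_r. Qed.

Lemma clampP u :
  [\/ u <= 0 /\ clamp u = 0, 0 <= u <= 1 /\ clamp u = u | 1 <= u /\ clamp u = 1].
Proof.
have [u0|u0] := leP u 0; first by constructor 1; rewrite clamp0.
have [u1|u1] := leP 1 u; first by constructor 3; rewrite clamp1.
by constructor 2; rewrite clamp_id ?ltW.
Qed.

Lemma clamp_lip u v : `|clamp u - clamp v| <= `|u - v|.
Proof.
rewrite ler_norml; have := ler_norm (u - v); have := ler_norm (v - u).
rewrite (distrC v u).
by case: (clampP u) => -[? ->]; case: (clampP v) => -[? ->]; lra.
Qed.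

(* Page [p] is the half-plane of the points
   (n + r * page_x p, page_y0 p + r * page_y p, z) with [r > 0].  As [p] runs
   from 0 to 8 the pages turn once around the segment {n} x [0, 1] x {0}: up its
   left side, around its top, down its right side and around its bottom. *)
Definition page_y0 p : R := clamp p - clamp (p - 4).
Definition page_x p : R := - 1 + 2 * clamp (p - 2) - 2 * clamp (p - 6).
Definition page_y p : R :=
  clamp (p - 1) - clamp (p - 3) - clamp (p - 5) + clamp (p - 7).

(** On each unit interval the three page functions are affine, so this case analysis makes
    statements about pages linear. *)
Variant page_spec p : R -> R -> R -> Prop :=
| Page0 of 0 <= p <= 1 : page_spec p p (- 1) 0
| Page1 of 1 <= p <= 2 : page_spec p 1 (- 1) (p - 1)
| Page2 of 2 <= p <= 3 : page_spec p 1 (2 * p - 5) 1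
| Page3 of 3 <= p <= 4 : page_spec p 1 1 (4 - p)
| Page4 of 4 <= p <= 5 : page_spec p (5 - p) 1 0
| Page5 of 5 <= p <= 6 : page_spec p 0 1 (5 - p)
| Page6 of 6 <= p <= 7 : page_spec p 0 (13 - 2 * p) (- 1)
| Page7 of 7 <= p <= 8 : page_spec p 0 (- 1) (p - 8).

Lemma page_specE p a b c : page_spec p a b c ->
  [/\ page_y0 p = a, page_x p = b & page_y p = c].
Proof.
case=> h; rewrite /page_y0 /page_x /page_y; split.
- by rewrite clamp_id ?clamp0; lra.
- by rewrite !clamp0; lra.
- by rewrite !clamp0; lra.
- by rewrite clamp1 ?clamp0; lra.
- by rewrite !clamp0; lra.
- by rewrite clamp_id ?clamp0; lra.
- by rewrite clamp1 ?clamp0; lra.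
- by rewrite clamp_id ?clamp0; lra.
- by rewrite clamp1 ?clamp0; lra.
- by rewrite clamp1 ?clamp0; lra.
- by rewrite clamp1 ?clamp0; lra.
- by rewrite clamp1 ?(clamp_id (u := p - 3)) ?clamp0; lra.
- by rewrite clamp1 ?clamp_id; lra.
- by rewrite clamp1 ?clamp0; lra.
- by rewrite clamp1 ?(clamp1 (u := p - 3)) ?clamp0; lra.
- by rewrite !clamp1; lra.
- by rewrite clamp1 ?clamp0; lra.
- by rewrite clamp1 ?(clamp1 (u := p - 3)) ?(clamp_id (u := p - 5)) ?clamp0; lra.
- by rewrite !clamp1; lra.
- by rewrite clamp1 ?clamp_id; lra.
- by rewrite clamp1 ?(clamp1 (u := p - 3)) ?(clamp1 (u := p - 5)) ?clamp0; lra.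
- by rewrite !clamp1; lra.
- by rewrite !clamp1; lra.
- by rewrite clamp1 ?(clamp1 (u := p - 3)) ?(clamp1 (u := p - 5)) ?clamp_id; lra.
Qed.

Lemma pageP p : 0 <= p <= 8 -> page_spec p (page_y0 p) (page_x p) (page_y p).
Proof.
have E a b c : page_spec p a b c -> page_spec p (page_y0 p) (page_x p) (page_y p).
  by move=> h; have [-> -> ->] := page_specE h.
move=> /andP[p0 p8].
have [h1|/ltW h1] := leP p 1; first by apply: (E _ _ _ (Page0 _)); rewrite p0.
have [h2|/ltW h2] := leP p 2; first by apply: (E _ _ _ (Page1 _)); rewrite h1.
have [h3|/ltW h3] := leP p 3; first by apply: (E _ _ _ (Page2 _)); rewrite h2.
have [h4|/ltW h4] := leP p 4; first by apply: (E _ _ _ (Page3 _)); rewrite h3.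
have [h5|/ltW h5] := leP p 5; first by apply: (E _ _ _ (Page4 _)); rewrite h4.
have [h6|/ltW h6] := leP p 6; first by apply: (E _ _ _ (Page5 _)); rewrite h5.
have [h7|/ltW h7] := leP p 7; first by apply: (E _ _ _ (Page6 _)); rewrite h6.
by apply: (E _ _ _ (Page7 _)); rewrite h7.
Qed.

(** The triple of page functions traces a simple closed polygon with eight edges. Comparing edges
    pairwise bounds the arc, taken modulo 8, by the chord. *)
Lemma page_chord_arc p q m : 0 <= p <= 8 -> 0 <= q <= 8 ->
  `|page_y0 p - page_y0 q| <= m -> `|page_x p - page_x q| <= m ->
  `|page_y p - page_y q| <= m ->
  `|p - q| <= 8 * m \/ 8 - `|p - q| <= 8 * m.
Proof.
wlog pq : p q / p <= q => [hw hp hq h1 h2 h3|].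
  have [pq|/ltW qp] := leP p q; first exact: hw.
  by rewrite distrC; apply: hw => //; rewrite distrC.
move=> hp hq h1 h2 h3; rewrite distrC ger0_norm ?subr_ge0 //.
move: h1 h2 h3; rewrite !ler_norml.
by case: (pageP hp) => ?; case: (pageP hq) => ? ? ? ?;
  first [left; lra|right; lra].
Qed.

Lemma page_norm p : 0 <= p <= 8 ->
  [/\ `|page_x p| <= 1, `|page_y p| <= 1 & `|page_x p| = 1 \/ `|page_y p| = 1].
Proof.
move=> hp; rewrite !ler_norml; case: (pageP hp) => ?; rewrite ?normrN1 ?normr1;
  split; lra || by [left|right].
Qed.

Definition page_pt n p (c : R * R) : space R :=
  pt (n%:R + (n%:R - c.1) * page_x p) (page_y0 p + (n%:R - c.1) * page_y p) c.2.

(** Clamping the y-coordinate projects onto the segment around which the pages turn, so [page_y0]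
    can be read off from the point. *)
Lemma clamp_page (r : R) p : 0 <= r -> 0 <= p <= 8 ->
  clamp (page_y0 p + r * page_y p) = page_y0 p.
Proof.
move=> r0 hp; case: (pageP hp) => h; rewrite ?mulr0 ?addr0.
- by rewrite clamp_id.
- by rewrite clamp1 // lerDl mulr_ge0; lra.
- by rewrite clamp1 // lerDl mulr_ge0; lra.
- by rewrite clamp1 // lerDl mulr_ge0; lra.
- by rewrite clamp_id; lra.
- by rewrite clamp0 // add0r -oppr_ge0 -mulrN mulr_ge0; lra.
- by rewrite clamp0 // add0r -oppr_ge0 -mulrN mulr_ge0; lra.
- by rewrite clamp0 // add0r -oppr_ge0 -mulrN mulr_ge0; lra.
Qed.

(** By [page_norm] the radius is the maximum norm of [(r * page_x p, r * page_y p)]. *)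
Lemma page_radius_le (r r' m p q : R) : 0 <= r' -> 0 <= p <= 8 -> 0 <= q <= 8 ->
  0 <= r ->
  `|r * page_x p - r' * page_x q| <= m -> `|r * page_y p - r' * page_y q| <= m ->
  r <= r' + m.
Proof.
move=> r'0 hp hq r0 h1 h2.
have aux a b : `|a| = 1 -> `|b| <= 1 -> `|r * a - r' * b| <= m -> r <= r' + m.
  move=> a1 b1 h; have : `|r * a| <= `|r' * b| + m.
    by rewrite -lerBlDl (le_trans (lerB_dist _ _)).
  rewrite !normrM a1 mulr1 (ger0_norm r0) (ger0_norm r'0) => /le_trans; apply; rewrite lerD2r.
  by rewrite ler_piMr.
have [bx by' _] := page_norm hq.
by have [_ _ [e|e]] := page_norm hp; [apply: aux e bx h1|apply: aux e by' h2].
Qed.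

(** Removing [page_y0] leaves an error of [2 * m] in the planar part, which bounds the change of the
    radius [n - c.1]. This radius is at least 1, so the direction is known up to [4 * m]. *)
Lemma page_pt_bilip n p q (c d : R * R) m : 0 <= p <= 8 -> 0 <= q <= 8 ->
  c.1 <= n%:R - 1 -> d.1 <= n%:R - 1 -> `|page_pt n p c - page_pt n q d| <= m ->
  [/\ `|c.1 - d.1| <= 2 * m, `|c.2 - d.2| <= m,
      `|page_x p - page_x q| <= 4 * m, `|page_y p - page_y q| <= 4 * m &
      `|page_y0 p - page_y0 q| <= m].
Proof.
case: c d => [x z] [x' z'] /= hp hq hx hx'; rewrite norm3_le /= => /and3P[h1 h2 h3].
set r := n%:R - x in h1 h2 *; set r' := n%:R - x' in h1 h2 *.
have r1 : 1 <= r by rewrite /r; lra.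
have r1' : 1 <= r' by rewrite /r'; lra.
have b0 : `|page_y0 p - page_y0 q| <= m.
  have e : clamp (page_y0 p + r * page_y p) = page_y0 p by apply: clamp_page => //; lra.
  have e' : clamp (page_y0 q + r' * page_y q) = page_y0 q by apply: clamp_page => //; lra.
  by rewrite -e -e'; exact: le_trans (clamp_lip _ _) h2.
have hX : `|r * page_x p - r' * page_x q| <= 2 * m.
  move: h1; rewrite !ler_norml; lra.
have hY : `|r * page_y p - r' * page_y q| <= 2 * m.
  move: h2 b0; rewrite !ler_norml; lra.
have rr' : `|r - r'| <= 2 * m.
  have A : r <= r' + 2 * m by apply: page_radius_le hX hY => //; lra.
  have B : r' <= r + 2 * m.
    by apply: (page_radius_le _ hq hp); rewrite 1?distrC //; lra.
  by rewrite ler_norml; lra.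
have dir a b : `|b| <= 1 -> `|r * a - r' * b| <= 2 * m -> `|a - b| <= 4 * m.
  move=> b1 h; apply: (@le_trans _ _ (`|r * (a - b)|)).
    by rewrite normrM ler_peMl // ger0_norm; lra.
  have -> : r * (a - b) = (r * a - r' * b) - (r - r') * b by ring.
  apply: le_trans (ler_normB _ _) _; rewrite normrM.
  have : `|r - r'| * `|b| <= 2 * m.
    by apply: le_trans rr'; rewrite ler_piMr.
  by lra.
have [b1 b2 _] := page_norm hq.
split => //; [|exact: dir|exact: dir].
by move: rr'; rewrite !ler_norml /r /r'; lra.
Qed.
End Pages.

(** * Homotopies of closed paths of configurations *)

Section Loops.
Variables (R : realType) (n : nat).
Implicit Types (p q t B c m : R) (s : 'S_n).

Notation conf := ('I_n -> R * R)%type.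

Definition lerp (V : lmodType R) t (a b : V) : V := a + t *: (b - a).

Lemma norm2_le (x : R * R) m : (`|x| <= m) = (`|x.1| <= m) && (`|x.2| <= m).
Proof. by case: x => a b; rewrite prod_normE ge_max. Qed.

Lemma lerp_dist (V : normedModType R) t (a a' b b' : V) m :
  0 <= t <= 1 -> `|a - a'| <= m -> `|b - b'| <= m ->
  `|lerp t a b - lerp t a' b'| <= m.
Proof.
move=> /andP[t0 t1] ha hb.
have -> : lerp t a b - lerp t a' b' = (1 - t) *: (a - a') + t *: (b - b').
  have e : b - a - (b' - a') = (b - b') - (a - a') by rewrite !opprB addrACA [in RHS]addrACA (addrC (- a)).
  by rewrite /lerp opprD addrACA -scalerBr e scalerBr scalerBl scale1r addrA addrAC.
apply: le_trans (ler_normD _ _) _; rewrite !normrZ !ger0_norm ?subr_ge0 //.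
have : (1 - t) * `|a - a'| <= (1 - t) * m by rewrite ler_wpM2l // subr_ge0.
have : t * `|b - b'| <= t * m by rewrite ler_wpM2l.
by lra.
Qed.

(* [G p] gives the positions of the strands in the half-plane of page [p];
   strand [j] continues as strand [s j] after one turn. *)
Definition loop s B (G : R -> conf) : Prop :=
  [/\ 0 <= B,
      forall p q j, 0 <= p <= 8 -> 0 <= q <= 8 -> `|G p j - G q j| <= B * `|p - q|,
      forall p j, 0 <= p <= 8 -> (G p j).1 <= n%:R - 1 &
      forall j, G 8 j = G 0 (s j)].

Definition loop_set (G : R -> conf) : set (space R) :=
  [set page_pt n jp.2 (G jp.2 jp.1) | jp in [set jp : 'I_n * R | 0 <= jp.2 <= 8]].

Lemma loop_lerp s B G0 G1 t : 0 <= t <= 1 -> loop s B G0 -> loop s B G1 ->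
  loop s B (fun p j => lerp t (G0 p j) (G1 p j)).
Proof.
move=> t01 [B0 l0 x0 e0] [_ l1 x1 e1]; split => //.
- by move=> p q j hp hq; apply: lerp_dist => //; [exact: l0|exact: l1].
- move=> p j hp; have := x0 p j hp; have := x1 p j hp; case/andP: t01 => t0 t1 /=.
  rewrite /lerp /=; move: (G0 p j).1 (G1 p j).1 => a b hb ha.
  have : (1 - t) * a <= (1 - t) * (n%:R - 1) by rewrite ler_wpM2l // subr_ge0.
  have : t * b <= t * (n%:R - 1) by rewrite ler_wpM2l.
  by rewrite /GRing.scale /=; lra.
- by move=> j; rewrite e0 e1.
Qed.

(** [k'] is strand [k] followed from page [q] to page [p] along the short arc, which may pass the
    closing page. It depends on [s] only, so the same [k'] serves both ends of a homotopy. *)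
Lemma loop_transfer s p q r k : 0 <= p <= 8 -> 0 <= q <= 8 ->
  `|p - q| <= r \/ 8 - `|p - q| <= r ->
  exists k', forall B G, loop s B G -> `|G q k - G p k'| <= B * r.
Proof.
move=> hp hq [pq|pq].
  exists k => B G [B0 l _ _]; apply: le_trans (l _ _ _ hq hp) _.
  by rewrite ler_wpM2l // distrC.
have h0 : 0 <= (0 : R) <= 8 by lra.
have h8 : 0 <= (8 : R) <= 8 by lra.
have [le_pq|lt_qp] := leP p q.
  exists (s k) => B G [B0 l _ e].
  have -> : G q k - G p (s k) = (G q k - G 8 k) + (G 0 (s k) - G p (s k)).
    by rewrite e addrA subrK.
  apply: le_trans (ler_normD _ _) _.
  apply: le_trans (lerD (l _ _ _ hq h8) (l _ _ _ h0 hp)) _.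
  rewrite -mulrDr ler_wpM2l //; apply: le_trans pq.
  by rewrite (ler0_norm (_ : q - 8 <= 0)) ?(ler0_norm (_ : 0 - p <= 0)) ?(ler0_norm (_ : p - q <= 0)); lra.
exists ((s^-1)%g k) => B G [B0 l _ e].
have -> : G q k - G p ((s^-1)%g k) =
    (G q k - G 0 k) + (G 8 ((s^-1)%g k) - G p ((s^-1)%g k)).
  by rewrite e permKV addrA subrK.
apply: le_trans (ler_normD _ _) _.
apply: le_trans (lerD (l _ _ _ hq h0) (l _ _ _ h8 hp)) _.
rewrite -mulrDr ler_wpM2l //; apply: le_trans pq.
by rewrite (ger0_norm (_ : 0 <= q - 0)) ?(ger0_norm (_ : 0 <= 8 - p)) ?(ger0_norm (_ : 0 <= p - q)); lra.
Qed.

Lemma loop_bound s B G : loop s B G ->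
  exists2 A, 0 <= A & forall p j, 0 <= p <= 8 -> `|G p j| <= A.
Proof.
move=> [B0 l _ _]; exists (\sum_j `|G 0 j| + B * 8).
  by rewrite addr_ge0 ?sumr_ge0 // mulr_ge0.
move=> p j hp; have h0 : 0 <= (0 : R) <= 8 by lra.
have -> : G p j = G 0 j + (G p j - G 0 j) by rewrite addrC subrK.
apply: le_trans (ler_normD _ _) _; apply: lerD.
  by rewrite (bigD1 j) //= lerDl sumr_ge0.
apply: le_trans (l _ _ _ hp h0) _; rewrite subr0 ler_wpM2l // ger0_norm; lra.
Qed.

Lemma page_ptB p (a b : R * R) :
  page_pt n p b - page_pt n p a =
  pt (- (b.1 - a.1) * page_x p) (- (b.1 - a.1) * page_y p) (b.2 - a.2).
Proof.
rewrite /page_pt /pt; congr (_, _, _) => //=; ring.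
Qed.

Lemma page_pt_lerp p t (a b : R * R) :
  page_pt n p a + t *: (page_pt n p b - page_pt n p a) = page_pt n p (lerp t a b).
Proof.
rewrite page_ptB /page_pt /pt /lerp; congr (_, _, _) => /=; rewrite /GRing.scale /=; ring.
Qed.

(** For two points at distance [m], strand [k] on page [q] is replaced by its continuation [k'] on
    page [p]. If [j = k'], the displacements differ by a multiple of [m] since the loops are
    Lipschitz. Otherwise the gap [c] bounds [m] from below, and the total bound on displacements
    suffices. *)
Theorem loop_isotopy s B c G0 G1 : 0 < c -> loop s B G0 -> loop s B G1 ->
  (forall t p j k, 0 <= t <= 1 -> 0 <= p <= 8 -> j != k ->
     c <= `|lerp t (G0 p j) (G1 p j) - lerp t (G0 p k) (G1 p k)|) ->
  ambient_isotopic (loop_set G0) (loop_set G1).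
Proof.
move=> c0 L0 L1 sep.
pose S := {jp : 'I_n * R | 0 <= jp.2 <= 8}.
pose F0 (a : S) := page_pt n (sval a).2 (G0 (sval a).2 (sval a).1).
pose F1 (a : S) := page_pt n (sval a).2 (G1 (sval a).2 (sval a).1).
have rE G : loop_set G =
    range (fun a : S => page_pt n (sval a).2 (G (sval a).2 (sval a).1)).
  rewrite predeqE => x; split; first by move=> [jp hp <-]; exists (exist _ jp hp).
  by move=> [[jp hp] _ <-]; exists jp.
have -> : loop_set G0 = range F0 by rewrite rE.
have -> : loop_set G1 = range (fun a => F0 a + (F1 a - F0 a)).
  by rewrite rE; congr (image setT); apply/funext => a; rewrite addrC subrK.
have [A0 A0ge bd0] := loop_bound L0; have [A1 A1ge bd1] := loop_bound L1.
have Bge : 0 <= B by case: L0.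
pose A := A0 + A1.
(* [4 * A] accounts for the turning of the page, [64 * B] for the transfer in both loops, over an
   arc of [8 * (4 * m)], and the last term for distinct strands, where [c <= (2 + 32 * B) * m]. *)
pose C := 4 * A + 64 * B + 2 * A * ((2 + 32 * B) / c).
apply: (@lip_isotopy _ _ _ _ C) => t [[j p] /= hp] [[k q] /= hq] t01.
rewrite /F0 /F1 /= !page_pt_lerp; set m := `|page_pt n p _ - _|.
have m0 : 0 <= m by exact: normr_ge0.
have [_ _ xt _] := loop_lerp t01 L0 L1.
have [] := @page_pt_bilip R n p q _ _ m hp hq (xt _ j hp) (xt _ k hq) (lexx _).
set u := lerp t _ _; set v := lerp t _ _ => h1 h2 h3 h4 h5.
have h5' : `|page_y0 p - page_y0 q| <= 4 * m by lra.
have [k' tr] := @loop_transfer s p q _ k hp hq (page_chord_arc hp hq h5' h3 h4).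
have t0 : 0 <= (0 : R) <= 1 by lra.
have t1 : 0 <= (1 : R) <= 1 by lra.
have aux (a b b' : R * R) : a - b' = (a - b) - (b' - b) by rewrite opprB addrA subrK.
have Age : 0 <= A by rewrite addr_ge0.
have rge : 0 <= (2 + 32 * B) / c by rewrite divr_ge0 ?(ltW c0) //; lra.
pose d i := G1 p i - G0 p i.
pose e := G1 q k - G0 q k.
have dA i : `|d i| <= A.
  by rewrite /A addrC; apply: le_trans (ler_normB _ _) _; rewrite lerD ?bd0 ?bd1.
have eA : `|e| <= A.
  by rewrite /A addrC; apply: le_trans (ler_normB _ _) _; rewrite lerD ?bd0 ?bd1.
have ed : `|e - d k'| <= 64 * B * m.
  have -> : e - d k' = (G1 q k - G1 p k') - (G0 q k - G0 p k').
    by rewrite /e /d !opprB addrACA [in RHS]addrACA (addrC (- G0 q k)).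
  apply: le_trans (ler_normB _ _) _.
  by have := tr _ _ L0; have := tr _ _ L1; lra.
have dd : `|d j - e| <= (64 * B + 2 * A * ((2 + 32 * B) / c)) * m.
  rewrite (_ : d j - e = (d j - d k') - (e - d k')); last exact: aux.
  apply: le_trans (ler_normB _ _) _.
  rewrite mulrDl addrC lerD //.
  have [->|jk] := eqVneq j k'.
    by rewrite subrr normr0; apply: mulr_ge0 => //; apply: mulr_ge0 => //; exact: mulr_ge0.
  have : c <= (2 + 32 * B) * m.
    apply: le_trans (sep t p j k' t01 hp jk) _; rewrite -/u.
    rewrite -[u](subrK v) -addrA; apply: le_trans (ler_normD _ _) _.
    rewrite mulrDl lerD //.
      rewrite norm2_le h1 /=; lra.
    have := tr _ _ (loop_lerp t01 L0 L1); rewrite -/v /=; lra.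
  move=> h; apply: le_trans (ler_normB _ _) _.
  apply: (@le_trans _ _ (2 * A)).
    by have := dA j; have := dA k'; lra.
  rewrite -(mulrA (2 * A)) ler_peMr ?mulr_ge0 //.
  by rewrite mulrAC ler_pdivlMr // mul1r.
have [px1 py1 _] := page_norm hp.
rewrite !page_ptB norm3_le /= -!/(d _) -/e.
move: dd eA; rewrite !norm2_le /= -/(d j) => /andP[dd1 dd2] /andP[eA1 _].
have dir a b : `|a| <= 1 -> `|a - b| <= 4 * m ->
    `|- (d j).1 * a - - e.1 * b| <= C * m.
  move=> a1 ab.
  have -> : - (d j).1 * a - - e.1 * b = - (((d j).1 - e.1) * a) - e.1 * (a - b) by ring.
  apply: le_trans (ler_normB _ _) _; rewrite normrN !normrM.
  have : `|(d j).1 - e.1| * `|a| <= (64 * B + 2 * A * ((2 + 32 * B) / c)) * m.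
    by apply: le_trans dd1; rewrite ler_piMr.
  have : `|e.1| * `|a - b| <= A * (4 * m) by apply: ler_pM.
  by rewrite /C; lra.
rewrite dir // dir //= /C (le_trans dd2) //.
by rewrite ler_wpM2r //; lra.
Qed.
End Loops.

(** * Piecewise linear paths of configurations *)

Section Lists.
Variables (R : realType) (n : nat).
Implicit Types (p q t u B : R) (s : 'S_n).

Notation conf := ('I_n -> R * R)%type.
Implicit Types (a b c d : conf) (l m : seq conf).

(** The step that starts at time [i] contributes its increment times [clamp (u - i)]: one sum for
    all [u], with a Lipschitz bound term by term. *)
Fixpoint increments a l u (j : 'I_n) : R * R :=
  if l is b :: l' then clamp u *: (b j - a j) + increments b l' (u - 1) j else 0.

(* The piecewise linear path through the configurations [l], at the times 0, 1, ... *)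
Definition plpath l u : conf :=
  if l is a :: l' then fun j => a j + increments a l' u j else fun=> 0.

Lemma increments0 a l u j : u <= 0 -> increments a l u j = 0.
Proof.
elim: l a u => //= b l IH a u u0; rewrite clamp0 // scale0r add0r IH //; lra.
Qed.

Lemma plpath_eval a l k t j : (k < size l)%N -> 0 <= t <= 1 ->
  plpath (a :: l) (k%:R + t) j =
  lerp t (nth a (a :: l) k j) (nth a (a :: l) k.+1 j).
Proof.
move=> + t01; elim: l a k => //= b l IH a [|k] kl.
  by rewrite add0r increments0 ?addr0 ?clamp_id //; lra.
have e : k.+1%:R + t - 1 = k%:R + t by rewrite -natr1; lra.
rewrite clamp1; last by rewrite -natr1; have := ler0n R k; lra.
rewrite scale1r e [LHS]addrA (addrC (a j)) subrK.
have := IH b k kl; rewrite /= => ->.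
by rewrite (set_nth_default b) ?(set_nth_default b a) //= ltnW.
Qed.

Lemma level_split (N : nat) u : 0 <= u <= N.+1%:R ->
  exists k t, [/\ (k < N.+1)%N, 0 <= t <= 1 & u = k%:R + t].
Proof.
elim: N u => [|N IH] u /andP[u0 uN].
  by exists 0%N, u; rewrite add0r u0.
have [uN'|uN'] := leP u N.+1%:R.
  have [|k [t [kN t01 ->]]] := IH u; first by rewrite u0.
  by exists k, t; split => //; exact: ltnW.
exists N.+1, (u - N.+1%:R); split => //; first by move: uN; rewrite -[in N.+2%:R]natr1; lra.
by rewrite addrC subrK.
Qed.

Lemma plpath_end l j : plpath l (size l).-1%:R j = last (fun=> 0) l j.
Proof.
case: l => //= a l; elim: l a => /= [|b l IH] a; first by rewrite addr0.
rewrite clamp1 ?scale1r; last by rewrite ler1n.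
by rewrite addrA (addrC (a j)) subrK -natr1 addrK IH.
Qed.

Lemma plpath_start l j : plpath l 0 j = head (fun=> 0) l j.
Proof. by case: l => //= a l; rewrite increments0 ?addr0. Qed.

Lemma plpath_lip l : exists2 B, 0 <= B &
  forall u v j, `|plpath l u j - plpath l v j| <= B * `|u - v|.
Proof.
case: l => [|a l] /=.
  by exists 0 => // u v j; rewrite subrr normr0 mul0r.
suff [B B0 h] : exists2 B, 0 <= B & forall u v j,
    `|increments a l u j - increments a l v j| <= B * `|u - v|.
  by exists B => // u v j; rewrite opprD addrACA subrr add0r.
elim: l a => [|b l IH] a /=.
  by exists 0 => // u v j; rewrite subrr normr0 mul0r.
have [B B0 h] := IH b; exists (\sum_j `|b j - a j| + B).
  by rewrite addr_ge0 // sumr_ge0.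
move=> u v j; rewrite opprD addrACA -scalerBl.
apply: le_trans (ler_normD _ _) _; rewrite mulrDl lerD //.
  rewrite normrZ mulrC ler_pM // ?clamp_lip //.
  by rewrite (bigD1 j) //= lerDl sumr_ge0.
apply: le_trans (h _ _ _) _; rewrite (_ : u - 1 - (v - 1) = u - v) //; lra.
Qed.

(* Positivity of [v] in a lexicographic order; a convex combination of positive
   vectors is positive, hence nonzero. *)
Definition lexpos (o : (R * R) * (R * R)) (v : R * R) : Prop :=
  0 < o.1.1 * v.1 + o.1.2 * v.2 \/
  o.1.1 * v.1 + o.1.2 * v.2 = 0 /\ 0 < o.2.1 * v.1 + o.2.2 * v.2.

Lemma lexpos_lerp o t x y : 0 <= t <= 1 -> lexpos o x -> lexpos o y ->
  lexpos o (lerp t x y).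
Proof.
case: o => -[a1 a2] [b1 b2]; case: x => x1 x2; case: y => y1 y2.
move=> /andP[t0 t1]; rewrite /lexpos /lerp /= /GRing.scale /=.
have E p q : p * (x1 + t * (y1 - x1)) + q * (x2 + t * (y2 - x2)) =
  (1 - t) * (p * x1 + q * x2) + t * (p * y1 + q * y2) by ring.
rewrite !E.
set X := a1 * x1 + _; set Y := a1 * y1 + _.
set X' := b1 * x1 + _; set Y' := b1 * y1 + _.
have conv p q : 0 < p -> 0 < q -> 0 < (1 - t) * p + t * q.
  move=> p0 q0; have [->|tn] := eqVneq t 0; first by rewrite subr0 mul1r mul0r addr0.
  apply: ltr_wpDl; first by rewrite mulr_ge0 ?subr_ge0 // ltW.
  by rewrite mulr_gt0 // lt_def tn.
case=> [hX|[-> hX]]; case=> [hY|[-> hY]].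
- by left; exact: conv.
- rewrite mulr0 addr0; have [->|tn] := eqVneq t 1.
    by right; rewrite subrr !mul0r mul1r add0r.
  by left; rewrite mulr_gt0 // subr_gt0 lt_def eq_sym tn.
- rewrite mulr0 add0r; have [->|tn] := eqVneq t 0.
    by right; rewrite subr0 !mul0r mul1r addr0.
  by left; rewrite mulr_gt0 // lt_def tn.
- by right; rewrite !mulr0 addr0; split => //; exact: conv.
Qed.

Lemma lexpos_neq0 o (v : R * R) : lexpos o v -> v != 0.
Proof.
case: v => v1 v2 h; apply/eqP => -[e1 e2]; move: h.
by rewrite /lexpos /= e1 e2 !mulr0 addr0 ltxx; case=> [//|[]].
Qed.

(** A single order [o] serves the whole list, as positivity of convex combinations requires. *)
Fixpoint lexpos_all o (j k : 'I_n) l : Prop :=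
  if l is c :: l' then lexpos o (c j - c k) /\ lexpos_all o j k l' else True.

(* All convex combinations of the configurations [l] have distinct strands. *)
Definition separated l : Prop :=
  forall j k : 'I_n, (j < k)%N -> exists o, lexpos_all o j k l.

Lemma lerpB (V : lmodType R) t (x y x' y' : V) :
  lerp t x y - lerp t x' y' = lerp t (x - x') (y - y').
Proof.
rewrite /lerp opprD addrACA -scalerBr !opprB; congr (_ + t *: _).
by rewrite addrACA [in RHS]addrACA (addrC (- x)).
Qed.

Lemma bigmin_witness (I : finType) (P : I -> R -> Prop) :
  (forall i x y, 0 < x -> x <= y -> P i y -> P i x) ->
  (forall i, exists2 x, 0 < x & P i x) -> exists2 x, 0 < x & forall i, P i x.
Proof.
move=> mono ex.
have [f h] : exists f, forall i, 0 < f i /\ P i (f i).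
  have ex' i : exists x, 0 < x /\ P i x by have [x] := ex i; exists x.
  by have [f] := choice ex'; exists f.
have h1 i : 0 < f i by case: (h i).
have h2 i : P i (f i) by case: (h i).
exists (\big[Num.min/1]_i f i).
  by apply: (big_ind (fun x => 0 < x)) => // x y x0 y0; rewrite lt_min x0.
move=> i; apply: mono (h2 i).
  by apply: (big_ind (fun x => 0 < x)) => // x y x0 y0; rewrite lt_min x0.
by rewrite (bigD1 i) //= ge_min lexx.
Qed.

(** A cell of a homotopy, time step by homotopy parameter, is bilinear in its four corners: the
    difference of the strands vanishes nowhere, and its norm has a minimum on the compact square. *)
Lemma quad_gap a b a' b' j k : (exists o, lexpos_all o j k [:: a; b; a'; b']) ->
  exists2 x, 0 < x & forall t v, 0 <= t <= 1 -> 0 <= v <= 1 ->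
    x <= `|lerp t (lerp v (a j) (b j)) (lerp v (a' j) (b' j)) -
           lerp t (lerp v (a k) (b k)) (lerp v (a' k) (b' k))|.
Proof.
case=> o /= [ha [hb [ha' [hb' _]]]].
pose f (x : R * R) := `|lerp x.1 (lerp x.2 (a j - a k) (b j - b k))
                                (lerp x.2 (a' j - a' k) (b' j - b' k))|.
have cl (y z : R * R -> R * R) (w : R * R -> R) : continuous y -> continuous z ->
    continuous w -> continuous (fun x => lerp (w x) (y x) (z x)).
  move=> cy cz cw x; apply: cvgD; first exact: cy.
  by apply: cvgZ; [exact: cw|apply: cvgB; [exact: cz|exact: cy]].
have cf : continuous f.
  have ccst (y : R * R) : continuous (fun _ : R * R => y) by exact: cst_continuous.
  have c1 : continuous (@fst R R) by move=> x; exact: cvg_fst.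
  have c2 : continuous (@snd R R) by move=> x; exact: cvg_snd.
  have c3 := cl _ _ _ (cl _ _ _ (ccst _) (ccst _) c2) (cl _ _ _ (ccst _) (ccst _) c2) c1.
  by move=> x; exact: cvg_norm (c3 _ _ _ _ x).
pose Q := `[0, 1]%classic `*` `[0, 1]%classic : set (R * R).
have Q0 : Q !=set0 by exists (0, 0); split; rewrite /= in_itv /= lexx ler01.
have cQ : compact Q by apply: compact_setX; exact: segment_compact.
have [x] := compact_EVT_min Q0 cQ (continuous_subspaceT cf).
rewrite inE => -[]; rewrite /= !in_itv /= => x1 x2 xmin.
exists (f x).
  rewrite normr_gt0; apply: (@lexpos_neq0 o).
  by apply: lexpos_lerp => //; apply: lexpos_lerp.
move=> t v t01 v01; rewrite !lerpB; apply: (xmin (t, v)).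
by rewrite inE; split; rewrite /= in_itv /=.
Qed.
End Lists.

Arguments plpath : simpl never.

(** * Straight homotopies between piecewise linear paths *)

Section ListIsotopy.
Variables (R : realType) (n : nat).
Implicit Types (p q t u B : R) (s : 'S_n).

Notation conf := ('I_n -> R * R)%type.
Implicit Types (a b c d : conf) (l m : seq conf).

(* The straight homotopy between the paths [l] and [l'] keeps strands distinct. *)
Fixpoint quads l l' : Prop :=
  match l, l' with
  | a :: l1, a' :: l1' =>
    match l1, l1' with
    | b :: _, b' :: _ => separated [:: a; b; a'; b'] /\ quads l1 l1'
    | [::], [::] => separated [:: a; a']
    | _, _ => False
    end
  | _, _ => False
  end.

Lemma separated_sub l m : separated l ->
  (forall o j k, lexpos_all o j k l -> lexpos_all o j k m) -> separated m.
Proof. by move=> h sub j k jk; have [w hw] := h j k jk; exists w; exact: sub. Qed.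

Lemma quads_size l l' : quads l l' -> size l = size l'.
Proof.
elim: l l' => [|a [|b l] IH] [|a' [|b' l']] //= [_ h].
by congr _.+1; exact: (IH (b' :: l')).
Qed.

Lemma quads_head a l a' l' : quads (a :: l) (a' :: l') -> separated [:: a; a'].
Proof.
case: l l' => [|b l] [|b' l'] //= [h _].
by apply: separated_sub h _ => o j k /=; tauto.
Qed.

Lemma quads_nth l l' x0 k : quads l l' -> (k.+1 < size l)%N ->
  separated [:: nth x0 l k; nth x0 l k.+1; nth x0 l' k; nth x0 l' k.+1].
Proof.
elim: l l' k => [|a [|b l] IH] [|a' [|b' l']] // [|k] [h1 h2] // kl.
exact: (IH (b' :: l') k).
Qed.

Lemma quads_cat l1 l1' a a' m m' : size l1 = size l1' ->
  (quads (l1 ++ a :: m) (l1' ++ a' :: m') <->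
   quads (rcons l1 a) (rcons l1' a') /\ quads (a :: m) (a' :: m')).
Proof.
elim: l1 l1' => [|c [|d l1] IH] [|c' [|d' l1']] //=.
- by move=> _; split=> [h|[]] //; split=> //; exact: quads_head h.
- move=> _; split=> [[h1 h2]|[[h1 h2] h3]] //; split=> //; split => //.
  exact: quads_head h2.
- move=> [e]; have := IH (d' :: l1'); rewrite /= e => /(_ erefl) {}IH.
  by split=> [[h1 /IH[]]|[[h1 h2] h3]] //; split => //; apply/IH.
Qed.

Lemma quads_refl_l l l' : quads l l' -> quads l l.
Proof.
elim: l l' => [|a [|b l] IH] [|a' [|b' l']] //=.
  by move=> h; apply: separated_sub h _ => o j k /=; tauto.
move=> [h /(IH (b' :: l')) h2]; split => //.
by apply: separated_sub h _ => o j k /=; tauto.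
Qed.

Lemma quads_sym l l' : quads l l' -> quads l' l.
Proof.
elim: l l' => [|a [|b l] IH] [|a' [|b' l']] //=.
  by move=> h; apply: separated_sub h _ => o j k /=; tauto.
move=> [h /(IH (b' :: l')) h2]; split => //.
by apply: separated_sub h _ => o j k /=; tauto.
Qed.

Fixpoint xbounded l : Prop :=
  if l is c :: l' then (forall j, (c j).1 <= n%:R - 1) /\ xbounded l' else True.

Lemma xbounded_cat l m : xbounded (l ++ m) <-> xbounded l /\ xbounded m.
Proof. by elim: l => /= [|c l IH]; [split=> [?|[]]|rewrite IH; tauto]. Qed.

Lemma xbounded_nth l x0 k j : xbounded l -> (k < size l)%N ->
  (nth x0 l k j).1 <= n%:R - 1.
Proof. by elim: l k => //= c l IH [|k] [h1 h2] //; exact: IH. Qed.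

(* A closed path of configurations, strand [j] of the end being strand [s j] of
   the start. *)
Definition good s l : Prop :=
  [/\ quads l l, xbounded l &
      forall j, last (fun=> 0) l j = head (fun=> 0) l (s j)].

(** Time changes from the pages [0, 8] to the path time [0, N]. They form a convex set, so any two
    are joined by a straight line of time changes; they may pause, which lets a path be synchronized
    with given pages. *)
Definition param (N : nat) (psi : R -> R) : Prop :=
  [/\ exists2 B, 0 <= B & forall p q, 0 <= p <= 8 -> 0 <= q <= 8 ->
        `|psi p - psi q| <= B * `|p - q|,
      psi 0 = 0, psi 8 = N%:R &
      forall p, 0 <= p <= 8 -> 0 <= psi p <= N%:R].

Definition path_set l (psi : R -> R) := loop_set (fun p => plpath l (psi p)).

Lemma good_size s l : good s l -> (0 < size l)%N.
Proof. by case: l => [[]|]. Qed.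

Lemma path_split l l' u : size l = size l' -> (1 < size l)%N ->
  0 <= u <= (size l).-1%:R ->
  exists k t, [/\ (k.+1 < size l)%N, 0 <= t <= 1 &
    forall j, plpath l u j = lerp t (nth (fun=> 0) l k j) (nth (fun=> 0) l k.+1 j) /\
              plpath l' u j = lerp t (nth (fun=> 0) l' k j) (nth (fun=> 0) l' k.+1 j)].
Proof.
case: l l' => [|a [|b l]] // [|a' l'] // [e] _ /=.
move=> /level_split[k [t [kl t01 ->]]]; exists k, t; split => // j.
rewrite !plpath_eval //; last by rewrite -e.
have kl' : (k < size l')%N by rewrite -e.
split; congr lerp; rewrite (set_nth_default (fun=> 0)) //=; exact: ltnW.
Qed.

Lemma good_loop s l psi : good s l -> param (size l).-1 psi ->
  exists2 B, 0 <= B & forall B', B <= B' -> loop s B' (fun p => plpath l (psi p)).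
Proof.
move=> gl [[B B0 lpsi] psi0 psi8 bpsi].
have [_ xb cl] := gl.
have [C C0 lC] := plpath_lip l; exists (C * B); first exact: mulr_ge0.
move=> B' BB'; split.
- by apply: le_trans BB'; exact: mulr_ge0.
- move=> p q j hp hq; apply: le_trans (lC _ _ _) _.
  apply: (@le_trans _ _ (C * (B * `|p - q|))); first by rewrite ler_wpM2l // lpsi.
  by rewrite mulrA ler_wpM2r.
- move=> p j hp; have := good_size gl.
  rewrite leq_eqVlt => /orP[/eqP e|l1].
    case: l e xb {gl cl lC psi8 bpsi} => [|a [|]] //= _ [h _].
    by rewrite addr0.
  have [k [t [kl t01 h]]] := path_split erefl l1 (bpsi p hp).
  have [-> _] := h j.
  have h1 := xbounded_nth (fun=> 0) j xb kl.
  have h2 := xbounded_nth (fun=> 0) j xb (ltnW kl).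
  rewrite /lerp /= /GRing.scale /=; move: h1 h2 t01.
  set x := (nth _ l k.+1 j).1; set y := (nth _ l k j).1 => h1 h2 /andP[t0 t1].
  have : t * x <= t * (n%:R - 1) by rewrite ler_wpM2l.
  have : (1 - t) * y <= (1 - t) * (n%:R - 1) by rewrite ler_wpM2l // subr_ge0.
  by lra.
- by move=> j; rewrite psi8 psi0 plpath_end plpath_start.
Qed.

Lemma path_gap l l' : quads l l' -> (1 < size l)%N ->
  exists2 x, 0 < x & forall t u j k, 0 <= t <= 1 -> 0 <= u <= (size l).-1%:R ->
    j != k ->
    x <= `|lerp t (plpath l u j) (plpath l' u j) -
           lerp t (plpath l u k) (plpath l' u k)|.
Proof.
move=> Q l1.
pose nl i := nth (fun=> 0 : R * R) l i; pose nl' i := nth (fun=> 0 : R * R) l' i.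
pose P (i : 'I_(size l).-1 * ('I_n * 'I_n)) x :=
  forall t v, 0 <= t <= 1 -> 0 <= v <= 1 -> i.2.1 != i.2.2 ->
    x <= `|lerp t (lerp v (nl i.1 i.2.1) (nl i.1.+1 i.2.1))
                  (lerp v (nl' i.1 i.2.1) (nl' i.1.+1 i.2.1)) -
           lerp t (lerp v (nl i.1 i.2.2) (nl i.1.+1 i.2.2))
                  (lerp v (nl' i.1 i.2.2) (nl' i.1.+1 i.2.2))|.
have [] := @bigmin_witness R _ P.
- by move=> i x y _ xy h t v t01 v01 ij; apply: le_trans xy _; exact: h.
- move=> [i [j k]]; have il : (i.+1 < size l)%N by rewrite -ltn_predRL.
  have S := quads_nth (fun=> 0) Q il.
  have [jk|kj|/val_inj->] := ltngtP j k.
  + have [x x0 h] := quad_gap (S j k jk).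
    by exists x => // t v t01 v01 _; exact: h.
  + have [x x0 h] := quad_gap (S k j kj).
    by exists x => // t v t01 v01 _; rewrite distrC; exact: h.
  + by exists 1 => // t v _ _; rewrite eqxx.
move=> x x0 h; exists x => // t u j k t01 hu jk.
have [i [v [il v01 e]]] := path_split (quads_size Q) l1 hu.
have [-> ->] := e j; have [-> ->] := e k.
by have il' : (i < (size l).-1)%N; [rewrite ltn_predRL|exact: (h (Ordinal il', (j, k)))].
Qed.
End ListIsotopy.

(** * Time changes and waiting *)

Section PathEquivalence.
Variables (R : realType) (n : nat).
Implicit Types (p q t u B : R) (s : 'S_n).

Notation conf := ('I_n -> R * R)%type.
Implicit Types (a b c d : conf) (l m : seq conf) (psi : R -> R).

Lemma path_move s l l' psi : good s l -> good s l' -> quads l l' ->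
  (1 < size l)%N -> param (size l).-1 psi ->
  ambient_isotopic (path_set l psi) (path_set l' psi).
Proof.
move=> gl gl' Q l1 hpsi.
have [B B0 L] := good_loop gl hpsi.
have hpsi' : param (size l').-1 psi by rewrite -(quads_size Q).
have [B' B0' L'] := good_loop gl' hpsi'.
have [x x0 gap] := path_gap Q l1.
apply: (loop_isotopy x0 (L (B + B') _) (L' (B + B') _)); rewrite ?lerDl ?lerDr //.
by move=> t p j k t01 hp jk; apply: gap => //; case: hpsi => _ _ _; apply.
Qed.

Lemma param_lerp N psi0 psi1 t : 0 <= t <= 1 -> param N psi0 -> param N psi1 ->
  param N (fun p => lerp t (psi0 p : R^o) (psi1 p)).
Proof.
move=> t01 [[B0 B0ge l0] s0 e0 b0] [[B1 B1ge l1] s1 e1 b1]; split.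
- exists (B0 + B1); first exact: addr_ge0.
  move=> p q hp hq; apply: (@lerp_dist _ R^o) => //.
    by apply: le_trans (l0 _ _ hp hq) _; rewrite ler_wpM2r // lerDl.
  by apply: le_trans (l1 _ _ hp hq) _; rewrite ler_wpM2r // lerDr.
- by rewrite s0 s1 /lerp subrr scaler0 addr0.
- by rewrite e0 e1 /lerp subrr scaler0 addr0.
- move=> p hp; have /andP[] := b0 p hp; have /andP[] := b1 p hp.
  rewrite /lerp /GRing.scale /=; case/andP: t01 => t0 t1.
  move: (psi0 p) (psi1 p) => x y hy1 hy2 hx1 hx2.
  have : 0 <= t * y by rewrite mulr_ge0.
  have : 0 <= (1 - t) * x by rewrite mulr_ge0 // subr_ge0.
  have : t * y <= t * N%:R by rewrite ler_wpM2l.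
  have : (1 - t) * x <= (1 - t) * N%:R by rewrite ler_wpM2l // subr_ge0.
  by lra.
Qed.

Lemma lerp_gap (V : normedModType R) t (x y x' y' : V) e : 0 <= t <= 1 ->
  e <= `|x - x'| -> `|y - x| <= e / 4 -> `|y' - x'| <= e / 4 ->
  e / 2 <= `|lerp t x y - lerp t x' y'|.
Proof.
move=> /andP[t0 t1] h hy hy'.
have -> : lerp t x y - lerp t x' y' = (x - x') + (t *: (y - x) - t *: (y' - x')).
  by rewrite /lerp opprD addrACA.
have h1 : `|t *: (y - x)| <= e / 4.
  by rewrite normrZ ger0_norm //; apply: le_trans hy; rewrite ler_piMl.
have h2 : `|t *: (y' - x')| <= e / 4.
  by rewrite normrZ ger0_norm //; apply: le_trans hy'; rewrite ler_piMl.
have := lerB_dist (x - x') (- (t *: (y - x) - t *: (y' - x'))).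
rewrite opprK normrN; have := ler_normB (t *: (y - x)) (t *: (y' - x')).
by lra.
Qed.

(** Interpolating times is not the same as interpolating positions. In small steps, however, the
    straight segment between two positions of a strand stays within [x / 4] of the path, whose
    strands are [x] apart. *)
Lemma reparam s l psi0 psi1 : good s l ->
  param (size l).-1 psi0 -> param (size l).-1 psi1 ->
  ambient_isotopic (path_set l psi0) (path_set l psi1).
Proof.
move=> gl h0 h1; have := good_size gl.
rewrite leq_eqVlt => /orP[/eqP e|l1].
  case: l e gl h0 h1 => [|a [|]] //= _ _ _ _.
  exact: ambient_isotopic_refl.
have Q : quads l l by case: gl.
have [x x0 gap] := path_gap Q l1.
have [C C0 lC] := plpath_lip l.
set N : R := (size l).-1%:R.
(* One step changes the time by at most [N / M] and hence a position by at most
   [C * N / M <= x / 4]. *)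
pose M := (Num.truncn (4 * C * N / x)).+1.
have MC : 4 * C * N / x < M%:R by rewrite /M truncnS_gt.
have M0 : 0 < M%:R :> R by rewrite ltr0n.
pose f i p : R := lerp (i%:R / M%:R) (psi0 p : R^o) (psi1 p).
have f0 : f 0%N = psi0.
  by apply/funext => p; rewrite /f /lerp mul0r scale0r addr0.
have fM : f M = psi1.
  by apply/funext => p; rewrite /f /lerp divff ?scale1r ?gt_eqF // addrC subrK.
rewrite -f0 -fM; apply: (@ambient_isotopic_chain _ (fun i => path_set l (f i))) => i iM.
have pf k : (k <= M)%N -> param (size l).-1 (f k).
  move=> kM; apply: param_lerp => //.
  by rewrite divr_ge0 //= ler_pdivrMr // mul1r ler_nat.
have [B B0 L] := good_loop gl (pf i (ltnW iM)).
have [B' B0' L'] := good_loop gl (pf i.+1 iM).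
have x2 : 0 < x / 2 by rewrite divr_gt0.
apply: (loop_isotopy x2 (L (B + B') _) (L' (B + B') _)); rewrite ?lerDl ?lerDr //.
have [_ _ _ b0] := h0; have [_ _ _ b1] := h1.
have step p j : 0 <= p <= 8 ->
    `|plpath l (f i.+1 p) j - plpath l (f i p) j| <= x / 4.
  move=> hp; apply: le_trans (lC _ _ _) _.
  have -> : f i.+1 p - f i p = M%:R^-1 * (psi1 p - psi0 p).
    rewrite /f /lerp opprD addrACA subrr add0r -scalerBl -mulrBl -natrB //.
    by rewrite subSnn mul1r.
  rewrite normrM ger0_norm ?invr_ge0 ?ler0n // mulrCA mulrC ler_pdivrMr //.
  have : `|psi1 p - psi0 p| <= N.
    rewrite ler_norml; have /andP[] := b0 p hp; have /andP[] := b1 p hp.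
    by rewrite -/N; lra.
  move=> /(ler_wpM2l C0) /le_trans; apply.
  move: MC; rewrite ltr_pdivrMr // => /ltW; lra.
move=> t p j k t01 hp jk; apply: lerp_gap => //; try exact: step.
have := gap 0 (f i p) j k; rewrite /lerp !scale0r !addr0; apply => //.
  by rewrite lexx ler01.
by case: (pf i (ltnW iM)) => _ _ _; apply.
Qed.

Lemma clamp_min u B : 1 <= B -> clamp (Num.min u B) = clamp u.
Proof.
move=> B1; have [//|Bu] := leP u B.
by rewrite !clamp1 //; lra.
Qed.

(* The time change that skips the waiting interval [k, k + 1]. *)
Definition skip (k : nat) u : R := Num.min u k%:R + Num.max 0 (u - k.+1%:R).

Lemma skipS k u : skip k.+1 u - 1 = skip k (u - 1).
Proof.
rewrite /skip -[k.+2%:R]natr1 -[k.+1%:R]natr1.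
have -> : Num.min u (k%:R + 1) = Num.min (u - 1) k%:R + 1.
  by rewrite addr_minl subrK.
have -> : u - 1 - (k%:R + 1) = u - (k%:R + 1 + 1) by lra.
by rewrite addrAC addrK.
Qed.

Lemma clamp_skip k u : clamp (skip k.+1 u) = clamp u.
Proof.
rewrite /skip; have k1 : 1 <= k.+1%:R :> R by rewrite ler1n.
have [h|h] := leP u k.+2%:R.
  by rewrite max_l ?addr0 ?clamp_min //; lra.
have k2 : k.+2%:R = k.+1%:R + 1 :> R by rewrite -natr1.
rewrite max_r; last by lra.
by rewrite min_r ?clamp1 //; lra.
Qed.

Lemma increments_dup l1 a b l2 u j :
  increments a (l1 ++ b :: b :: l2) u j =
  increments a (l1 ++ b :: l2) (skip (size l1).+1 u) j.
Proof.
elim: l1 a u => [|c l1 IH] a u /=; last by rewrite clamp_skip IH skipS.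
rewrite clamp_skip skipS subrr scaler0 add0r; congr (_ + _).
rewrite /skip; have [h|h] := leP (u - 1) 1.
  rewrite max_l ?addr0; last by lra.
  by rewrite !increments0 //; rewrite ?ge_min ?lexx ?orbT //; lra.
rewrite max_r; last by lra.
by rewrite min_r ?add0r //; lra.
Qed.

Lemma plpath_dup l1 b l2 u j : 0 <= u ->
  plpath (l1 ++ b :: b :: l2) u j = plpath (l1 ++ b :: l2) (skip (size l1) u) j.
Proof.
move=> u0; case: l1 => [|a l1]; last by rewrite /plpath /= increments_dup.
rewrite /plpath /= subrr scaler0 add0r; congr (_ + _).
rewrite /skip min_r //; have [h|h] := leP u 1; last by rewrite max_r ?add0r // subr_ge0 ltW.
by rewrite !increments0 // ?add0r ?ge_max ?lexx //; lra.
Qed.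

Lemma param_skip N k psi : (k <= N)%N -> param N.+1 psi ->
  param N (fun p => skip k (psi p)).
Proof.
move=> kN [[B B0 lB] e0 e8 bd].
have lmin (x y z : R) : `|Num.min x z - Num.min y z| <= `|x - y|.
  rewrite ler_norml; have := ler_norm (x - y); have := ler_norm (y - x).
  by rewrite (distrC y x); case: (leP x z); case: (leP y z); lra.
have lmax (x y : R) : `|Num.max 0 x - Num.max 0 y| <= `|x - y|.
  rewrite ler_norml; have := ler_norm (x - y); have := ler_norm (y - x).
  by rewrite (distrC y x); case: (leP 0 x); case: (leP 0 y); lra.
have kN' : k%:R <= N%:R :> R by rewrite ler_nat.
have k0 : 0 <= k%:R :> R by [].
split.
- exists (B + B); first exact: addr_ge0.
  move=> p q hp hq; rewrite /skip opprD addrACA mulrDl.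
  apply: le_trans (ler_normD _ _) _; apply: lerD.
    by apply: le_trans (lmin _ _ _) _; exact: lB.
  apply: le_trans (lmax _ _) _.
  have -> : psi p - k.+1%:R - (psi q - k.+1%:R) = psi p - psi q by ring.
  exact: lB.
- by rewrite e0 /skip min_l // add0r max_l // sub0r oppr_le0.
- rewrite e8 /skip min_r ?ler_nat ?leqW // max_r; last by rewrite subr_ge0 ler_nat.
  by rewrite -!natr1; lra.
- move=> p /bd /andP[h1 h2]; rewrite /skip; move: h2; rewrite -!natr1 => h2.
  by have [?|?] := leP (psi p) k%:R; have [?|?] := leP 0 (psi p - (k%:R + 1)); lra.
Qed.

Definition std_param N p : R := N%:R / 8 * p.

Lemma std_paramP N : param N (std_param N).
Proof.
have N0 : 0 <= N%:R / 8 :> R by rewrite divr_ge0.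
split; rewrite /std_param ?mulr0 //.
- by exists (N%:R / 8) => // p q _ _; rewrite -mulrBr normrM ger0_norm.
- by rewrite divfK.
- move=> p /andP[p0 p8]; rewrite mulr_ge0 //=.
  by rewrite -[leRHS](@divfK _ 8) // ler_wpM2l.
Qed.

Definition path_closure l := path_set l (std_param (size l).-1).
End PathEquivalence.

(** * Moves on paths of configurations *)

Section PathEquivalence2.
Variables (R : realType) (n : nat).
Implicit Types (p q t u B : R) (s : 'S_n).

Notation conf := ('I_n -> R * R)%type.
Implicit Types (a b c d : conf) (l m : seq conf) (psi : R -> R).

(** Two moves generate the equivalence: waiting at a configuration, and a straight homotopy of a
    stretch between fixed ends. Neither refers to the closing permutation, so paths can be composed
    and relabelled before they are closed. *)
Inductive peq : seq conf -> seq conf -> Prop :=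
| peq_refl l : peq l l
| peq_sym l l' : peq l l' -> peq l' l
| peq_trans l l' l'' : peq l l' -> peq l' l'' -> peq l l''
| peq_dup l1 b l2 : peq (l1 ++ b :: l2) (l1 ++ b :: b :: l2)
| peq_move l1 a m m' b l2 : quads (a :: rcons m b) (a :: rcons m' b) ->
    xbounded m -> xbounded m' -> peq (l1 ++ a :: m ++ b :: l2) (l1 ++ a :: m' ++ b :: l2).

Lemma peq_cat l l' l1 l2 : peq l l' -> peq (l1 ++ l ++ l2) (l1 ++ l' ++ l2).
Proof.
elim=> [?|? ? _ ?|? ? ? _ h _|m1 b m2|m1 a m m' b m2 Q xm xm'].
- exact: peq_refl.
- exact: peq_sym.
- exact: peq_trans.
- by rewrite -!catA !catA -!catA /= catA; have := peq_dup (l1 ++ m1) b (m2 ++ l2); rewrite -!catA.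
- have := peq_move (l1 ++ m1) (m2 ++ l2) Q xm xm'.
  by rewrite -!catA /= -!catA /=.
Qed.

Lemma quads_move l1 a m b l2 :
  quads (l1 ++ a :: m ++ b :: l2) (l1 ++ a :: m ++ b :: l2) <->
  [/\ quads (rcons l1 a) (rcons l1 a), quads (a :: rcons m b) (a :: rcons m b) &
      quads (b :: l2) (b :: l2)].
Proof.
rewrite quads_cat // -(cat_cons a) quads_cat //; split; first by move=> [? []].
by move=> [].
Qed.

Lemma head_cat_cons (T : Type) (x0 a : T) (l1 m m' : seq T) :
  head x0 (l1 ++ a :: m) = head x0 (l1 ++ a :: m').
Proof. by case: l1. Qed.

Lemma path_closure_dup s l1 b l2 : good s (l1 ++ b :: l2) ->
  ambient_isotopic (path_closure (l1 ++ b :: l2)) (path_closure (l1 ++ b :: b :: l2)) /\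
  ambient_isotopic (path_closure (l1 ++ b :: b :: l2)) (path_closure (l1 ++ b :: l2)).
Proof.
move=> g; set N := (size (l1 ++ b :: l2)).-1.
have eN : (size (l1 ++ b :: b :: l2)).-1 = N.+1.
  by rewrite /N !size_cat /= !addnS.
have kN : (size l1 <= N)%N by rewrite /N size_cat /= addnS /= leq_addr.
have pN1 := std_paramP R N.+1.
have pN := param_skip kN pN1.
have e : path_closure (l1 ++ b :: b :: l2) =
    path_set (l1 ++ b :: l2) (fun p => skip (size l1) (std_param N.+1 p)).
  rewrite /path_closure eN /path_set /loop_set predeqE => x.
  have E p j : 0 <= p <= 8 -> plpath (l1 ++ b :: b :: l2) (std_param N.+1 p) j =
      plpath (l1 ++ b :: l2) (skip (size l1) (std_param N.+1 p)) j.
    by move=> hp; apply: plpath_dup; case: pN1 => _ _ _ /(_ p hp)/andP[].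
  by split=> -[[j p] hp <-]; exists (j, p) => //=; rewrite E.
rewrite e; split; apply: reparam g _ _ => //; exact: std_paramP.
Qed.

(** The induction carries goodness along because intermediate paths must close up as well, and both
    directions of the isotopy because of the rule [peq_sym]. *)
Theorem peq_isotopy l l' : peq l l' -> forall s, (good s l <-> good s l') /\
  (good s l -> ambient_isotopic (path_closure l) (path_closure l') /\
               ambient_isotopic (path_closure l') (path_closure l)).
Proof.
elim=> {l l'} [l|l l' _ IH|l l' l'' _ IH1 _ IH2|l1 b l2|l1 a m m' b l2 Q xm xm'] s.
- by split => // _; split; exact: ambient_isotopic_refl.
- by have [e h] := IH s; split=> [|/e/h[]]; [rewrite e|].
- have [e1 h1] := IH1 s; have [e2 h2] := IH2 s; split; first by rewrite e1.
  move=> g; have [x1 y1] := h1 g; have [x2 y2] := h2 (e1.1 g).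
  by split; [exact: ambient_isotopic_trans x1 x2|exact: ambient_isotopic_trans y2 y1].
- split; last exact: path_closure_dup.
  have q : quads (l1 ++ b :: b :: l2) (l1 ++ b :: b :: l2) <-> quads (l1 ++ b :: l2) (l1 ++ b :: l2).
    rewrite !quads_cat //; split; first by move=> [? []].
    move=> [? h]; split=> //; split => //.
    by apply: separated_sub (quads_head h) _ => o j k /=; tauto.
  have x : xbounded (l1 ++ b :: b :: l2) <-> xbounded (l1 ++ b :: l2).
    by rewrite !xbounded_cat /=; tauto.
  rewrite /good !last_cat /= (head_cat_cons _ _ _ (b :: l2) l2).
  by split=> -[? ? ?]; split => //; tauto.
- have e : good s (l1 ++ a :: m ++ b :: l2) <-> good s (l1 ++ a :: m' ++ b :: l2).
    have Q1 := quads_refl_l Q; have Q2 := quads_refl_l (quads_sym Q).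
    have q : quads (l1 ++ a :: m ++ b :: l2) (l1 ++ a :: m ++ b :: l2) <->
        quads (l1 ++ a :: m' ++ b :: l2) (l1 ++ a :: m' ++ b :: l2).
      by rewrite !quads_move; split=> -[].
    have x : xbounded (l1 ++ a :: m ++ b :: l2) <-> xbounded (l1 ++ a :: m' ++ b :: l2).
      by rewrite !xbounded_cat /= !xbounded_cat /=; tauto.
    rewrite /good !last_cat /= !last_cat /=.
    rewrite (head_cat_cons _ _ _ (m ++ b :: l2) (m' ++ b :: l2)).
    by split=> -[? ? ?]; split => //; tauto.
  split=> // g; have g' := e.1 g.
  have S : size m = size m' by have := quads_size Q; rewrite /= !size_rcons => -[].
  have QQ : quads (l1 ++ a :: m ++ b :: l2) (l1 ++ a :: m' ++ b :: l2).
    case: g => /quads_move[h1 _ h3] _ _.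
    rewrite quads_cat // -!(cat_cons a) quads_cat //=; last by rewrite S.
  have s1 : (1 < size (l1 ++ a :: m ++ b :: l2))%N.
    by rewrite size_cat /= size_cat /= !addnS.
  have s2 : (1 < size (l1 ++ a :: m' ++ b :: l2))%N.
    by rewrite size_cat /= size_cat /= !addnS.
  split; rewrite /path_closure.
    rewrite -(quads_size QQ); apply: path_move g g' QQ s1 _; exact: std_paramP.
  rewrite (quads_size QQ); apply: path_move g' g (quads_sym QQ) s2 _; exact: std_paramP.
Qed.

(** Strands keep the name of their first position; in a later factor strand [j] plays the part of
    the strand that starts at [s j]. *)
Definition relabel (s : 'S_n) l := [seq (fun j => c (s j)) | c <- l].

Lemma lexpos_opp (o : (R * R) * (R * R)) (v : R * R) :
  lexpos o v -> lexpos (- o.1, - o.2) (- v).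
Proof.
case: o v => -[a1 a2] [b1 b2] [v1 v2]; rewrite /lexpos /=.
have E (x y z w : R) : - x * - y + - z * - w = x * y + z * w by ring.
by rewrite !E.
Qed.

Lemma lexpos_all_opp o j k l :
  lexpos_all o j k l -> lexpos_all (- o.1, - o.2) k j l.
Proof.
elim: l => //= c l IH [h1 h2]; split; last exact: IH.
by rewrite -opprB; exact: lexpos_opp.
Qed.

Lemma lexpos_all_relabel o s j k l :
  lexpos_all o (s j) (s k) l -> lexpos_all o j k (relabel s l).
Proof. by elim: l => //= c l IH [h1 h2]; split; last exact: IH. Qed.

Lemma separated_relabel s l : separated l -> separated (relabel s l).
Proof.
move=> h j k jk; have : s j != s k by rewrite (inj_eq perm_inj) -val_eqE ltn_eqF.
rewrite -val_eqE neq_ltn => /orP[] lt.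
  by have [w hw] := h _ _ lt; exists w; exact: lexpos_all_relabel.
have [w hw] := h _ _ lt; exists (- w.1, - w.2).
by apply: lexpos_all_relabel; exact: lexpos_all_opp.
Qed.

Lemma quads_relabel s l l' : quads l l' -> quads (relabel s l) (relabel s l').
Proof.
elim: l l' => [|a [|b l] IH] [|a' [|b' l']] //=.
  exact: (@separated_relabel s [:: a; a']).
by move=> [h /(IH (b' :: l')) h2]; split=> //; exact: (@separated_relabel s [:: a; b; a'; b']).
Qed.

Lemma xbounded_relabel s l : xbounded l -> xbounded (relabel s l).
Proof. by elim: l => //= c l IH [h1 h2]; split=> //; exact: IH. Qed.

Lemma relabel_cat s l m : relabel s (l ++ m) = relabel s l ++ relabel s m.
Proof. exact: map_cat. Qed.

Lemma peq_relabel s l l' : peq l l' -> peq (relabel s l) (relabel s l').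
Proof.
elim=> [?|? ? _ ?|? ? ? _ h _|m1 b m2|m1 a m m' b m2 Q xm xm'].
- exact: peq_refl.
- exact: peq_sym.
- exact: peq_trans.
- by rewrite !relabel_cat; exact: peq_dup.
- rewrite !relabel_cat /= !relabel_cat; apply: peq_move; try exact: xbounded_relabel.
  by have := quads_relabel s Q; rewrite /relabel /= !map_rcons.
Qed.
End PathEquivalence2.

(** * Braid words as paths *)

Section Words.
Variables (R : realType) (n : nat).
Implicit Types (s : 'S_n) (w u v : braid_word n) (h : 'I_n -> R).

Notation conf := ('I_n -> R * R)%type.
Implicit Types (c : conf) (l m : seq conf).

Definition std s : conf := fun j => ((s j)%:R, 0).

(** The middle vertices of [letter_strand], for the strand that has reached position [s j]. *)
Definition letter_mid (a : braid_letter n) s : conf := fun j =>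
  let q := adj_transp a.1 (s j) in
  (((s j)%:R + q%:R) / 2, (if a.2 then 1 else - 1) * (q%:R - (s j)%:R)).

Fixpoint word_path w : seq conf :=
  if w is a :: w' then
    word_path w' ++ [:: letter_mid a (word_perm w'); std (word_perm w)]
  else [:: std 1].

Definition stack h : conf := fun j => (0, h j).

(** In a generator the strand going right passes over, so of the two crossing strands the left one,
    [j], has to be the higher one. *)
Definition letter_layered h s (a : braid_letter n) : Prop :=
  forall j k, s j = pos_left a.1 -> s k = pos_right a.1 ->
  if a.2 then h k < h j else h j < h k.

(* Strand [j] can be lifted to height [h j] throughout the word. *)
Fixpoint layered h w : Prop :=
  if w is a :: w' then layered h w' /\ letter_layered h (word_perm w') a else True.

Lemma separated_wlog s l :
  (forall j k, (s j < s k)%N -> exists o, lexpos_all o j k l) -> separated l.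
Proof.
move=> H j k jk; have : s j != s k by rewrite (inj_eq perm_inj) -val_eqE ltn_eqF.
rewrite -val_eqE neq_ltn => /orP[/H//|/H[w hw]].
by exists (- w.1, - w.2); exact: lexpos_all_opp.
Qed.

Lemma lexpos_xz (e f : R) (x : R * R) :
  0 < e * x.1 \/ (x.1 = 0 /\ 0 < f * x.2) -> lexpos ((e, 0), (0, f)) x.
Proof.
rewrite /lexpos /= !mul0r addr0 add0r; case=> [?|[-> ?]]; first by left.
by right; rewrite mulr0.
Qed.

Lemma lexpos_zx (e f : R) (x : R * R) :
  0 < f * x.2 \/ (x.2 = 0 /\ 0 < e * x.1) -> lexpos ((0, f), (e, 0)) x.
Proof.
rewrite /lexpos /= !mul0r addr0 add0r; case=> [?|[-> ?]]; first by left.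
by right; rewrite mulr0.
Qed.

Lemma stack_order h : injective h -> forall j k, j != k ->
  exists2 f, f = 1 \/ f = - 1 & 0 < f * (h j - h k).
Proof.
move=> hi j k jk; have : h j != h k by rewrite (inj_eq hi).
rewrite neq_lt => /orP[] lt.
  by exists (- 1); [right|rewrite mulN1r opprB subr_gt0].
by exists 1; [left|rewrite mul1r subr_gt0].
Qed.

(** Positions are compared first and heights second: [std s] is decided by the positions, and in a
    stack these tie. *)
Lemma std_stack_separated h s : injective h -> separated [:: std s; stack h].
Proof.
move=> hi; apply: (@separated_wlog s) => j k jk.
have jk' : j != k by apply: contraTN jk => /eqP->; rewrite ltnn.
have [f _ hf] := stack_order hi jk'.
exists ((- 1, 0), (0, f)); split; [|split=> //]; apply: lexpos_xz => /=.
  by left; rewrite mulN1r opprB subr_gt0 ltr_nat.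
by right; rewrite subrr.
Qed.

Lemma letter_cases (a : braid_letter n) s h j k : letter_layered h s a ->
  (s j < s k)%N ->
  [/\ s j = pos_left a.1, s k = pos_right a.1,
      (letter_mid a s j - letter_mid a s k).1 = 0 &
      0 < (letter_mid a s j - letter_mid a s k).2 * (h j - h k)] \/
  (letter_mid a s j - letter_mid a s k).1 < 0 /\
  (adj_transp a.1 (s j) < adj_transp a.1 (s k))%N.
Proof.
move=> la jk; case: (boolP ((s j == pos_left a.1) && (s k == pos_right a.1))) => hc.
  left; move: hc => /andP[/eqP ej /eqP ek]; split => //.
    rewrite /letter_mid /= ej ek /adj_transp tpermL tpermR /=; lra.
  have := la j k ej ek; rewrite /letter_mid /= ej ek /adj_transp tpermL tpermR /=.
  rewrite -natr1; case: a.2 => h1.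
    by rewrite pmulr_lgt0 ?subr_gt0 //; lra.
  by rewrite nmulr_lgt0 ?subr_lt0 //; lra.
right; have lt := adj_transp_lt jk hc; split => //.
rewrite /letter_mid /= -mulrBl pmulr_llt0 ?invr_gt0 //.
by move: lt jk; rewrite -!(ltr_nat R); lra.
Qed.

(** The only strands with equal positions in the middle of the letter are the crossing ones, and
    there their heights are ordered as in the stack. *)
Lemma letter_before_separated a s h : injective h -> letter_layered h s a ->
  separated [:: std s; letter_mid a s; stack h].
Proof.
move=> hi la; apply: (@separated_wlog s) => j k jk.
have jk' : j != k by apply: contraTN jk => /eqP->; rewrite ltnn.
have [f f1 hf] := stack_order hi jk'.
exists ((- 1, 0), (0, f)); split; [|split; [|split=> //]]; apply: lexpos_xz.
- by left; rewrite /= mulN1r opprB subr_gt0 ltr_nat.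
- have [[_ _ -> h1]|[h1 _]] := letter_cases la jk; last by left; lra.
  right; split => //; case: f1 hf => ->; rewrite ?mul1r ?mulN1r ?oppr_gt0 => h2.
    by rewrite -(pmulr_lgt0 _ h2).
  by rewrite -(nmulr_lgt0 _ h2).
- by right; rewrite /= subrr.
Qed.

Lemma letter_after_separated a s h : injective h -> letter_layered h s a ->
  separated [:: letter_mid a s; std (s * adj_transp a.1)%g; stack h].
Proof.
move=> hi la; apply: (@separated_wlog s) => j k jk.
have jk' : j != k by apply: contraTN jk => /eqP->; rewrite ltnn.
have [f f1 hf] := stack_order hi jk'.
have [[ej ek ex h1]|[h1 h2]] := letter_cases la jk.
  exists ((1, 0), (0, f)); split; [|split; [|split=> //]]; apply: lexpos_xz.
  - right; split => //; case: f1 hf => ->; rewrite ?mul1r ?mulN1r ?oppr_gt0 => h2.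
      by rewrite -(pmulr_lgt0 _ h2).
    by rewrite -(nmulr_lgt0 _ h2).
  - by left; rewrite /= !permM ej ek /adj_transp tpermL tpermR mul1r subr_gt0 ltr_nat /=.
  - by right; rewrite /= subrr.
exists ((- 1, 0), (0, f)); split; [|split; [|split=> //]]; apply: lexpos_xz.
- by left; lra.
- by left; rewrite /= !permM mulN1r opprB subr_gt0 ltr_nat.
- by right; rewrite /= subrr.
Qed.

Lemma stack_xbounded h : (0 < n)%N -> forall j, (stack h j).1 <= n%:R - 1.
Proof. by move=> n0 j; rewrite /= subr_ge0 ler1n. Qed.

(* Raising every strand to its own height straightens a layered word. *)
Theorem word_path_layered h w : (0 < n)%N -> injective h -> layered h w ->
  peq (word_path w) [:: std 1; stack h; std (word_perm w)].
Proof.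
move=> n0 hi; have xh := stack_xbounded h n0; elim: w => [_|a w IH [lw la]].
  apply: (@peq_trans _ _ _ [:: std 1; std 1; std 1]).
    apply: peq_trans (peq_dup [::] (std 1) [:: std 1]).
    exact: (peq_dup [::] (std 1) [::]).
  apply: (@peq_move _ _ [::] (std 1) [:: std 1] [:: stack h] (std 1) [::]) => //=.
    by split; [|split]; apply: separated_sub (std_stack_separated 1 hi) _ => o j k /=; tauto.
  by split=> // j; rewrite /= perm1 lerBrDr natr1 ler_nat ltn_ord.
set s := word_perm w in la IH *.
pose s' := (s * adj_transp a.1)%g.
apply: (@peq_trans _ _ _ ([:: std 1; stack h; std s] ++ [:: letter_mid a s; std s'])).
  exact: (peq_cat [::] [:: letter_mid a s; std s'] (IH lw)).
(* The old end and the middle of the new letter are pulled into the stack that precedes them; the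
   repetitions of the stack are then dropped. *)
apply: (@peq_trans _ _ _ [:: std 1; stack h; stack h; stack h; std s']).
  apply: (@peq_move _ _ [:: std 1] (stack h) [:: std s; letter_mid a s]
    [:: stack h; stack h] (std s') [::]) => //=; last first.
    split=> [j|].
      by rewrite /= lerBrDr natr1 ler_nat ltn_ord.
    split=> // j; rewrite /letter_mid /= ler_pdivrMr //.
    have : (s j)%:R <= n%:R - 1 :> R by rewrite lerBrDr natr1 ler_nat ltn_ord.
    have : (adj_transp a.1 (s j))%:R <= n%:R - 1 :> R by rewrite lerBrDr natr1 ler_nat ltn_ord.
    by lra.
  have S1 := letter_before_separated hi la; have S2 := letter_after_separated hi la.
  split; first by apply: separated_sub S1 _ => o j k /=; tauto.
  split; first by apply: separated_sub S1 _ => o j k /=; tauto.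
  split; first by apply: separated_sub S2 _ => o j k /=; tauto.
  by apply: separated_sub S2 _ => o j k /=; tauto.
apply: peq_sym; apply: peq_trans (peq_dup [:: std 1; stack h] (stack h) [:: std s']).
exact: (peq_dup [:: std 1] (stack h) [:: std s']).
Qed.

Lemma word_path_head w : word_path w = std 1 :: behead (word_path w).
Proof. by elim: w => //= a w ->. Qed.

Lemma word_path_last c w : last c (word_path w) = std (word_perm w).
Proof. by case: w => //= a w; rewrite last_cat. Qed.

Lemma word_perm_cat u v : word_perm (u ++ v) = (word_perm v * word_perm u)%g.
Proof. by elim: u => [|a u IH] /=; rewrite ?mulg1 // IH mulgA. Qed.

(** The right factor [v] comes first, and the strands enter [u] at the positions where [v] leaves
    them. [behead] removes the shared configuration. *)
Lemma word_path_cat u v :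
  word_path (u ++ v) = word_path v ++ behead (relabel (word_perm v) (word_path u)).
Proof.
elim: u => [|a u IH]; first by rewrite /= cats0.
have e : letter_mid a (word_perm (u ++ v)) = fun j => letter_mid a (word_perm u) (word_perm v j).
  by apply/funext => j; rewrite /letter_mid word_perm_cat !permM.
have e' : std (word_perm ((a :: u) ++ v)) = fun j => std (word_perm (a :: u)) (word_perm v j).
  by apply/funext => j; rewrite /std word_perm_cat !permM.
rewrite -[LHS]/(word_path (u ++ v) ++ [:: letter_mid a (word_perm (u ++ v));
  std (word_perm ((a :: u) ++ v))]) IH e e'.
by rewrite -catA [word_path (a :: u)]/= relabel_cat (word_path_head u).
Qed.
End Words.

(** * Invariance under the braid relations *)

Section WordEquivalence.
Variables (R : realType) (n : nat).
Implicit Types (s : 'S_n) (w u v : braid_word n) (h : 'I_n -> R).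

Definition up (j : 'I_n) : R := j%:R.
Definition down (j : 'I_n) : R := - j%:R.

Lemma up_inj : injective up.
Proof. by move=> j k /eqP; rewrite /up eqr_nat => /eqP/val_inj. Qed.

Lemma down_inj : injective down.
Proof. by move=> j k /eqP; rewrite /down eqr_opp eqr_nat => /eqP/val_inj. Qed.

Lemma down_lt j k : (down j < down k) = (k < j)%N.
Proof. by rewrite /down ltrN2 ltr_nat. Qed.

Lemma up_lt j k : (up j < up k) = (j < k)%N.
Proof. by rewrite /up ltr_nat. Qed.

Lemma adj_transp_val (i : 'I_n.-1) (x : 'I_n) :
  adj_transp i x = (if x == i :> nat then i.+1 else if x == i.+1 :> nat then i : nat else x) :> nat.
Proof.
rewrite /adj_transp; case: tpermP => [->|->|]; rewrite /= ?eqxx //.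
  by rewrite eqn_leq ltnn /=.
move=> h1 h2; case: eqP => [e|_]; first by case: h1; exact: val_inj.
by case: eqP => [e|//]; case: h2; exact: val_inj.
Qed.

Lemma layered_peq h u v : (0 < n)%N -> injective h -> layered h u -> layered h v ->
  word_perm u = word_perm v -> peq (word_path R u) (word_path R v).
Proof.
move=> n0 hi lu lv e; apply: peq_trans (word_path_layered n0 hi lu) _.
by rewrite e; apply: peq_sym; exact: word_path_layered.
Qed.

Lemma word_path_rcons w : exists l, word_path R w = rcons l (std R (word_perm w)).
Proof.
case: (lastP (word_path R w)) (word_path_head R w) (word_path_last (std R 1%g) w) => //.
by move=> l c _; rewrite last_rcons => ->; exists l.
Qed.

Lemma word_path_cat_rcons u v l : word_path R v = rcons l (std R (word_perm v)) ->
  word_path R (u ++ v) = l ++ relabel (word_perm v) (word_path R u).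
Proof.
move=> e; rewrite word_path_cat e cat_rcons (word_path_head R u) /=.
by congr (_ ++ _ :: _); apply/funext => j; rewrite /std perm1.
Qed.

(** The two sides of each relation have the same permutation and are layered by the same heights, so
    both are equivalent to one path through a single stack. For the relations between generators
    [down] serves: a strand starting on the left passes over. *)
Theorem braid_equiv_peq u v : (0 < n)%N -> braid_equiv u v ->
  word_perm u = word_perm v /\ peq (word_path R u) (word_path R v).
Proof.
move=> n0; elim=> {u v} [u|u v _ [-> h]|u v w _ [-> h1] _ [-> h2]
  |u u' v v' _ [eu hu] _ [ev hv]|i b|i j ij|i j ij].
- by split => //; exact: peq_refl.
- by split => //; exact: peq_sym.
- by split => //; exact: peq_trans h1 h2.
- rewrite !word_perm_cat eu ev; split => //.
  apply: (@peq_trans _ _ _ (word_path R (u' ++ v))).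
    have [l e] := word_path_rcons v; rewrite !(word_path_cat_rcons _ e).
    by have := peq_cat l [::] (peq_relabel (word_perm v) hu); rewrite !cats0.
  by rewrite !word_path_cat -ev; exact: (peq_cat [::] _ hv).
- have e : word_perm [:: (i, b); (i, ~~ b)] = word_perm [::].
    by rewrite /= mul1g /adj_transp tperm2.
  (* The rightmost letter, of sign [~~ b], comes first: if [b] is true, the left strand begins by
     passing under the other, which is [up]. *)
  split => //; apply: (@layered_peq (if b then up else down)) => //.
    by case: b {e}; [exact: up_inj|exact: down_inj].
  split; first split=> //.
    move=> x y; rewrite /= !perm1 => -> ->; case: b {e} => /=; rewrite ?up_lt ?down_lt //=.
  move=> x y; rewrite /= mul1g /adj_transp => ex ey.
  have -> : x = pos_right i by apply: (@perm_inj _ (tperm (pos_left i) (pos_right i))); rewrite ex tpermR.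
  have -> : y = pos_left i by apply: (@perm_inj _ (tperm (pos_left i) (pos_right i))); rewrite ey tpermL.
  by case: b {e}; rewrite ?up_lt ?down_lt /=.
- have e : word_perm (sigma_word i ++ sigma_word j) = word_perm (sigma_word j ++ sigma_word i).
    apply/permP => x; apply: ord_inj; rewrite /= !permM !perm1 !adj_transp_val.
    by (repeat case: eqP => /=); lia.
  split => //; apply: (@layered_peq down) => //; first exact: down_inj.
    split; first split=> //; move=> x y /(congr1 (@nat_of_ord n)) + /(congr1 (@nat_of_ord n));
      by rewrite /= ?permM !perm1 ?adj_transp_val down_lt; (repeat case: eqP => /=); lia.
  split; first split=> //; move=> x y /(congr1 (@nat_of_ord n)) + /(congr1 (@nat_of_ord n));
    by rewrite /= ?permM !perm1 ?adj_transp_val down_lt; (repeat case: eqP => /=); lia.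
- have e : word_perm (sigma_word i ++ sigma_word j ++ sigma_word i) =
      word_perm (sigma_word j ++ sigma_word i ++ sigma_word j).
    apply/permP => x; apply: ord_inj; rewrite /= !permM !perm1 !adj_transp_val.
    by (repeat case: eqP => /=); lia.
  split => //; apply: (@layered_peq down) => //; first exact: down_inj.
    split; first split; first split=> //; move=> x y /(congr1 (@nat_of_ord n)) + /(congr1 (@nat_of_ord n));
      by rewrite /= ?permM !perm1 ?adj_transp_val down_lt; (repeat case: eqP => /=); lia.
  split; first split; first split=> //; move=> x y /(congr1 (@nat_of_ord n)) + /(congr1 (@nat_of_ord n));
    by rewrite /= ?permM !perm1 ?adj_transp_val down_lt; (repeat case: eqP => /=); lia.
Qed.
End WordEquivalence.

(** * Layerings of simple words and the braid of the theorem *)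

Section SimpleWords.
Variables (R : realType) (n : nat).
Implicit Types (s : 'S_n) (w u v : braid_word n) (h : 'I_n -> R).

Lemma crossing_pair w (a : braid_letter n) (j k : 'I_n) :
  word_perm w j = pos_left a.1 -> word_perm w k = pos_right a.1 ->
  [set ((word_perm w)^-1)%g (pos_left a.1);
       ((word_perm w)^-1)%g (pos_right a.1)]%SET = [set j; k]%SET.
Proof. by move=> <- <-; rewrite !permK. Qed.

Lemma not_crossed_lt w (j k : 'I_n) : (j < k)%N ->
  [set j; k]%SET \notin word_crossings w -> (word_perm w j < word_perm w k)%N.
Proof.
move=> jk; elim: w => [|a w IH]; first by rewrite /= !perm1.
rewrite /= inE negb_or => /andP[h1 /IH h2]; rewrite !permM.
apply: adj_transp_lt => //; apply: contra h1 => /andP[/eqP e1 /eqP e2].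
by rewrite (crossing_pair e1 e2).
Qed.

Lemma simple_word_cons a w : simple_word (a :: w) ->
  [/\ a.2, simple_word w & forall j k, word_perm w j = pos_left a.1 ->
    word_perm w k = pos_right a.1 -> [set j; k]%SET \notin word_crossings w].
Proof.
rewrite /simple_word /= => /andP[/andP[a2 aw] /andP[nc uw]].
by split=> //; [rewrite aw uw|move=> j k e1 e2; rewrite -(crossing_pair e1 e2)].
Qed.

(** The crossing of the pair reverses its order, and no other letter of a simple word can swap the
    pair back. *)
Lemma crossed_gt w (j k : 'I_n) : simple_word w -> (j < k)%N ->
  [set j; k]%SET \in word_crossings w -> (word_perm w k < word_perm w j)%N.
Proof.
move=> sw jk; elim: w sw => //= a w IH /simple_word_cons[a2 sw nc].
rewrite inE !permM => /orP[/eqP e|h].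
  have : [set j; k]%SET \notin word_crossings w.
    by rewrite e; apply: nc; rewrite permKV.
  move=> /(not_crossed_lt jk) lt; move: e.
  move=> /setP e; have := e j; have := e k.
  rewrite !inE !eqxx orbT /= => /esym/orP e1 /esym/orP e2.
  have jk' : j != k by apply: contraTN jk => /eqP->; rewrite ltnn.
  have [ej ek] : word_perm w j = pos_left a.1 /\ word_perm w k = pos_right a.1.
    case: e1 e2 => /eqP e1 [] /eqP e2.
    - by move: jk'; rewrite e2 -e1 eqxx.
    - by move: lt; rewrite e1 e2 !permKV /= ltnNge leqnSn.
    - by rewrite e1 e2 !permKV.
    - by move: jk'; rewrite e2 -e1 eqxx.
  by rewrite ej ek /adj_transp tpermL tpermR /=.
apply: adj_transp_lt; first exact: IH.
apply/negP => /andP[/eqP ek /eqP ej]; have := nc _ _ ek ej.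
by rewrite finset.setUC h.
Qed.

(** A pair that is about to cross has not crossed before, so the strand on its left also started on
    the left. *)
Lemma simple_layered h w : simple_word w ->
  (forall j k, [set j; k]%SET \in word_crossings w -> (j < k)%N -> h k < h j) ->
  layered h w.
Proof.
elim: w => //= a w IH /simple_word_cons[a2 sw nc] hh; split.
  by apply: IH => // j k jk; apply: hh; rewrite inE jk orbT.
move=> j k ej ek; rewrite a2; apply: hh; first by rewrite inE (crossing_pair ej ek) eqxx.
rewrite ltnNge leq_eqVlt; apply/negP => /orP[/eqP/val_inj e|kj].
  by move: ek; rewrite e ej => /(congr1 val) /= /n_Sn.
have jkC : [set k; j]%SET = [set j; k]%SET :> {set 'I_n}.
  by apply/finset.setP => x; rewrite !inE orbC.
have := @not_crossed_lt w _ _ kj.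
rewrite jkC ej ek => /(_ (nc _ _ ej ek)) /=.
by rewrite ltnNge leqnSn.
Qed.

Lemma simple_layered_down w : simple_word w -> layered (down R (n:=n)) w.
Proof. by move=> sw; apply: simple_layered => // j k _ jk; rewrite down_lt. Qed.

(** Crossed strands end in reverse order: the one that started on the left, which is on top, has the
    larger final position. *)
Lemma simple_layered_up w : simple_word w ->
  layered (fun j => up R (word_perm w j)) w.
Proof.
by move=> sw; apply: simple_layered => // j k X jk; rewrite up_lt; exact: crossed_gt.
Qed.

Lemma layered_ext h h' w : h =1 h' -> layered h w -> layered h' w.
Proof. by move=> /funext ->. Qed.

Lemma layered_cat h u v : layered h v ->
  layered (fun j => h (((word_perm v)^-1)%g j)) u -> layered h (u ++ v).
Proof.
move=> lv; elim: u => //= a u IH [/IH lu la]; split=> // j k.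
rewrite word_perm_cat !permM => ej ek; have := la _ _ ej ek.
by rewrite !permK.
Qed.

Lemma word_inv_cons a w : word_inv (a :: w) = word_inv w ++ [:: (a.1, ~~ a.2)].
Proof. by rewrite /word_inv /= rev_cons cats1. Qed.

Lemma word_perm_inv w : word_perm (word_inv w) = ((word_perm w)^-1)%g.
Proof.
elim: w => [|a w IH]; first by rewrite /= invg1.
by rewrite word_inv_cons word_perm_cat IH /= mul1g invMg /adj_transp tpermV.
Qed.

(** Reading a word backwards changes the sign of a letter as well as the sides of its strands, so
    the upper strand stays the upper one. In the inverse the strands are named by their final
    positions in [w]. *)
Lemma layered_inv h w : layered h w ->
  layered (fun j => h (((word_perm w)^-1)%g j)) (word_inv w).
Proof.
elim: w => //= a w IH [/IH lw la]; rewrite word_inv_cons; apply: layered_cat.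
  split=> // j k; rewrite /= !perm1 => -> ->.
  rewrite invMg !permM /adj_transp tpermV tpermL tpermR.
  have := la _ _ (permKV _ _) (permKV _ _).
  by case: a.2.
apply: layered_ext lw => j; congr h.
by rewrite /= mul1g invMg permM /adj_transp !tpermV tpermK.
Qed.

Lemma br_word s : exists w, [/\ simple_word w, word_perm w = s & br s = braid_of w].
Proof.
exists (xchoose (exists_simple_word s)); have /andP[-> /eqP ->] := xchooseP (exists_simple_word s).
by split.
Qed.

(* The closed braid of the theorem as a path of configurations: the strands
   are sorted by position and by height in turn. *)
Theorem braid_word_path s1 s2 w : (0 < n)%N ->
  braid_of w = (delta n * (br s1)^-1 * (br (s1^-1))^-1 * br (s2^-1) * br s2)%g ->
  word_perm w = cyc_perm n /\
  peq (word_path R w)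
    [:: std R 1%g; stack (down R (n:=n)); std R s2; stack (up R (n:=n)); std R s1;
        stack (down R (n:=n)); std R (cyc_perm n)].
Proof.
move=> n0 ew.
have [wd [sd pd ed]] := br_word (cyc_perm n).
have [w1 [sw1 p1 e1]] := br_word s1.
have [w1' [sw1' p1' e1']] := br_word (s1^-1)%g.
have [w2 [sw2 p2 e2]] := br_word s2.
have [w2' [sw2' p2' e2']] := br_word (s2^-1)%g.
(* Adjacent factors that share a height function are grouped, so that each group passes through one
   stack only. *)
pose wA := word_inv w1' ++ w2'; pose wB := wd ++ word_inv w1.
have E : braid_of w = braid_of (wB ++ (wA ++ w2)).
  rewrite ew /delta ed e1 e1' e2 e2'.
  rewrite -[((_ * _ * _ * _ * _)%g)]/(braid_mul (braid_mul (braid_mul (braid_mul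
    (braid_of wd) (braid_inv (braid_of w1))) (braid_inv (braid_of w1')))
    (braid_of w2')) (braid_of w2)).
  by rewrite !braid_invE !braid_mulE /wA /wB -!catA.
have /asboolP eqv : `[< braid_equiv w (wB ++ (wA ++ w2)) >] by apply/braid_ofP.
have [ep hp] := braid_equiv_peq R n0 eqv.
have pA : word_perm wA = (s2^-1 * s1)%g.
  by rewrite /wA word_perm_cat word_perm_inv p1' p2' invgK.
have pB : word_perm wB = (s1^-1 * cyc_perm n)%g.
  by rewrite /wB word_perm_cat word_perm_inv p1 pd.
have pAC : word_perm (wA ++ w2) = s1 by rewrite word_perm_cat pA p2 mulKVg.
split; first by rewrite ep word_perm_cat pAC pB mulKVg.
apply: peq_trans hp _.
have lC := word_path_layered n0 (@down_inj R n) (simple_layered_down sw2).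
(* Between its two factors [wA] has every strand back at its first position. This is a final
   position for [br (s2^-1)] and a first one for the inverse of [br (s1^-1)], and it serves as the
   height in both. *)
have lA : layered (fun j => up R ((s2^-1)%g j)) wA.
  apply: layered_cat; first by rewrite -p2'; exact: simple_layered_up.
  have := layered_inv (simple_layered_up sw1'); apply: layered_ext => j.
  by rewrite permKV p2' invgK permK.
have lB : layered (fun j => down R ((s1^-1)%g j)) wB.
  apply: layered_cat; first by rewrite -p1; exact: layered_inv (simple_layered_down sw1).
  have := simple_layered_down sd; apply: layered_ext => j.
  by rewrite word_perm_inv p1 invgK permK.
have lA' := word_path_layered n0 (inj_comp (@up_inj R n) (@perm_inj _ (s2^-1)%g)) lA.
have lB' := word_path_layered n0 (inj_comp (@down_inj R n) (@perm_inj _ (s1^-1)%g)) lB.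
have rel (s : 'S_n) h s' : relabel s [:: std R 1%g; stack h; std R s'] =
    [:: std R s; stack (h \o s); std R (s * s')%g].
  rewrite /relabel /=; congr [:: _; _; _]; apply/funext => j; rewrite /std /stack ?permM ?perm1 //.
have key : peq (word_path R (wA ++ w2))
    [:: std R 1%g; stack (down R (n:=n)); std R s2; stack (up R (n:=n)); std R s1].
  have [l el] := word_path_rcons R w2.
  rewrite (word_path_cat_rcons _ el).
  apply: (@peq_trans _ _ _ (l ++ relabel (word_perm w2) [:: std R 1%g;
     stack (fun j => up R ((s2^-1)%g j)); std R (word_perm wA)])).
    by have := peq_cat l [::] (peq_relabel (word_perm w2) lA'); rewrite !cats0.
  have el' : word_path R w2 = rcons l (std R s2) by rewrite el p2.
  rewrite rel p2 pA mulKVg -cat_rcons -el' -p2.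
  have -> : (fun j => up R (((word_perm w2)^-1)%g j)) \o word_perm w2 = up R (n:=n).
    by apply/funext => j /=; rewrite permK.
  exact: (peq_cat [::] _ lC).
have [l el] := word_path_rcons R (wA ++ w2).
rewrite (word_path_cat_rcons _ el).
apply: (@peq_trans _ _ _ (l ++ relabel (word_perm (wA ++ w2)) [:: std R 1%g;
   stack (fun j => down R ((s1^-1)%g j)); std R (word_perm wB)])).
  by have := peq_cat l [::] (peq_relabel (word_perm (wA ++ w2)) lB'); rewrite !cats0.
have el' : word_path R (wA ++ w2) = rcons l (std R s1) by rewrite el pAC.
rewrite rel pB pAC mulKVg -cat_rcons -el'.
have -> : (fun j => down R ((s1^-1)%g j)) \o s1 = down R (n:=n).
  by apply/funext => j /=; rewrite permK.
exact: (peq_cat [::] _ key).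
Qed.
End SimpleWords.

(** * The standard closure in the open book *)

Section WordClosure.
Variables (R : realType) (n : nat).
Implicit Types (x y z t p : R) (w : braid_word n).

(** The piecewise linear homeomorphism of the line that takes [0, a] onto [0, b] and has slope 1
    outside, fixing the negative half-line. *)
Definition stretch (a b y : R) : R :=
  Num.min y 0 + b * clamp (y / a) + Num.max 0 (y - a).

Lemma stretch_low a b y : 0 < a -> y <= 0 -> stretch a b y = y.
Proof.
move=> a0 y0; rewrite /stretch min_l // clamp0 ?mulr0 ?addr0.
  by rewrite max_l ?addr0 //; lra.
by rewrite pmulr_lle0 ?invr_gt0.
Qed.

Lemma stretch_mid a b y : 0 < a -> 0 <= y <= a -> stretch a b y = b / a * y.
Proof.
move=> a0 /andP[y0 ya]; rewrite /stretch min_r // max_l; last by lra.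
rewrite clamp_id; first by rewrite add0r addr0; ring.
by rewrite divr_ge0 ?(ltW a0) //= ler_pdivrMr // mul1r.
Qed.

Lemma stretch_high a b y : 0 < a -> a <= y -> stretch a b y = y - a + b.
Proof.
move=> a0 ya; rewrite /stretch min_r ?(le_trans (ltW a0)) // max_r; last by lra.
rewrite clamp1 ?mulr1; first by rewrite add0r addrC.
by rewrite ler_pdivlMr // mul1r.
Qed.

Lemma stretchK a b : 0 < a -> 0 < b -> cancel (stretch a b) (stretch b a).
Proof.
move=> a0 b0 y; have [y0|y0] := leP y 0; first by rewrite !stretch_low // stretch_low.
have [ya|ya] := leP y a.
  have e := stretch_mid b a0 (_ : 0 <= y <= a); rewrite e ?(ltW y0) //.
  rewrite stretch_mid //; first by field; rewrite !gt_eqF.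
  rewrite mulr_ge0 ?divr_ge0 ?(ltW a0) ?(ltW b0) ?(ltW y0) //=.
  by rewrite mulrAC ler_pdivrMr // ler_pM2l.
rewrite (stretch_high _ a0 (ltW ya)) stretch_high //; lra.
Qed.

Lemma stretch_bounds a b y y' : 0 < a -> 0 < b -> y' <= y ->
  Num.min 1 (b / a) * (y - y') <= stretch a b y - stretch a b y' <=
  Num.max 1 (b / a) * (y - y').
Proof.
move=> a0 b0 yy'.
have id v : v = stretch a a v.
  have [v0|v0] := leP v 0; first by rewrite stretch_low.
  have [va|va] := leP v a; first by rewrite stretch_mid ?(ltW v0) // divff ?mul1r // gt_eqF.
  by rewrite stretch_high ?(ltW va) // subrK.
have mmin : Num.min y' 0 <= Num.min y 0 by case: (leP y' 0); case: (leP y 0); lra.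
have mmax : Num.max 0 (y' - a) <= Num.max 0 (y - a).
  by case: (leP 0 (y' - a)); case: (leP 0 (y - a)); lra.
have mcl : clamp (y' / a) <= clamp (y / a).
  have : y' / a <= y / a by rewrite ler_pM2r ?invr_gt0.
  by case: (clampP (y' / a)) => -[? ->]; case: (clampP (y / a)) => -[? ->]; lra.
have -> : y - y' = stretch a a y - stretch a a y' by rewrite -!id.
rewrite /stretch.
set u := Num.min y 0 in mmin *; set u' := Num.min y' 0 in mmin *.
set v := clamp (y / a) in mcl *; set v' := clamp (y' / a) in mcl *.
set r := Num.max 0 (y - a) in mmax *; set r' := Num.max 0 (y' - a) in mmax *.
set m := Num.min 1 _; set M := Num.max 1 _.
have m1 : m <= 1 by rewrite /m ge_min lexx.
have M1 : 1 <= M by rewrite /M le_max lexx.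
have m2 : m * a <= b by rewrite -ler_pdivlMr // /m ge_min lexx orbT.
have M2 : b <= M * a by rewrite -ler_pdivrMr // /M le_max lexx orbT.
have E k : k * (u + a * v + r - (u' + a * v' + r')) =
  k * (u - u') + k * a * (v - v') + k * (r - r') by ring.
have E' : u + b * v + r - (u' + b * v' + r') =
  (u - u') + b * (v - v') + (r - r') by ring.
rewrite !E E'; apply/andP; split; apply: lerD; try apply: lerD.
- by rewrite ler_piMl // subr_ge0.
- by rewrite ler_wpM2r // subr_ge0.
- by rewrite ler_piMl // subr_ge0.
- by rewrite ler_peMl // subr_ge0.
- by rewrite ler_wpM2r // subr_ge0.
- by rewrite ler_peMl // subr_ge0.
Qed.

Definition stretch_map (a b : R) (P : space R) : space R :=
  pt P.1.1 (stretch a b P.1.2) P.2.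

(** The stages of the straight homotopy from the identity have slopes at least [m] in y, and the
    displacement has Lipschitz constant at most [M + 1]. *)
Lemma stretch_isotopy a b (K : set (space R)) : 0 < a -> 0 < b ->
  ambient_isotopic K [set stretch_map a b P | P in K].
Proof.
move=> a0 b0; pose A (s : {P : space R | K P}) := sval s.
pose D (s : {P : space R | K P}) : space R := pt 0 (stretch a b (A s).1.2 - (A s).1.2) 0.
have -> : K = range A.
  by rewrite predeqE => P; split=> [KP|[[Q KQ] _ <-] //]; exists (exist _ P KP).
have -> : [set stretch_map a b P | P in range A] = range (fun s => A s + D s).
  have e s : stretch_map a b (A s) = A s + D s.
    rewrite /stretch_map /D /pt; case: (A s) => [[x y] z] /=.
    by congr (_, _, _) => /=; ring.
  rewrite predeqE => P; split; first by move=> [_ [s _ <-] <-]; exists s; rewrite // e.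
  by move=> [s _ <-]; exists (A s); [exists s|rewrite e].
set M := Num.max 1 (b / a); set m := Num.min 1 (b / a).
have m0 : 0 < m by rewrite /m lt_min ltr01 divr_gt0.
have m1 : m <= 1 by rewrite /m ge_min lexx.
have M1 : 1 <= M by rewrite /M le_max lexx.
apply: (@lip_isotopy _ _ _ _ ((M + 1) / m)) => t s s' /andP[t0 t1].
set N := `|_ + t *: _ - _|; rewrite norm3_le /= subrr normr0.
have N0 : 0 <= (M + 1) / m * N.
  by apply: mulr_ge0; [apply: divr_ge0; lra|exact: normr_ge0].
rewrite N0 /= andbT.
have hN : `|(A s).1.2 + t * (stretch a b (A s).1.2 - (A s).1.2) -
            ((A s').1.2 + t * (stretch a b (A s').1.2 - (A s').1.2))| <= N.
  by have := lexx N; rewrite {1}/N norm3_le /= => /and3P[].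
move: hN; move: (A s).1.2 (A s').1.2 => y y' {N0}.
rewrite mulrAC ler_pdivlMr //.
wlog yy' : y y' / y' <= y => [hw h|h].
  have [yy'|/ltW yy'] := leP y' y; first exact: hw.
  by rewrite distrC; apply: hw => //; rewrite distrC.
have /andP[h1 h2] := stretch_bounds a0 b0 yy'.
rewrite -/m in h1; rewrite -/M in h2.
have d0 : 0 <= y - y' by rewrite subr_ge0.
have md0 : 0 <= m * (y - y') by rewrite mulr_ge0 // ltW.
set sg := stretch a b y - stretch a b y' in h1 h2.
have lo : m * (y - y') <= N.
  apply: le_trans h; apply: le_trans (ler_norm _).
  have -> : y + t * (stretch a b y - y) - (y' + t * (stretch a b y' - y')) =
    (1 - t) * (y - y') + t * sg by rewrite /sg; ring.
  have : t * (m * (y - y')) <= t * sg by rewrite ler_wpM2l.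
  have : (1 - t) * (m * (y - y')) <= (1 - t) * (y - y').
    by rewrite ler_wpM2l ?subr_ge0 // ler_piMl.
  by lra.
have hi : `|stretch a b y - y - (stretch a b y' - y')| <= (M + 1) * (y - y').
  have -> : stretch a b y - y - (stretch a b y' - y') = sg - (y - y') by rewrite /sg; ring.
  by rewrite ler_norml; lra.
apply: (@le_trans _ _ ((M + 1) * (y - y') * m)); first by rewrite ler_wpM2r // ltW.
by rewrite -mulrA ler_wpM2l ?(mulrC _ m) //; lra.
Qed.
End WordClosure.

(** * Closing arcs as traces of the pages *)

Section ClosureSets.
Variables (R : realType) (n : nat).
Implicit Types (x y z t p u : R) (w : braid_word n).

Lemma between_conv (a b y : R) : a <= b ->
  (exists2 s, 0 <= s <= 1 & y = a + s * (b - a)) <-> a <= y <= b.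
Proof.
move=> ab; split=> [[s /andP[s0 s1] ->]|/andP[ay yb]].
  have : 0 <= s * (b - a) by rewrite mulr_ge0 // subr_ge0.
  have : s * (b - a) <= b - a by rewrite ler_piMl // subr_ge0.
  by lra.
have [e|ne] := eqVneq a b; first by exists 0; [rewrite lexx ler01|lra].
have d0 : 0 < b - a by rewrite subr_gt0 lt_def eq_sym ne.
exists ((y - a) / (b - a)); last by rewrite divfK ?gt_eqF //; lra.
by rewrite divr_ge0 ?subr_ge0 //= ler_pdivrMr // mul1r; lra.
Qed.

Lemma segment_sym (a b : space R) : segment a b = segment b a.
Proof.
have sub (c d : space R) : segment c d `<=` segment d c.
  move=> P [s]; rewrite /= in_itv /= => /andP[s0 s1] <-.
  exists (1 - s); first by rewrite /= in_itv /=; lra.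
  by rewrite scalerBl scale1r addrA (addrC d) subrK -scalerN opprB.
by apply/seteqP; split; exact: sub.
Qed.

Lemma vsegP x z a b (P : space R) : a <= b ->
  segment (pt x a z) (pt x b z) P <-> [/\ P.1.1 = x, P.2 = z & a <= P.1.2 <= b].
Proof.
move=> ab; split.
  move=> [s]; rewrite /= in_itv /= => hs <-; split.
  - by rewrite /= /GRing.scale /= subrr mulr0 addr0.
  - by rewrite /= /GRing.scale /= subrr mulr0 addr0.
  - by apply/between_conv => //; exists s.
case: P => [[x' y'] z'] /= [-> -> hb]; have [s hs ->] := (between_conv _ ab).2 hb.
exists s; first by rewrite /= in_itv.
by rewrite /pt; congr (_, _, _) => /=; rewrite /GRing.scale /= subrr mulr0 addr0.
Qed.

Lemma hsegP y z a b (P : space R) : a <= b ->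
  segment (pt a y z) (pt b y z) P <-> [/\ P.1.2 = y, P.2 = z & a <= P.1.1 <= b].
Proof.
move=> ab; split.
  move=> [s]; rewrite /= in_itv /= => hs <-; split.
  - by rewrite /= /GRing.scale /= subrr mulr0 addr0.
  - by rewrite /= /GRing.scale /= subrr mulr0 addr0.
  - by apply/between_conv => //; exists s.
case: P => [[x' y'] z'] /= [-> -> hb]; have [s hs ->] := (between_conv _ ab).2 hb.
exists s; first by rewrite /= in_itv.
by rewrite /pt; congr (_, _, _) => /=; rewrite /GRing.scale /= subrr mulr0 addr0.
Qed.

Definition arc_pt (a : R) (j : 'I_n) (P : space R) : Prop :=
  let d : R := n%:R - j%:R in
  P.2 = 0 /\
  [\/ P.1.1 = j%:R /\ a <= P.1.2 <= a + d,
      P.1.2 = a + d /\ j%:R <= P.1.1 <= n%:R + d,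
      P.1.1 = n%:R + d /\ - d <= P.1.2 <= a + d |
      P.1.2 = - d /\ j%:R <= P.1.1 <= n%:R + d \/ P.1.1 = j%:R /\ - d <= P.1.2 <= 0].

Lemma arc_width (j : 'I_n) : 1 <= n%:R - j%:R :> R.
Proof. by rewrite lerBrDr addrC natr1 ler_nat. Qed.

Lemma closing_arcE (L : nat) (j : 'I_n) (P : space R) :
  closing_arc L j P <-> arc_pt L%:R j P.
Proof.
have d1 := arc_width j; have L0 := ler0n R L.
rewrite /closing_arc /= /arc_pt; set d : R := n%:R - j%:R in d1 *.
have e1 := @vsegP j%:R 0 L%:R (L%:R + d) P (_ : L%:R <= L%:R + d).
have e2 := @hsegP (L%:R + d) 0 j%:R (n%:R + d) P (_ : j%:R <= n%:R + d).
have e3 := @vsegP (n%:R + d) 0 (- d) (L%:R + d) P (_ : - d <= L%:R + d).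
have e4 := @hsegP (- d) 0 j%:R (n%:R + d) P (_ : j%:R <= n%:R + d).
have e5 := @vsegP j%:R 0 (- d) 0 P (_ : - d <= 0).
have h1 : L%:R <= L%:R + d by lra.
have h2 : j%:R <= n%:R + d by move: d1; rewrite /d; lra.
have h3 : - d <= L%:R + d by lra.
have h5 : - d <= 0 by lra.
rewrite (segment_sym (pt (n%:R + d) (L%:R + d) 0)) (segment_sym (pt (n%:R + d) (- d) 0) (pt j%:R _ _)).
split.
  case=> [/(e1 h1)[]|[/(e2 h2)[]|[/(e3 h3)[]|[/(e4 h2)[]|[/(e5 h5)[]|//]]]]] => ? ? ?; split => //.
  - by constructor 1.
  - by constructor 2.
  - by constructor 3.
  - by constructor 4; left.
  - by constructor 4; right.
move=> [z0 [[]|[]|[]|[[]|[]]]] => ? ?.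
- by left; apply/e1.
- by right; left; apply/e2.
- by right; right; left; apply/e3.
- by right; right; right; left; apply/e4.
- by right; right; right; right; left; apply/e5.
Qed.

Lemma page_left p (c : R * R) : 0 <= p <= 1 -> page_pt n p c = pt c.1 p c.2.
Proof.
move=> hp; have [e1 e2 e3] := page_specE (Page0 hp).
by rewrite /page_pt e1 e2 e3 /pt; congr (_, _, _); lra.
Qed.

(** The pages are made for this: from page 1 to page 8 the point at position [j] runs along the
    closing arc of [j] for a strip of height 1. *)
Lemma page_arcs (j : 'I_n) (P : space R) :
  (exists2 p, 1 <= p <= 8 & P = page_pt n p (j%:R, 0)) <-> arc_pt 1 j P.
Proof.
have d1 := arc_width j; rewrite /arc_pt; set d : R := n%:R - j%:R in d1 *.
have ej : j%:R = n%:R - d :> R by rewrite /d; lra.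
have d0 : 0 < d by lra.
split.
  move=> [p hp ->]; have hp' : 0 <= p <= 8 by lra.
  split => //; rewrite /page_pt /= -/d ej.
  have conv q : 0 <= q <= 1 -> 0 <= d * q <= d.
    by move=> /andP[q0 q1]; rewrite mulr_ge0 ?(ltW d0) //= ler_piMr // ltW.
  case: (pageP hp') => h.
  - by constructor 1; split; lra.
  - constructor 1; have : 0 <= p - 1 <= 1 by lra.
    by move=> /conv; split; lra.
  - constructor 2; have : 0 <= p - 2 <= 1 by lra.
    by move=> /conv; split; lra.
  - constructor 3; have : 0 <= 4 - p <= 1 by lra.
    by move=> /conv; split; lra.
  - by constructor 3; split; lra.
  - constructor 3; have : 0 <= p - 5 <= 1 by lra.
    by move=> /conv; split; lra.
  - constructor 4; left; have : 0 <= p - 6 <= 1 by lra.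
    by move=> /conv; split; lra.
  - constructor 4; right; have : 0 <= 8 - p <= 1 by lra.
    by move=> /conv; split; lra.
case: P => [[x y] z] /= [-> H].
have frac v : 0 <= v <= d -> exists2 q, 0 <= q <= 1 & v = d * q.
  move=> /andP[v0 vd]; exists (v / d); last by rewrite mulrC divfK // gt_eqF.
  by rewrite divr_ge0 ?(ltW d0) //= ler_pdivrMr // mul1r.
have frac2 v : n%:R - d <= v <= n%:R + d -> exists2 q, 0 <= q <= 1 & v = n%:R + d * (2 * q - 1).
  move=> hv; have [|q hq e] := frac ((v - (n%:R - d)) / 2); first by lra.
  by exists q => //; lra.
have fin p b0 bx by' : 1 <= p <= 8 -> page_spec p b0 bx by' ->
    x = n%:R + d * bx -> y = b0 + d * by' ->
    exists2 p0, 1 <= p0 <= 8 & (x, y, 0) = page_pt n p0 (j%:R, 0) :> space R.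
  move=> hp sp ex ey; exists p => //.
  by have [e1 e2 e3] := page_specE sp; rewrite /page_pt /= -/d /pt e1 e2 e3 -ex -ey.
case: H => [[ex hy]|[ey hx]|[ex hy]|[[ey hx]|[ex hy]]].
- have [|q hq e] := frac (y - 1); first by lra.
  by apply: (fin (1 + q) _ _ _ _ (Page1 _)); lra.
- have [|q hq e] := frac2 x; first by lra.
  have e' : 2 * (2 + q) - 5 = 2 * q - 1 by lra.
  by apply: (fin (2 + q) _ _ _ _ (Page2 _)); rewrite ?e'; lra.
- have [y1|y1] := leP 1 y.
    have [|q hq e] := frac (y - 1); first by lra.
    by apply: (fin (4 - q) _ _ _ _ (Page3 _)); lra.
  have [y0|y0] := leP 0 y.
    by apply: (fin (5 - y) _ _ _ _ (Page4 _)); lra.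
  have [|q hq e] := frac (- y); first by lra.
  by apply: (fin (5 + q) _ _ _ _ (Page5 _)); lra.
- have [|q hq e] := frac2 x; first by lra.
  have e' : 13 - 2 * (7 - q) = 2 * q - 1 by lra.
  by apply: (fin (7 - q) _ _ _ _ (Page6 _)); rewrite ?e'; lra.
- have [|q hq e] := frac (- y); first by lra.
  by apply: (fin (8 - q) _ _ _ _ (Page7 _)); lra.
Qed.
End ClosureSets.

(** * The standard closure as a path of configurations *)

Section WordClosureIsotopy.
Variables (R : realType) (n : nat).
Implicit Types (x y z t p u : R) (w : braid_word n).

Notation conf := ('I_n -> R * R)%type.
Implicit Types (a b c m e : conf) (l r : seq conf).

Lemma plpath_catl a l r u j : u <= (size l)%:R ->
  plpath (a :: l ++ r) u j = plpath (a :: l) u j.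
Proof.
rewrite /plpath => ul; congr (_ + _); elim: l a u ul => [|b l IH] a u /= ul.
  by rewrite increments0.
by rewrite IH //; move: ul; rewrite -natr1; lra.
Qed.

Lemma plpath_catr a l r u j : (size l)%:R <= u ->
  plpath (a :: l ++ r) u j = plpath (last a l :: r) (u - (size l)%:R) j.
Proof.
rewrite /plpath; elim: l a u => [|b l IH] a u /= ul; first by rewrite subr0.
have l0 := ler0n R (size l); move: ul; rewrite -natr1 => ul.
rewrite clamp1; last by lra.
rewrite scale1r addrA (addrC (a j)) subrK IH; last by lra.
by congr (_ + increments _ _ _ _); lra.
Qed.

(** A letter has height 1 and takes two steps of the path, hence [u / 2]. *)
Definition path_curve l : set (space R) :=
  [set P | exists u j, 0 <= u <= (size l).-1%:R /\
    P = pt (plpath l u j).1 (u / 2) (plpath l u j).2].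

Definition step_segment (h : R) (c m : conf) (j : 'I_n) : set (space R) :=
  segment (pt (c j).1 h (c j).2) (pt (m j).1 (h + 1 / 2) (m j).2).

Lemma step_segmentP h c m j P : step_segment h c m j P <->
  exists2 t, 0 <= t <= 1 &
    P = pt (lerp t (c j) (m j)).1 (h + t / 2) (lerp t (c j) (m j)).2.
Proof.
have E t : pt (c j).1 h (c j).2 + t *: (pt (m j).1 (h + 1 / 2) (m j).2 - pt (c j).1 h (c j).2)
    = pt (lerp t (c j) (m j)).1 (h + t / 2) (lerp t (c j) (m j)).2 :> space R.
  by rewrite /pt /lerp; congr (_, _, _) => /=; rewrite /GRing.scale /=; lra.
split; first by move=> [t]; rewrite /= in_itv /= => ht <-; exists t; rewrite -?E.
by move=> [t ht ->]; exists t; rewrite /= ?in_itv //= E.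
Qed.

Lemma path_curve_step a l m e P : let N : R := (size l)%:R in
  path_curve ((a :: l) ++ [:: m; e]) P <->
  path_curve (a :: l) P \/
  exists j, step_segment (N / 2) (last a l) m j P \/
            step_segment (N / 2 + 1 / 2) m e j P.
Proof.
move=> N; have N0 : 0 <= N by exact: ler0n.
have e1 t j : 0 <= t <= 1 ->
    plpath [:: last a l; m; e] t j = lerp t (last a l j) (m j).
  by move=> t01; have := @plpath_eval _ _ (last a l) [:: m; e] 0 t j erefl t01; rewrite add0r.
have e2 t j : 0 <= t <= 1 -> plpath [:: last a l; m; e] (1 + t) j = lerp t (m j) (e j).
  exact: (@plpath_eval _ _ (last a l) [:: m; e] 1 t j erefl).
have sz : (size ((a :: l) ++ [:: m; e])).-1%:R = N + 2 :> R.
  by rewrite size_cat /= natrD.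
split.
  move=> [u [j [/andP[u0 u2] ->]]]; rewrite sz in u2.
  have [uN|/ltW uN] := leP u N.
    by left; exists u, j; rewrite u0 uN cat_cons plpath_catl.
  right; exists j; rewrite cat_cons plpath_catr // -/N.
  have [uN1|/ltW uN1] := leP u (N + 1).
    left; apply/step_segmentP; exists (u - N); first by lra.
    by rewrite e1; [congr (pt _ _ _); lra|lra].
  right; apply/step_segmentP; exists (u - N - 1); first by lra.
  have -> : u - N = 1 + (u - N - 1) by lra.
  rewrite e2; last by lra.
  by congr (pt _ _ _); first [congr (_.1); congr (lerp _ _ _)|congr (_.2); congr (lerp _ _ _)|idtac]; lra.
case=> [[u [j [/andP[u0 uN] ->]]]|[j [/step_segmentP|/step_segmentP] [t /andP[t0 t1] ->]]].
- exists u, j; split; first by rewrite sz u0 /=; move: uN; rewrite /= -/N; lra.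
  by rewrite cat_cons plpath_catl.
- exists (N + t), j; split; first by rewrite sz; lra.
  rewrite cat_cons plpath_catr -/N ?lerDl // (addrC N) addrK e1 ?t0 //.
  by congr (pt _ _ _); lra.
- exists (N + (1 + t)), j; split; first by rewrite sz; lra.
  rewrite cat_cons plpath_catr -/N; last by lra.
  rewrite (addrC N) addrK e2 ?t0 //.
  by congr (pt _ _ _); lra.
Qed.

Lemma size_word_path w : size (word_path R w) = (2 * size w).+1.
Proof. by elim: w => //= a w IH; rewrite size_cat IH /=; lia. Qed.

(** The drawing is indexed by current positions and the path by first positions, whence [s j] in
    [seg]. The second alternative accounts for the empty word: its path is one configuration, its
    drawing is empty. *)
Lemma word_strands_curve w P :
  path_curve (word_path R w) P <->
  @word_strands R n w P \/ exists j : 'I_n, P = pt j%:R 0 0.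
Proof.
elim: w P => [|a w IH] P.
  split.
    move=> [u [j [/andP[u0]]]] /= u0' ->; right; exists j.
    have -> : u = 0 by apply/le_anti; rewrite u0 u0'.
    by rewrite mul0r /plpath /= !addr0 perm1.
  case=> // -[j ->]; exists 0, j; split; first by rewrite /= lexx.
  by rewrite mul0r /plpath /= !addr0 perm1.
have sw := size_word_path w; have hw := word_path_head R w.
set l := behead (word_path R w) in hw.
have sl : (size l)%:R / 2 = (size w)%:R :> R.
  move: sw; rewrite hw /= => -[->]; rewrite natrM mulrC mulKf //.
set s := word_perm w.
have lst : last (std R 1%g) l = std R s.
  by have := word_path_last (std R 1%g) w; rewrite hw /=.
have seg (j : 'I_n) : @letter_strand R n a (size w) (s j) P <->
    step_segment ((size l)%:R / 2) (last (std R 1%g) l) (letter_mid R a s) j P \/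
    step_segment ((size l)%:R / 2 + 1 / 2) (letter_mid R a s) (std R (s * adj_transp a.1)%g) j P.
  have e : (size w)%:R + 1 / 2 + 1 / 2 = (size w)%:R + 1 :> R by lra.
  rewrite sl lst /step_segment /std /letter_mid e permM /letter_strand /=.
  by split; [case=> [h|[h|[]]]; [left|right]|case=> h; [left|right; left]].
rewrite [word_path R (a :: w)]/= hw path_curve_step -hw IH /= -/s; split.
  case=> [[h|h]|[j /seg h]]; [by left; right|by right|left; left].
  by exists (s j).
case=> [[[j _ h]|h]|h]; [|by left; left|by left; right].
by right; exists ((s^-1)%g j); apply/seg; rewrite permKV.
Qed.

Lemma word_closureE w P : word_closure R w P <->
  path_curve (word_path R w) P \/ exists j : 'I_n, arc_pt (size w)%:R j P.
Proof.
have zero (j : 'I_n) : arc_pt (size w)%:R j (pt j%:R 0 0 : space R).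
  have := arc_width R j; split => //; constructor 4; right; split => //=; lra.
rewrite word_strands_curve /word_closure; split.
  by move=> [h|[j _ /closing_arcE h]]; [left; left|right; exists j].
case=> [[h|[j ->]]|[j h]]; [by left|right|right].
  by exists j => //; apply/closing_arcE.
by exists j => //; apply/closing_arcE.
Qed.

Definition strip_param (N : nat) p : R := N%:R * clamp p.

Lemma strip_paramP N : param N (strip_param N).
Proof.
split; rewrite /strip_param.
- exists N%:R => // p q _ _; rewrite -mulrBr normrM ger0_norm //.
  by rewrite ler_wpM2l // clamp_lip.
- by rewrite clamp0 // mulr0.
- by rewrite clamp1 ?mulr1 //; lra.
- by move=> p _; rewrite mulr_ge0 ?clamp_ge0 //= ler_piMr // clamp_le1.
Qed.

Lemma strip_path_set w (P : space R) :
  path_set (word_path R w) (strip_param (2 * size w)) P <->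
  (exists p j, 0 <= p <= 1 /\ let c := plpath (word_path R w) ((2 * size w)%:R * p) j in
     P = pt c.1 p c.2) \/ exists j : 'I_n, arc_pt 1 j P.
Proof.
set N := (2 * size w)%N; set W := word_path R w.
have last j : plpath W N%:R j = ((word_perm w j)%:R, 0).
  have -> : N = (size W).-1 by rewrite /W size_word_path.
  by rewrite plpath_end /W word_path_last.
split.
  move=> [[j p] /= hp <-].
  have [p1|p1] := leP p 1.
    have hp1 : 0 <= p <= 1 by lra.
    by left; exists p, j; rewrite page_left // /strip_param clamp_id.
  right; exists (word_perm w j); apply/page_arcs; exists p; first by lra.
  by rewrite /strip_param clamp1 ?mulr1 ?last // ltW.
case=> [[p [j [hp ->]]]|[j /page_arcs[p hp ->]]].
  exists (j, p); first by rewrite /=; lra.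
  by rewrite /= page_left // /strip_param clamp_id.
exists (((word_perm w)^-1)%g j, p); first by rewrite /=; lra.
by rewrite /= /strip_param clamp1 ?mulr1 ?last ?permKV //; lra.
Qed.

Lemma arc_stretch (a b : R) (j : 'I_n) (P : space R) : 0 < a -> 0 < b ->
  arc_pt a j P -> arc_pt b j (stretch_map a b P).
Proof.
move=> a0 b0; have d1 := arc_width R j; rewrite /arc_pt /stretch_map.
set d : R := n%:R - j%:R in d1 *; case: P => [[x y] z] /= [-> H]; split => //.
have hi : a <= y -> stretch a b y = y - a + b := stretch_high b a0.
have lo : y <= 0 -> stretch a b y = y := stretch_low b a0.
case: H => [[ex hy]|[ey hx]|[ex hy]|[[ey hx]|[ex hy]]].
- by constructor 1; rewrite hi; lra.
- by constructor 2; rewrite hi; lra.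
- constructor 3; split => //; have [y0|y0] := leP y 0; first by rewrite lo; lra.
  have [ya|/ltW ya] := leP y a; last by rewrite hi; lra.
  rewrite stretch_mid ?(ltW y0) //.
  have : 0 <= b / a * y by rewrite !mulr_ge0 ?invr_ge0 // ltW.
  have : b / a * y <= b by rewrite mulrAC ler_pdivrMr // ler_pM2l.
  by lra.
- by constructor 4; left; rewrite lo; lra.
- by constructor 4; right; rewrite lo; lra.
Qed.

(* With no letter the strip [0, 1] of the pages has to be opened. *)
Lemma arc0_stretch (j : 'I_n) (P : space R) :
  arc_pt 0 j P -> let P' := stretch_map 2^-1 (3 / 2) P in
  arc_pt 1 j P' \/ [/\ P'.1.1 = j%:R, P'.2 = 0 & 0 <= P'.1.2 <= 1].
Proof.
have d1 := arc_width R j; rewrite /arc_pt /stretch_map.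
set d : R := n%:R - j%:R in d1 *; case: P => [[x y] z] /= [-> H].
have a0 : 0 < 2^-1 :> R by lra.
have hi : 2^-1 <= y -> stretch 2^-1 (3 / 2) y = y - 2^-1 + 3 / 2 := stretch_high _ a0.
have lo : y <= 0 -> stretch 2^-1 (3 / 2) y = y := stretch_low _ a0.
have mi : 0 <= y <= 2^-1 -> stretch 2^-1 (3 / 2) y = 3 * y.
  by move=> h; rewrite stretch_mid //; lra.
case: H => [[ex hy]|[ey hx]|[ex hy]|[[ey hx]|[ex hy]]].
- have [h|h] := leP y 2^-1; last by left; split=> //; constructor 1; rewrite hi; lra.
  have [h3|h3] := leP (3 * y) 1; first by right; split=> //; rewrite mi; lra.
  by left; split=> //; constructor 1; rewrite mi; lra.
- by left; split=> //; constructor 2; rewrite hi; lra.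
- left; split=> //; constructor 3; split => //.
  have [y0|y0] := leP y 0; first by rewrite lo; lra.
  by have [h|h] := leP y 2^-1; [rewrite mi|rewrite hi]; lra.
- by left; split=> //; constructor 4; left; rewrite lo; lra.
- by left; split=> //; constructor 4; right; rewrite lo; lra.
Qed.

Lemma arc1_stretch (j : 'I_n) (P : space R) :
  arc_pt 1 j P \/ [/\ P.1.1 = j%:R, P.2 = 0 & 0 <= P.1.2 <= 1] ->
  arc_pt 0 j (stretch_map (3 / 2) 2^-1 P).
Proof.
have d1 := arc_width R j; rewrite /arc_pt /stretch_map.
set d : R := n%:R - j%:R in d1 *; case: P => [[x y] z] /=.
have a0 : 0 < 3 / 2 :> R by lra.
have hi : 3 / 2 <= y -> stretch (3 / 2) 2^-1 y = y - 3 / 2 + 2^-1 := stretch_high _ a0.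
have lo : y <= 0 -> stretch (3 / 2) 2^-1 y = y := stretch_low _ a0.
have mi : 0 <= y <= 3 / 2 -> stretch (3 / 2) 2^-1 y = y / 3.
  by move=> h; rewrite stretch_mid //; lra.
case=> [[-> H]|[-> -> hy]]; split => //; last first.
  by constructor 1; rewrite mi; lra.
case: H => [[ex hy]|[ey hx]|[ex hy]|[[ey hx]|[ex hy]]].
- by constructor 1; have [h|h] := leP y (3 / 2); [rewrite mi|rewrite hi]; lra.
- by constructor 2; rewrite hi; lra.
- constructor 3; split => //; have [y0|y0] := leP y 0; first by rewrite lo; lra.
  by have [h|h] := leP y (3 / 2); [rewrite mi|rewrite hi]; lra.
- by constructor 4; left; rewrite lo; lra.
- by constructor 4; right; rewrite lo; lra.
Qed.

Lemma stretch_mapK (a b : R) : 0 < a -> 0 < b ->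
  cancel (stretch_map a b : space R -> space R) (stretch_map b a).
Proof. by move=> a0 b0 [[x y] z]; rewrite /stretch_map /= stretchK. Qed.

(** Stretching [0, size w] onto [0, 1] shifts what lies above as a block, which turns the closing
    arcs into those traced by the pages. *)
Theorem word_closure_isotopy w :
  ambient_isotopic (word_closure R w)
    (path_set (word_path R w) (strip_param (2 * size w))).
Proof.
have [e|L0] := posnP (size w).
  have w0 : w = [::] by case: w e.
  (* A strip of height 0 cannot be stretched. Since all arcs rise at least to height 1, stretching
     [0, 1/2] onto [0, 3/2] lifts their tops by 1 instead. *)
  subst w; have a0 : 0 < 2^-1 :> R by lra.
  have pl u (j : 'I_n) : plpath (word_path R ([::] : braid_word n)) u j = (j%:R, 0).
    by rewrite /plpath /= addr0 /std perm1.
  have b0 : 0 < 3 / 2 :> R by lra.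
  have := @stretch_isotopy R _ _ (word_closure R ([::] : braid_word n)) a0 b0.
  congr (ambient_isotopic _ _); apply/seteqP; split.
    move=> _ [P /word_closureE h <-]; apply/strip_path_set; case: h.
      move=> [u [j [/andP[u0 u0']]]] /= -> .
      have {u0 u0'}-> : u = 0 by apply/le_anti; rewrite u0 u0'.
      left; exists 0, j; split; first by rewrite lexx ler01.
      by rewrite /stretch_map /= mul0r stretch_low // mulr0.
    move=> [j /arc0_stretch[h|]]; first by right; exists j.
    case=> e1 e2 h; left; exists (stretch_map 2^-1 (3 / 2) P).1.2, j; split=> //.
    by rewrite pl -e1 -e2.
  move=> P /strip_path_set h; exists (stretch_map (3 / 2) 2^-1 P); last by rewrite stretch_mapK.
  apply/word_closureE; right; case: h => [[p [j [hp]]]|[j h]]; last first.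
    by exists j; apply: arc1_stretch; left.
  rewrite pl => ->; exists j; apply: arc1_stretch; right.
  by split.
have L0' : 0 < (size w)%:R :> R by rewrite ltr0n.
have N2 : (2 * size w)%:R = 2 * (size w)%:R :> R by rewrite natrM.
have := stretch_isotopy (word_closure R w) L0' ltr01.
congr (ambient_isotopic _ _); apply/seteqP; split.
  move=> _ [P /word_closureE h <-]; apply/strip_path_set; case: h; last first.
    by move=> [j h]; right; exists j; exact: arc_stretch.
  move=> [u [j []]]; rewrite size_word_path /= N2 => hu ->; left.
  have hp : 0 <= u / 2 / (size w)%:R <= 1.
    rewrite divr_ge0 ?(ltW L0') //=; last by lra.
    by rewrite ler_pdivrMr // mul1r; lra.
  exists (u / 2 / (size w)%:R), j; split => //.
  have eu : 2 * (size w)%:R * (u / 2 / (size w)%:R) = u by field; rewrite gt_eqF.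
  rewrite eu /stretch_map /= stretch_mid //; last by lra.
  by congr (pt _ _ _); rewrite div1r mulrC.
move=> P /strip_path_set h; exists (stretch_map 1 (size w)%:R P); last by rewrite stretch_mapK.
apply/word_closureE; case: h => [[p [j [hp ->]]]|[j h]]; last first.
  by right; exists j; exact: arc_stretch.
left; exists ((2 * size w)%:R * p), j; rewrite size_word_path /=; split.
  by rewrite mulr_ge0 //= ?ler_piMr //; case/andP: hp.
rewrite /stretch_map /= stretch_mid //; congr (pt _ _ _).
by rewrite N2; lra.
Qed.
End WordClosureIsotopy.

(** * From the sorted path to the petal loop *)

Section LoopLex.
Variables (R : realType) (n : nat).
Implicit Types (p q t u B : R) (s : 'S_n).

Notation conf := ('I_n -> R * R)%type.

(** The order may vary with the page; compactness of the rectangle of times and pages gives the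
    uniform gap. *)
Theorem loop_isotopy_lex s B (G0 G1 : R -> conf) : loop s B G0 -> loop s B G1 ->
  (forall p, 0 <= p <= 8 -> separated [:: G0 p; G1 p]) ->
  ambient_isotopic (loop_set G0) (loop_set G1).
Proof.
move=> L0 L1 sep.
(* A loop is controlled on [0, 8] only; clamping the page gives a function continuous on the whole
   plane. *)
pose c8 p := Num.max 0 (Num.min 8 p).
have c8P p : 0 <= c8 p <= 8.
  by rewrite /c8 le_max lexx ge_max ge_min lexx /=; lra.
have c8id p : 0 <= p <= 8 -> c8 p = p.
  by move=> /andP[p0 p8]; rewrite /c8 min_r // max_r.
have c8lip p q : `|c8 p - c8 q| <= `|p - q|.
  have h x y : `|x - y| <= `|p - q| -> `|Num.max 0 x - Num.max 0 y| <= `|p - q|.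
    by rewrite !ler_norml; case: (leP 0 x); case: (leP 0 y); lra.
  apply: h; rewrite ler_norml; have := ler_norm (p - q); have := ler_norm (q - p).
  by rewrite (distrC q p); case: (leP 8 p); case: (leP 8 q); lra.
pose P (jk : 'I_n * 'I_n) x := forall t p, 0 <= t <= 1 -> 0 <= p <= 8 -> jk.1 != jk.2 ->
  x <= `|lerp t (G0 p jk.1) (G1 p jk.1) - lerp t (G0 p jk.2) (G1 p jk.2)|.
have gap (j k : 'I_n) : (j < k)%N -> exists2 x, 0 < x & P (j, k) x.
  move=> jk.
  pose f (x : R * R) := `|lerp x.1 (G0 (c8 x.2) j - G0 (c8 x.2) k)
                                  (G1 (c8 x.2) j - G1 (c8 x.2) k)|.
  have cG G (i : 'I_n) : loop s B G -> continuous (fun x : R * R => G (c8 x.2) i).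
    move=> [B0 l _ _]; apply: (@lip_continuous _ _ _ _ B) => x y.
    apply: le_trans (l _ _ _ (c8P _) (c8P _)) _; rewrite ler_wpM2l //.
    by apply: le_trans (c8lip _ _) _; have := lexx `|x - y|; rewrite {1}norm2_le => /andP[].
  have cf : continuous f.
    move=> x; apply: cvg_norm; apply: cvgD.
      by apply: cvgB; exact: cG.
    apply: cvgZ; first exact: cvg_fst.
    by apply: cvgB; apply: cvgB; exact: cG.
  pose Q := `[0, 1]%classic `*` `[0, 8]%classic : set (R * R).
  have Q0 : Q !=set0 by exists (0, 0); split; rewrite /= in_itv /= lexx ?ler01 ?ler0n.
  have cQ : compact Q by apply: compact_setX; exact: segment_compact.
  have [x] := compact_EVT_min Q0 cQ (continuous_subspaceT cf).
  rewrite inE => -[]; rewrite /= !in_itv /= => x1 x2 xmin.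
  exists (f x).
    have [w /= [h1 [h2 _]]] := sep _ (c8P x.2) j k jk.
    by rewrite normr_gt0; apply: (@lexpos_neq0 _ w); exact: lexpos_lerp.
  move=> t p t01 p08 _; rewrite /= lerpB.
  have Qtp : (t, p) \in Q by rewrite inE; split; rewrite /= in_itv.
  by have := xmin _ Qtp; rewrite {2}/f /= c8id.
have [] := @bigmin_witness R _ P.
- by move=> i x y _ xy h t v t01 v01 ij; apply: le_trans xy _; exact: h.
- move=> [j k]; have [jk|kj|/val_inj->] := ltngtP j k; first exact: gap.
    have [x x0 h] := gap _ _ kj.
    by exists x => // t p t01 p08; rewrite /= eq_sym distrC; exact: h.
  by exists 1 => // t v _ _; rewrite eqxx.
move=> x x0 h; apply: (loop_isotopy x0 L0 L1) => t p j k t01 p08 jk.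
exact: (h (j, k)).
Qed.

Lemma loop_weaken s B B' (G : R -> conf) : B <= B' -> loop s B G -> loop s B' G.
Proof.
move=> BB [B0 l x e]; split => //; first exact: le_trans BB.
by move=> p q j hp hq; apply: le_trans (l _ _ _ hp hq) _; rewrite ler_wpM2r.
Qed.

Lemma loop_isotopy_lex' s B B' (G0 G1 : R -> conf) : loop s B G0 -> loop s B' G1 ->
  (forall p, 0 <= p <= 8 -> separated [:: G0 p; G1 p]) ->
  ambient_isotopic (loop_set G0) (loop_set G1).
Proof.
move=> L0 L1; have B0 : 0 <= B by case: L0.
have B0' : 0 <= B' by case: L1.
by apply: (loop_isotopy_lex (loop_weaken _ L0) (loop_weaken (_ : B' <= B + B') L1)); rewrite ?lerDl ?lerDr.
Qed.
End LoopLex.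

Ltac clamps := repeat match goal with |- context [clamp ?u] =>
  first [ rewrite (@clamp0 _ u); [|lra] | rewrite (@clamp1 _ u); [|lra]
        | rewrite (@clamp_id _ u); [|lra] ] end.

(** * Moving the closing page and hooking strand 0 *)

Section Sorting.
Variables (R : realType) (n : nat) (s1 s2 : 'S_n).
Hypothesis n0 : (0 < n)%N.
Implicit Types (p q t u B : R).

Notation conf := ('I_n -> R * R)%type.

(* The path is closed up one step later, on a page where strand 0, at the end of
   the previous strand, is the lowest one; hooking it over the others creates the
   additional crossing. *)
Definition low (k : 'I_n) : R := if k == 0%N :> nat then - n%:R else - k%:R.

(** Strand 0 passes the stacked strands alone, on the side x = -1, on its way from the bottom to the
    top. *)
Definition tip : conf := fun k => (if k == 0%N :> nat then - 1 else 0, - k%:R).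

(** Strand 0 overshoots to height [n], which gives the additional petal its extent, while the others
    are half-way from the stack to [std s2]. *)
Definition hook : conf := fun k =>
  if k == 0%N :> nat then (- 1, n%:R) else ((s2 k)%:R / 2, - k%:R / 2).

Let c := cyc_perm n.
Let V := stack (down R (n:=n)).
Let V' := stack (up R (n:=n)).

Lemma cyc_permE (j : 'I_n) : c j = (if j.+1 == n then 0%N else j.+1) :> nat.
Proof.
rewrite /c permE /=; case: eqP => [->|ne]; first by rewrite modnn.
by rewrite modn_small // ltn_neqAle ltn_ord andbT; apply/eqP.
Qed.

Lemma low_inj : injective low.
Proof.
move=> j k; rewrite /low; case: eqP => ej; case: eqP => ek h.
- by apply: val_inj; rewrite /= ej ek.
- by move/eqP: h; rewrite eqr_opp eqr_nat => /eqP e; have := ltn_ord k; rewrite -e ltnn.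
- by move/eqP: h; rewrite eqr_opp eqr_nat => /eqP e; have := ltn_ord j; rewrite e ltnn.
- by move/eqP: h; rewrite eqr_opp eqr_nat => /eqP /val_inj.
Qed.

(** Strand n - 1, the lowest of the stack [down], becomes strand 0, which [low] puts at the bottom.
    So [low \o c] orders the strands as [down] does, and the path can close up without unstacking
    them. *)
Lemma low_cyc_lt (j k : 'I_n) : (j < k)%N -> low (c k) < low (c j).
Proof.
move=> jk; rewrite /low !cyc_permE.
have -> : (j.+1 == n) = false by apply/eqP; have := ltn_ord k; lia.
have kn := ltn_ord k; have [e|ne] := eqVneq k.+1 n; rewrite /= ltrN2 ltr_nat; lia.
Qed.

Let sgx (s : 'S_n) (j k : 'I_n) : (j < k)%N ->
  exists e, 0 < e * ((s j)%:R - (s k)%:R) :> R.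
Proof.
move=> jk; have : s j != s k by rewrite (inj_eq perm_inj) -val_eqE ltn_eqF.
rewrite -val_eqE neq_ltn => /orP[] lt.
  by exists (- 1); rewrite mulN1r opprB subr_gt0 ltr_nat.
by exists 1; rewrite mul1r subr_gt0 ltr_nat.
Qed.

Definition sorted_path : seq conf :=
  [:: std R 1%g; V; std R s2; V'; std R s1; V; std R c].

Lemma std_stack_quads (s : 'S_n) (h : 'I_n -> R) (l : seq conf) : injective h -> quads (std R s :: l) (std R s :: l) ->
  quads (stack h :: std R s :: l) (stack h :: std R s :: l).
Proof.
move=> hi Q; split=> //.
by apply: separated_sub (std_stack_separated s hi) _ => o j k /=; tauto.
Qed.

Lemma stack_std_quads (s : 'S_n) (h : 'I_n -> R) (l : seq conf) : injective h -> quads (stack h :: l) (stack h :: l) ->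
  quads (std R s :: stack h :: l) (std R s :: stack h :: l).
Proof.
move=> hi Q; split=> //.
by apply: separated_sub (std_stack_separated s hi) _ => o j k /=; tauto.
Qed.

Lemma std_xbounded (s : 'S_n) (j : 'I_n) : (std R s j).1 <= n%:R - 1.
Proof. by rewrite /= lerBrDr natr1 ler_nat ltn_ord. Qed.

Lemma sorted_path_good : good c sorted_path.
Proof.
have [iu id] := (@up_inj R n, @down_inj R n).
split.
- do ![apply: stack_std_quads => //; apply: std_stack_quads => //].
  by apply: separated_sub (std_stack_separated c iu) _ => o j k /=; tauto.
- by do ![split; try exact: std_xbounded; try exact: stack_xbounded].
- by move=> j; rewrite /= /std perm1.
Qed.

Definition lifted_path : seq conf :=
  [:: stack low; std R 1%g; V; std R s2; V'; std R s1; V; stack (low \o c)].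

Lemma lifted_path_good_quads :
  quads (std R 1%g :: sorted_path) lifted_path /\ good c lifted_path.
Proof.
have [iu id] := (@up_inj R n, @down_inj R n).
have Q : quads (std R 1%g :: sorted_path) lifted_path.
  have S s h (hi : injective h) : separated [:: std R s; stack h; std R s; stack h].
    by apply: separated_sub (std_stack_separated s hi) _ => o j k /=; tauto.
  have S' s h (hi : injective h) : separated [:: stack h; std R s; stack h; std R s].
    by apply: separated_sub (std_stack_separated s hi) _ => o j k /=; tauto.
  have E : separated [:: V; std R c; V; stack (low \o c)].
    move=> j k jk; have [e he] := sgx c jk.
    have v1 : 0 < 1 * ((V j - V k).2) by rewrite mul1r subr_gt0 down_lt.
    exists ((0, 1), (e, 0)); do ![split => //]; apply: lexpos_zx; try by left.
      by right; rewrite /= subrr.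
    by left; rewrite /= mul1r subr_gt0 low_cyc_lt.
  split.
    by apply: separated_sub (std_stack_separated 1%g low_inj) _ => o j k /=; tauto.
  do ![split; first by [exact: S|exact: S']].
  split=> //; apply: separated_sub E _ => o j k /=; tauto.
split=> //; split.
- exact: quads_refl_l (quads_sym Q).
- by do ![split; try exact: std_xbounded; try exact: stack_xbounded].
- by [].
Qed.

Lemma sorted_lifted_isotopy :
  ambient_isotopic (path_closure sorted_path) (path_closure lifted_path).
Proof.
have [Q g] := lifted_path_good_quads.
(* Repeating the first configuration provides the additional step that the new start [stack low]
   takes. *)
have [d _] := @path_closure_dup R n c [::] (std R 1%g) (behead sorted_path) sorted_path_good.
apply: ambient_isotopic_trans d _.
have [e _] := peq_isotopy (@peq_dup R n [::] (std R 1%g) (behead sorted_path)) c.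
by apply: (path_move (e.1 sorted_path_good) g Q) => //; exact: std_paramP.
Qed.

Definition hooked_path : seq conf :=
  [:: stack low; hook; std R s2; V'; std R s1; V; stack (low \o c)].

Lemma tip_xbounded j : (tip j).1 <= n%:R - 1.
Proof.
have : 1 <= n%:R :> R by rewrite ler1n.
by rewrite /tip /=; case: ifP => _; lra.
Qed.

Lemma hook_xbounded j : (hook j).1 <= n%:R - 1.
Proof.
have := std_xbounded s2 j; have : 0 <= (s2 j)%:R :> R by [].
have : 1 <= n%:R :> R by rewrite ler1n.
by rewrite /hook /=; case: ifP => _ /=; lra.
Qed.

(** In [std 1] strand 0 is the leftmost; there it only passes from the bottom of the stack to the
    top. It can do so alone, as in [tip], and then the others need not return to [V] before they
    move to [std s2]. *)
Lemma lifted_hooked_peq : peq lifted_path hooked_path.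
Proof.
pose rest : seq conf := [:: V'; std R s1; V; stack (low \o c)].
apply: (@peq_trans _ _ _ [:: stack low, tip, V, std R s2 & rest]).
  apply: (@peq_move _ _ [::] (stack low) [:: std R 1%g] [:: tip] V (std R s2 :: rest)).
  - split; last split.
    + move=> j k jk; have k0 : (k == 0%N :> nat) = false by case: (k : nat) jk.
      have jk' : (j%:R : R) < k%:R by rewrite ltr_nat.
      have k0' : 0 < k%:R :> R by rewrite ltr0n; exact: leq_ltn_trans jk.
      have kn : (k%:R : R) < n%:R by rewrite ltr_nat.
      case: (eqVneq (j : nat) 0%N) => ej.
        exists ((- 1, 0), (0, - 1)); do ![split => //]; apply: lexpos_xz;
          rewrite /= /low /tip /= ?perm1 ?ej ?k0 /=; [right|left|right|left]; (lra || (split; lra)).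
      exists ((0, 1), (- 1, 0)); do ![split => //]; apply: lexpos_zx;
        rewrite /= /low /tip /= ?perm1 ?(negbTE ej) ?k0 /=; [left|right|left|left]; (lra || (split; lra)).
    + move=> j k jk; have k0 : (k == 0%N :> nat) = false by case: (k : nat) jk.
      have jk' : (j%:R : R) < k%:R by rewrite ltr_nat.
      have k0' : 0 < k%:R :> R by rewrite ltr0n; exact: leq_ltn_trans jk.
      have kn : (k%:R : R) < n%:R by rewrite ltr_nat.
      case: (eqVneq (j : nat) 0%N) => ej.
        exists ((- 1, 0), (0, 1)); do ![split => //]; apply: lexpos_xz;
          rewrite /= /low /tip /down /= ?perm1 ?ej ?k0 /=; [left|right|left|right]; (lra || (split; lra)).
      exists ((0, 1), (- 1, 0)); do ![split => //]; apply: lexpos_zx;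
        rewrite /= /low /tip /down /= ?perm1 ?(negbTE ej) ?k0 /=; [right|left|left|left]; (lra || (split; lra)).
    + move=> j k jk; have jk' : (j%:R : R) < k%:R by rewrite ltr_nat.
      have k0' : 0 < k%:R :> R by rewrite ltr0n; exact: leq_ltn_trans jk.
      exists ((0, 1), (- 1, 0)); do ![split => //]; apply: lexpos_zx; left;
        rewrite /= /down /=; lra.
  - by split => //; exact: std_xbounded.
  - by split => //; exact: tip_xbounded.
apply: (@peq_trans _ _ _ [:: stack low, hook, hook, std R s2 & rest]); last first.
  exact/peq_sym/(@peq_dup _ _ [:: stack low] hook (std R s2 :: rest)).
apply: (@peq_move _ _ [::] (stack low) [:: tip; V] [:: hook; hook] (std R s2) rest).
- have main (j k : 'I_n) (h : (j < k)%N) : exists o,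
      lexpos_all o j k [:: tip; V; hook; std R s2].
    have k0 : (k == 0%N :> nat) = false by case: (k : nat) h.
    have jk' : (j%:R : R) < k%:R by rewrite ltr_nat.
      have k0' : 0 < k%:R :> R by rewrite ltr0n; exact: leq_ltn_trans h.
    have j0 : 0 <= j%:R :> R by [].
    have kn : (k%:R : R) < n%:R by rewrite ltr_nat.
    have n0' : 0 < n%:R :> R by rewrite ltr0n.
    have [e he] := sgx s2 h.
    exists ((0, 1), (e, 0)); split; [|split; [|split; [|split => //]]]; apply: lexpos_zx.
    + by left; rewrite /tip /=; lra.
    + by left; rewrite /= /down; lra.
    + by left; rewrite /hook k0; case: (j == 0%N :> nat) => /=; lra.
    + by right; rewrite /= subrr.
  split; last split; last split.
  + move=> j k jk; have k0 : (k == 0%N :> nat) = false by case: (k : nat) jk.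
    have jk' : (j%:R : R) < k%:R by rewrite ltr_nat.
      have k0' : 0 < k%:R :> R by rewrite ltr0n; exact: leq_ltn_trans jk.
    have kn : (k%:R : R) < n%:R by rewrite ltr_nat.
    have sk : 0 <= (s2 k)%:R :> R by [].
    case: (eqVneq (j : nat) 0%N) => ej.
      exists ((- 1, 0), (0, - 1)); do ![split => //]; apply: lexpos_xz;
        rewrite /= /low /tip /hook /= ?ej ?k0 /=; [right|left|right|left]; (lra || (split; lra)).
    exists ((0, 1), (- 1, 0)); do ![split => //]; apply: lexpos_zx; left;
      rewrite /= /low /tip /hook /= ?(negbTE ej) ?k0 /=; lra.
  + by move=> j k /main[w /= h]; exists w => /=; tauto.
  + by move=> j k /main[w /= h]; exists w => /=; tauto.
  + by move=> j k /main[w /= h]; exists w => /=; tauto.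
- by split; [exact: tip_xbounded|split=> //; exact: stack_xbounded].
- by split; [exact: hook_xbounded|split=> //; exact: hook_xbounded].
Qed.
End Sorting.

Section Lipschitz8.
Variable R : realType.
Implicit Types (f g : R -> R) (p q u : R).

Definition lip8 f := exists2 B, 0 <= B &
  forall p q, 0 <= p <= 8 -> 0 <= q <= 8 -> `|f p - f q| <= B * `|p - q|.

Lemma lip8_cst u : lip8 (fun=> u).
Proof. by exists 0 => // p q _ _; rewrite subrr normr0 mul0r. Qed.

Lemma lip8D f g : lip8 f -> lip8 g -> lip8 (fun p => f p + g p).
Proof.
move=> [B B0 hf] [C C0 hg]; exists (B + C); first exact: addr_ge0.
move=> p q hp hq; rewrite opprD addrACA mulrDl.
by apply: le_trans (ler_normD _ _) _; rewrite lerD ?hf ?hg.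
Qed.

Lemma lip8N f : lip8 f -> lip8 (fun p => - f p).
Proof.
move=> [B B0 hf]; exists B => // p q hp hq.
by rewrite -opprD normrN; exact: hf.
Qed.

Lemma lip8B f g : lip8 f -> lip8 g -> lip8 (fun p => f p - g p).
Proof. by move=> hf hg; apply: lip8D => //; exact: lip8N. Qed.

Lemma lip8_bound f : lip8 f -> exists2 A, 0 <= A & forall p, 0 <= p <= 8 -> `|f p| <= A.
Proof.
move=> [B B0 hf]; exists (`|f 0| + B * 8); first by rewrite addr_ge0 // mulr_ge0.
move=> p hp; have h0 : 0 <= (0 : R) <= 8 by lra.
rewrite -[f p](subrK (f 0)) addrC; apply: le_trans (ler_normD _ _) _.
rewrite lerD2l; apply: le_trans (hf _ _ hp h0) _.
by rewrite ler_wpM2l // subr0 ger0_norm; lra.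
Qed.

Lemma lip8M f g : lip8 f -> lip8 g -> lip8 (fun p => f p * g p).
Proof.
move=> lf lg; have [A A0 bf] := lip8_bound lf; have [A' A0' bg] := lip8_bound lg.
case: lf lg => [B B0 hf] [C C0 hg]; exists (B * A' + A * C).
  by rewrite addr_ge0 ?mulr_ge0.
move=> p q hp hq.
have -> : f p * g p - f q * g q = (f p - f q) * g p + f q * (g p - g q) by ring.
apply: le_trans (ler_normD _ _) _; rewrite !normrM mulrDl; apply: lerD.
  by rewrite mulrAC; apply: ler_pM => //; [exact: hf|exact: bg].
by rewrite -mulrA; apply: ler_pM => //; [exact: bf|exact: hg].
Qed.

Lemma lip8_clamp a b : lip8 (fun p => clamp (a * p - b)).
Proof.
exists `|a| => // p q _ _; apply: le_trans (clamp_lip _ _) _.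
by rewrite (_ : a * p - b - (a * q - b) = a * (p - q)) ?normrM //; ring.
Qed.

Lemma lip8_clamp0 a : lip8 (fun p => clamp (a * p)).
Proof. by have := lip8_clamp a 0; congr lip8; apply/funext => p; rewrite subr0. Qed.

Lemma lip8_clampB b : lip8 (fun p => clamp (p - b)).
Proof. by have := lip8_clamp 1 b; congr lip8; apply/funext => p; rewrite mul1r. Qed.

Lemma lip8_clamp_id : lip8 (@clamp R).
Proof. by have := lip8_clampB 0; congr lip8; apply/funext => p; rewrite subr0. Qed.
End Lipschitz8.

Ltac prove_lip8 := repeat match goal with
  | |- lip8 (fun p => @?f p + - @?g p) => apply: (lip8B (f := f) (g := g))
  | |- lip8 (fun p => @?f p + @?g p) => apply: (lip8D (f := f) (g := g))
  | |- lip8 (fun p => - @?f p) => apply: (lip8N (f := f))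
  | |- lip8 (fun p => @?f p * @?g p) => apply: (lip8M (f := f) (g := g))
  | |- lip8 (fun=> ?u) => exact: lip8_cst
  | |- _ => first [exact: lip8_clamp_id | exact: lip8_clampB | exact: lip8_clamp | exact: lip8_clamp0]
  end.

(** * The loop whose projection is the rose *)

Section PetalConf.
Variables (R : realType) (n : nat) (s1 s2 : 'S_n).
Hypothesis n0 : (0 < n)%N.
Implicit Types (p q t u B : R) (j k : 'I_n).

Notation conf := ('I_n -> R * R)%type.
Let c := cyc_perm n.

(* The y-coordinate, measured from the multi-crossing, of the strands on page [p]. *)
Definition axis p : R := page_y0 p + n%:R * page_y p - 1 / 2.

(* In the (y, z)-plane strand [k] has slope [slope k p] as seen from the
   multi-crossing, apart from the detour of strand 0 before [p = 1 / 2]. *)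
Definition slope k p : R := 2 * k%:R + (clamp (p - 2) + clamp (p - 6)).

(* Strand [k] crosses the axis at height [s2 k] on page 1/2 and at height [s1 k] on
   page 9/2; before page 1/2 strand 0 is led around the others at [x = -1]. *)
Definition petal_conf p : conf := fun k =>
  ((if k == 0%N :> nat then - clamp (8 * p) + clamp (8 * p - 2) + (s2 k)%:R * clamp (8 * p - 3)
    else (s2 k)%:R * clamp (2 * p)) - (s2 k)%:R * clamp (2 * p - 1) +
   (s1 k)%:R * (clamp (2 * p - 8) - clamp (2 * p - 9)),
   (if k == 0%N :> nat then n%:R * (- 1 + 2 * clamp (8 * p - 1) - clamp (8 * p - 2)) else 0) +
   slope k p * axis p).

Let n1 : 1 <= n%:R :> R. Proof. by rewrite ler1n. Qed.

Let sbd (s : 'S_n) k : 0 <= ((s k)%:R : R) <= n%:R - 1.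
Proof. by rewrite ler0n /= lerBrDr natr1 ler_nat ltn_ord. Qed.

Lemma petal_conf_loop : exists B, loop c B petal_conf.
Proof.
have L k : exists2 B, 0 <= B & forall p q, 0 <= p <= 8 -> 0 <= q <= 8 ->
    `|petal_conf p k - petal_conf q k| <= B * `|p - q|.
  have [Bx Bx0 hx] : lip8 (fun p => (petal_conf p k).1).
    by rewrite /petal_conf /=; case: (_ == _); prove_lip8.
  have [Bz Bz0 hz] : lip8 (fun p => (petal_conf p k).2).
    by rewrite /petal_conf /slope /axis /page_y0 /page_y /=; case: (_ == _); prove_lip8.
  exists (Bx + Bz); first exact: addr_ge0.
  move=> p q hp hq; rewrite norm2_le; apply/andP; split.
    by apply: le_trans (hx _ _ hp hq) _; rewrite ler_wpM2r // lerDl.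
  by apply: le_trans (hz _ _ hp hq) _; rewrite ler_wpM2r // lerDr.
have [f hf] : exists f : 'I_n -> R, forall k, 0 <= f k /\ forall p q,
    0 <= p <= 8 -> 0 <= q <= 8 -> `|petal_conf p k - petal_conf q k| <= f k * `|p - q|.
  have ex' i : exists x, 0 <= x /\ forall p q, 0 <= p <= 8 -> 0 <= q <= 8 ->
      `|petal_conf p i - petal_conf q i| <= x * `|p - q|.
    by have [x x0 h] := L i; exists x.
  by have [f] := choice ex'; exists f.
exists (\sum_k f k); split.
- by apply: sumr_ge0 => k _; case: (hf k).
- move=> p q k hp hq; case: (hf k) => _ /(_ p q hp hq) /le_trans; apply.
  rewrite ler_wpM2r // (bigD1 k) //= lerDl sumr_ge0 // => i _; by case: (hf i).
- move=> p k /andP[p0 p8]; rewrite /petal_conf /=.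
  have /andP[a0 a1] := sbd s2 k; have /andP[b0 b1] := sbd s1 k.
  move: (s2 k)%:R (s1 k)%:R a0 a1 b0 b1 => a b a0 a1 b0 b1.
  have M (x y v : R) : 0 <= x <= y -> v <= 1 -> x * v <= y.
    by move=> /andP[x0 xy] v1; apply: le_trans xy; rewrite ler_piMr.
  have c0 (v : R) : 0 <= clamp v <= 1 by rewrite clamp_ge0 clamp_le1.
  have [p4|p4] := leP p 4.
    rewrite (@clamp0 _ (2 * p - 8)) ?(@clamp0 _ (2 * p - 9)); [|lra..].
    rewrite subr0 mulr0 addr0; have := c0 (2 * p - 1); have := c0 (8 * p).
    have := c0 (2 * p); have := c0 (8 * p - 3) => h1 h2 h3 h4.
    have ab : 0 <= a <= n%:R - 1 by rewrite a0.
    have : a * clamp (8 * p - 3) <= n%:R - 1 by apply: M => //; lra.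
    have : a * clamp (2 * p) <= n%:R - 1 by apply: M => //; lra.
    have : 0 <= a * clamp (2 * p - 1) by rewrite mulr_ge0 //; lra.
    have : clamp (8 * p - 2) <= clamp (8 * p).
      by case: (clampP (8 * p - 2)) => -[? ->]; case: (clampP (8 * p)) => -[? ->]; lra.
    by case: ifP => _; lra.
  rewrite (@clamp1 _ (8 * p)) ?(@clamp1 _ (8 * p - 2)) ?(@clamp1 _ (8 * p - 3))
    ?(@clamp1 _ (2 * p - 1)) ?(@clamp1 _ (2 * p)); [|lra..].
  have : b * (clamp (2 * p - 8) - clamp (2 * p - 9)) <= n%:R - 1.
    by apply: M; [rewrite b0|have := c0 (2 * p - 8); have := c0 (2 * p - 9); lra].
  by case: ifP => _; lra.
(* At both ends [axis] is -1/2, so strand [k] ends at height -(k + 1), where strand [k + 1] begins.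
   Strand n - 1 ends at height -n, which is where the detour of strand 0 begins. *)
- move=> k; have hc := cyc_permE k; rewrite /petal_conf /slope /axis /page_y0 /page_y.
  have kn := ltn_ord k.
  congr (_, _); last first.
    rewrite -/c hc; clamps.
    have [e|ne] := eqVneq k.+1 n; rewrite /=.
      have -> : n%:R = k%:R + 1 :> R by rewrite natr1 e.
      by case: eqP => [->|_]; lra.
    rewrite -[k.+1%:R]natr1; case: eqP => [->|_]; lra.
  clamps; case: ifP => _; case: ifP => _; lra.
Qed.
End PetalConf.

Ltac clamp_value :=
  first [apply: clamp0; lra | apply: clamp1; lra | apply: clamp_id; lra].

(** * Comparison of the hooked path with the petal loop *)

Section ClampTables.
Variable R : realType.
Implicit Types p : R.

Lemma clamps_01 p : 0 <= p <= 1 / 4 ->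
  (clamp (4 * p) = 4 * p) * (clamp (4 * p - 1) = 0) * (clamp (2 * p - 1) = 0) *
  (clamp (2 * p - 8) = 0) * (clamp (2 * p - 9) = 0) * (clamp (p - 7) = 0) *
  (clamp (8 * p - 2) = 0) * (clamp (8 * p - 3) = 0) * (clamp (2 * p) = 2 * p) *
  (clamp (p - 2) = 0) * (clamp (p - 6) = 0).
Proof. by move=> hp; do ![split]; clamp_value. Qed.

Lemma clamps_12 p : 1 / 4 <= p <= 1 / 2 ->
  (clamp (4 * p) = 1) * (clamp (4 * p - 1) = 4 * p - 1) * (clamp (2 * p - 1) = 0) *
  (clamp (2 * p - 8) = 0) * (clamp (2 * p - 9) = 0) * (clamp (p - 7) = 0) *
  (clamp (8 * p) = 1) * (clamp (8 * p - 1) = 1) * (clamp (2 * p) = 2 * p) *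
  (clamp (p - 2) = 0) * (clamp (p - 6) = 0).
Proof. by move=> hp; do ![split]; clamp_value. Qed.

Lemma clamps_23 p : 1 / 2 <= p <= 1 ->
  (clamp (4 * p) = 1) * (clamp (4 * p - 1) = 1) * (clamp (2 * p - 1) = 2 * p - 1) *
  (clamp (2 * p - 8) = 0) * (clamp (2 * p - 9) = 0) * (clamp (p - 7) = 0) *
  (clamp (8 * p) = 1) * (clamp (8 * p - 1) = 1) * (clamp (8 * p - 2) = 1) *
  (clamp (8 * p - 3) = 1) * (clamp (2 * p) = 1) * (clamp (p - 2) = 0) *
  (clamp (p - 6) = 0).
Proof. by move=> hp; do ![split]; clamp_value. Qed.

Lemma clamps_34 p : 1 <= p <= 4 ->
  (clamp (4 * p) = 1) * (clamp (4 * p - 1) = 1) * (clamp (2 * p - 1) = 1) *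
  (clamp (2 * p - 8) = 0) * (clamp (2 * p - 9) = 0) * (clamp (p - 7) = 0) *
  (clamp (8 * p) = 1) * (clamp (8 * p - 1) = 1) * (clamp (8 * p - 2) = 1) *
  (clamp (8 * p - 3) = 1) * (clamp (2 * p) = 1) * (clamp (p - 6) = 0).
Proof. by move=> hp; do ![split]; clamp_value. Qed.

Lemma clamps_45 p : 4 <= p <= 9 / 2 ->
  (clamp (4 * p) = 1) * (clamp (4 * p - 1) = 1) * (clamp (2 * p - 1) = 1) *
  (clamp (2 * p - 8) = 2 * p - 8) * (clamp (2 * p - 9) = 0) * (clamp (p - 7) = 0) *
  (clamp (8 * p) = 1) * (clamp (8 * p - 1) = 1) * (clamp (8 * p - 2) = 1) *
  (clamp (8 * p - 3) = 1) * (clamp (2 * p) = 1) * (clamp (p - 2) = 1) *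
  (clamp (p - 6) = 0).
Proof. by move=> hp; do ![split]; clamp_value. Qed.

Lemma clamps_56 p : 9 / 2 <= p <= 5 ->
  (clamp (4 * p) = 1) * (clamp (4 * p - 1) = 1) * (clamp (2 * p - 1) = 1) *
  (clamp (2 * p - 8) = 1) * (clamp (2 * p - 9) = 2 * p - 9) * (clamp (p - 7) = 0) *
  (clamp (8 * p) = 1) * (clamp (8 * p - 1) = 1) * (clamp (8 * p - 2) = 1) *
  (clamp (8 * p - 3) = 1) * (clamp (2 * p) = 1) * (clamp (p - 2) = 1) *
  (clamp (p - 6) = 0).
Proof. by move=> hp; do ![split]; clamp_value. Qed.

Lemma clamps_67 p : 5 <= p <= 8 ->
  (clamp (4 * p) = 1) * (clamp (4 * p - 1) = 1) * (clamp (2 * p - 1) = 1) *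
  (clamp (2 * p - 8) = 1) * (clamp (2 * p - 9) = 1) * (clamp (8 * p) = 1) *
  (clamp (8 * p - 1) = 1) * (clamp (8 * p - 2) = 1) * (clamp (8 * p - 3) = 1) *
  (clamp (2 * p) = 1) * (clamp (p - 2) = 1).
Proof. by move=> hp; do ![split]; clamp_value. Qed.
End ClampTables.

Ltac stair_value :=
  first [apply: clamp0; lra | apply: clamp1; lra | rewrite clamp_id; lra].

Section HookedPetal.
Variables (R : realType) (n : nat) (s1 s2 : 'S_n).
Hypothesis n0 : (0 < n)%N.
Implicit Types (p q t u B : R) (j k : 'I_n).

Notation conf := ('I_n -> R * R)%type.
Let c := cyc_perm n.

(** The times are those of [petal_conf]: [hook] on page 1/4, [std s2] on page 1/2, the stack [up]
    from page 1 to 4, [std s1] on page 9/2, the stack [down] from page 5 to 7, and the end on page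
    8. *)
Definition hooked_param p : R :=
  clamp (4 * p) + clamp (4 * p - 1) + clamp (2 * p - 1) +
  clamp (2 * p - 8) + clamp (2 * p - 9) + clamp (p - 7).

Lemma hooked_paramP : param 6 hooked_param.
Proof.
have c0 u : 0 <= clamp u <= 1 by rewrite clamp_ge0 clamp_le1.
split.
- by change (lip8 hooked_param); rewrite /hooked_param; prove_lip8.
- by rewrite /hooked_param; clamps; lra.
- by rewrite /hooked_param; clamps; lra.
- move=> p _; rewrite /hooked_param.
  have := c0 (4 * p); have := c0 (4 * p - 1); have := c0 (2 * p - 1).
  have := c0 (2 * p - 8); have := c0 (2 * p - 9); have := c0 (p - 7); lra.
Qed.

Lemma clamp_hooked_param p : 0 <= p <= 8 ->
  [/\ clamp (hooked_param p) = clamp (4 * p),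
      clamp (hooked_param p - 1) = clamp (4 * p - 1) &
      clamp (hooked_param p - 1 - 1) = clamp (2 * p - 1)] /\
  [/\ clamp (hooked_param p - 1 - 1 - 1) = clamp (2 * p - 8),
      clamp (hooked_param p - 1 - 1 - 1 - 1) = clamp (2 * p - 9) &
      clamp (hooked_param p - 1 - 1 - 1 - 1 - 1) = clamp (p - 7)].
Proof.
move=> /andP[p0 p8]; rewrite /hooked_param.
have [h1|/ltW h1] := leP p (1 / 4).
  by have V := clamps_01 (introT andP (conj p0 h1)); rewrite !V; split; split; stair_value.
have [h2|/ltW h2] := leP p (1 / 2).
  by have V := clamps_12 (introT andP (conj h1 h2)); rewrite !V; split; split; stair_value.
have [h3|/ltW h3] := leP p 1.
  by have V := clamps_23 (introT andP (conj h2 h3)); rewrite !V; split; split; stair_value.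
have [h4|/ltW h4] := leP p 4.
  by have V := clamps_34 (introT andP (conj h3 h4)); rewrite !V; split; split; stair_value.
have [h5|/ltW h5] := leP p (9 / 2).
  by have V := clamps_45 (introT andP (conj h4 h5)); rewrite !V; split; split; stair_value.
have [h6|/ltW h6] := leP p 5.
  by have V := clamps_56 (introT andP (conj h5 h6)); rewrite !V; split; split; stair_value.
have V := clamps_67 (introT andP (conj h6 p8)); rewrite !V.
by case: (clampP (p - 7)) => -[h7 ->]; split; split; stair_value.
Qed.

Lemma hooked_path_eval p k : 0 <= p <= 8 ->
  plpath (hooked_path R s1 s2) (hooked_param p) k =
  (clamp (4 * p) * (hook R s2 k).1 + clamp (4 * p - 1) * ((s2 k)%:R - (hook R s2 k).1) -
     clamp (2 * p - 1) * (s2 k)%:R + clamp (2 * p - 8) * (s1 k)%:R -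
     clamp (2 * p - 9) * (s1 k)%:R,
   low R k + clamp (4 * p) * ((hook R s2 k).2 - low R k) - clamp (4 * p - 1) * (hook R s2 k).2 +
     clamp (2 * p - 1) * k%:R - clamp (2 * p - 8) * k%:R -
     clamp (2 * p - 9) * k%:R + clamp (p - 7) * (low R (c k) + k%:R)).
Proof.
move=> /clamp_hooked_param[[h1 h2 h3] [h4 h5 h6]].
rewrite /plpath /hooked_path /= h1 h2 h3 h4 h5 h6 /stack /std /up /down /=.
congr (_, _) => /=; rewrite /GRing.scale /=; ring.
Qed.

End HookedPetal.

Section HookedPetalSeparated.
Variables (R : realType) (n : nat) (s1 s2 : 'S_n).
Hypothesis n0 : (0 < n)%N.
Implicit Types (p q t u B : R) (j k : 'I_n).

Notation conf := ('I_n -> R * R)%type.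
Let c := cyc_perm n.

Lemma axis_01 p : 0 <= p <= 1 -> axis n p = p - 1 / 2.
Proof.
move=> /andP[p0 p1]; rewrite /axis /page_y0 /page_y.
rewrite (clamp_id (u := p)) ?p0 // !clamp0; lra.
Qed.

Lemma axis_45 p : 4 <= p <= 5 -> axis n p = 9 / 2 - p.
Proof.
move=> /andP[p4 p5]; rewrite /axis /page_y0 /page_y.
rewrite (clamp_id (u := p - 4)) ?(clamp0 (u := p - 5)) ?(clamp0 (u := p - 7)) ?clamp1; lra.
Qed.

Lemma lexpos_pair_zx e f (a b : conf) j k :
  0 < f * ((a j).2 - (a k).2) \/ ((a j).2 - (a k).2 = 0 /\ 0 < e * ((a j).1 - (a k).1)) ->
  0 < f * ((b j).2 - (b k).2) \/ ((b j).2 - (b k).2 = 0 /\ 0 < e * ((b j).1 - (b k).1)) ->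
  exists o, lexpos_all o j k [:: a; b].
Proof. by exists ((0, f), (e, 0)); split; [|split=> //]; exact: lexpos_zx. Qed.

Lemma lexpos_pair_xz e f (a b : conf) j k :
  0 < e * ((a j).1 - (a k).1) \/ ((a j).1 - (a k).1 = 0 /\ 0 < f * ((a j).2 - (a k).2)) ->
  0 < e * ((b j).1 - (b k).1) \/ ((b j).1 - (b k).1 = 0 /\ 0 < f * ((b j).2 - (b k).2)) ->
  exists o, lexpos_all o j k [:: a; b].
Proof. by exists ((e, 0), (0, f)); split; [|split=> //]; exact: lexpos_xz. Qed.

(** Both configurations are separated by one order. Heights come first, and positions decide on
    pages 1/2 and 9/2, where all heights vanish; only before page 1/4 strand 0 is told apart by its
    position. *)
Lemma separated_hooked_petal p : 0 <= p <= 8 ->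
  separated [:: plpath (hooked_path R s1 s2) (hooked_param p); petal_conf s1 s2 p].
Proof.
move=> hp j k jk.
have k0 : (k == 0%N :> nat) = false by case: (k : nat) jk.
have jk' : (j%:R : R) < k%:R by rewrite ltr_nat.
have kp : 0 < k%:R :> R by rewrite ltr0n; exact: leq_ltn_trans jk.
have jp : 0 <= j%:R :> R by [].
have kn : (k%:R : R) < n%:R by rewrite ltr_nat.
have n1 : 1 <= n%:R :> R by rewrite ler1n.
have sp (s : 'S_n) i : 0 <= (s i)%:R :> R by [].
have sgx (s : 'S_n) : exists e, 0 < e * ((s j)%:R - (s k)%:R) :> R.
  have : s j != s k by rewrite (inj_eq perm_inj) -val_eqE ltn_eqF.
  rewrite -val_eqE neq_ltn => /orP[] lt.
    by exists (- 1); rewrite mulN1r opprB subr_gt0 ltr_nat.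
  by exists 1; rewrite mul1r subr_gt0 ltr_nat.
have lowc := low_cyc_lt R n0 jk.
have [e2 he2] := sgx s2; have [e1 he1] := sgx s1.
have /andP[p0 p8] := hp.
have P (x y : R) : 0 <= x -> 0 <= y -> 0 <= x * y by exact: mulr_ge0.
have Q (x y : R) : 0 < x -> 0 < y -> 0 < x * y by exact: mulr_gt0.
have kj : 0 < k%:R - j%:R :> R by rewrite subr_gt0.
(* Supplies the signs of products to linear arithmetic, apart from the page [a] where the heights
   tie. *)
have ties (a : R) : p = a \/ 0 < `|p - a| * (k%:R - j%:R) /\ 0 < `|p - a| * k%:R.
  have [->|ne] := eqVneq p a; [by left|right].
  by split; apply: Q; rewrite // normr_gt0 subr_eq0.
have [q1|/ltW q1] := leP p (1 / 4).
  have V := clamps_01 (introT andP (conj p0 q1)).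
  have A : axis n p = p - 1 / 2 by apply: axis_01; lra.
  have [j0|jn0] := eqVneq (j : nat) 0%N.
    (* Strand 0 is to the left of the others, except on page 0, where it is at the bottom of the
       stack. *)
    have j0' : j%:R = 0 :> R by rewrite j0.
    have m1 := P p _ p0 (sp s2 k); have m2 := P p _ p0 (sp s2 j).
    apply: (@lexpos_pair_xz (- 1) (- 1));
      rewrite ?hooked_path_eval // /petal_conf /slope /hook /low ?A ?V k0 j0 /=.
      have [e|pn] := eqVneq p 0; [right|left]; first by rewrite e; clear -kn; split; lra.
      have pp : 0 < p by rewrite lt_def pn.
      by clear -pp m1; lra.
    have [e|pn] := eqVneq p 0; [right|left]; first by rewrite e; clamps; clear -kn; split; lra.
    have pp : 0 < p by rewrite lt_def pn.
    by clear -pp m1; case: (clampP (8 * p)) => -[? ->]; lra.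
  have m1 : 0 < (1 - 2 * p) * (k%:R - j%:R) by apply: Q => //; lra.
  apply: (@lexpos_pair_zx 1 1); left;
    rewrite ?hooked_path_eval // /petal_conf /slope /hook /low ?A ?V k0 (negbTE jn0) /=;
    clear -m1 kj; lra.
have [q2|/ltW q2] := leP p (1 / 2).
  have V := clamps_12 (introT andP (conj q1 q2)).
  have A : axis n p = p - 1 / 2 by apply: axis_01; lra.
  have := ties (1 / 2); rewrite ler0_norm; last by lra.
  move=> T; have [j0|jn0] := eqVneq (j : nat) 0%N.
    have j0' : j%:R = 0 :> R by rewrite j0.
    have m3 : 0 <= (1 - 2 * p) * n%:R by apply: P => //; lra.
    apply: (@lexpos_pair_zx e2 1);
      rewrite ?hooked_path_eval // /petal_conf /slope /hook /low ?A ?V k0 j0 /=.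
      by case: T => [e|[_ m]]; [right; rewrite e; clear -he2; split; lra|left; clear -m m3; lra].
    case: T => [e|[_ m]]; [right; rewrite e; clamps; clear -he2; split; lra|left].
    have : 0 <= n%:R * (1 - clamp (8 * p - 2)) by apply: P => //; have := clamp_le1 (8 * p - 2); lra.
    by clear -m; lra.
  apply: (@lexpos_pair_zx e2 1);
    rewrite ?hooked_path_eval // /petal_conf /slope /hook /low ?A ?V k0 (negbTE jn0) /=;
    by case: T => [e|[m _]]; [right; rewrite e; clear -he2; split; lra|left; clear -m; lra].
have [q3|/ltW q3] := leP p 1.
  have V := clamps_23 (introT andP (conj q2 q3)).
  have A : axis n p = p - 1 / 2 by apply: axis_01; lra.
  have := ties (1 / 2); rewrite ger0_norm; last by lra.
  move=> T; apply: (@lexpos_pair_zx e2 (- 1));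
    rewrite ?hooked_path_eval // /petal_conf /slope ?A ?V ?k0 /=;
    by case: T => [e|[m _]]; [right; rewrite e; clear -he2; split; try case: ifP => _; lra
                             |left; clear -m; try case: ifP => _; lra].
have [q4|/ltW q4] := leP p 4.
  have V := clamps_34 (introT andP (conj q3 q4)).
  have m1 : 0 < (k%:R - j%:R) * axis n p.
    apply: Q => //; rewrite /axis.
    have [y0 y1] : page_y0 p = 1 /\ 0 <= page_y p by clear -hp q3 q4; case: (pageP hp) => ?; split; lra.
    have := P _ _ (ler0n R n) y1; lra.
  apply: (@lexpos_pair_zx 1 (- 1)); left;
    rewrite ?hooked_path_eval // /petal_conf /slope ?V ?k0 /=;
    clear -m1 kj; try case: ifP => _; lra.
have [q5|/ltW q5] := leP p (9 / 2).
  have V := clamps_45 (introT andP (conj q4 q5)).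
  have A : axis n p = 9 / 2 - p by apply: axis_45; lra.
  have := ties (9 / 2); rewrite ler0_norm; last by lra.
  move=> T; apply: (@lexpos_pair_zx e1 (- 1));
    rewrite ?hooked_path_eval // /petal_conf /slope ?A ?V ?k0 /=;
    by case: T => [e|[m _]]; [right; rewrite e; clear -he1; split; try case: ifP => _; lra
                             |left; clear -m; try case: ifP => _; lra].
have [q6|/ltW q6] := leP p 5.
  have V := clamps_56 (introT andP (conj q5 q6)).
  have A : axis n p = 9 / 2 - p by apply: axis_45; lra.
  have := ties (9 / 2); rewrite ger0_norm; last by lra.
  move=> T; apply: (@lexpos_pair_zx e1 1);
    rewrite ?hooked_path_eval // /petal_conf /slope ?A ?V ?k0 /=;
    by case: T => [e|[m _]]; [right; rewrite e; clear -he1; split; try case: ifP => _; lra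
                             |left; clear -m; try case: ifP => _; lra].
have V := clamps_67 (introT andP (conj q6 p8)).
have m1 : 0 < (k%:R - j%:R) * - axis n p.
  apply: Q => //; rewrite /axis.
  have [y0 y1] : page_y0 p = 0 /\ 0 <= - page_y p by clear -hp q6; case: (pageP hp) => ?; split; lra.
  have := P _ _ (ler0n R n) y1; lra.
apply: (@lexpos_pair_zx 1 1); left; rewrite ?hooked_path_eval // /petal_conf /slope ?V ?k0 /=.
  (* From page 7 on the heights pass from [down] to [low \o c]; both decrease with the index of the
     strand. *)
  have h : 0 < (1 - clamp (p - 7)) * (k%:R - j%:R) + clamp (p - 7) * (low R (c j) - low R (c k)).
    have h1 : 0 < low R (c j) - low R (c k) by rewrite subr_gt0.
    have [e|ne] := eqVneq (clamp (p - 7)) 0; first by rewrite e; clear -kj; lra.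
    apply: ltr_wpDl; last by rewrite Q // lt_def ne clamp_ge0.
    by apply: P; [rewrite subr_ge0 clamp_le1|exact: ltW].
  by clear -h; move: (clamp (p - 7)) h => r h; lra.
by clear -m1 kj; case: ifP => _; lra.
Qed.

Lemma hooked_petal_isotopy : good c (hooked_path R s1 s2) ->
  ambient_isotopic (path_closure (hooked_path R s1 s2)) (loop_set (petal_conf s1 s2)).
Proof.
move=> g.
have h := reparam g (std_paramP R 6) (hooked_paramP R).
apply: ambient_isotopic_trans h _.
have [B _ L] := good_loop g (hooked_paramP R).
have [B' L'] := petal_conf_loop R s1 s2.
by apply: (loop_isotopy_lex' (L B (lexx _)) L'); exact: separated_hooked_petal.
Qed.
End HookedPetalSeparated.

(** * Projection along the x-axis *)

Section Folding.
Variable R : realType.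
Implicit Types (x y v : space R) (K : set (space R)).

Lemma lip_map_isotopy K (D : space R -> space R) C :
  (forall t x y, 0 <= t <= 1 ->
     `|D x - D y| <= C * `|(x + t *: D x) - (y + t *: D y)|) ->
  ambient_isotopic K [set x + D x | x in K].
Proof.
move=> h; pose A (a : {x | K x}) := sval a.
have := @lip_isotopy R _ A (fun a => D (A a)) C (fun t a b => h t (A a) (A b)).
congr ambient_isotopic; rewrite predeqE => x; split.
- by move=> [[y Ky] _ <-].
- by move=> Kx; exists (exist _ x Kx).
- by move=> [[y Ky] _ <-]; exists y.
- by move=> [y Ky <-]; exists (exist _ y Ky).
Qed.

Definition shear (h : R * R -> R) x : space R :=
  pt x.1.1 (x.1.2 + h (x.1.1, x.2)) x.2.

Lemma shear_isotopy K h C : (forall a b, `|h a - h b| <= C * `|a - b|) ->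
  ambient_isotopic K [set shear h x | x in K].
Proof.
move=> hh; pose D x := pt 0 (h (x.1.1, x.2)) 0 : space R.
have -> : [set shear h x | x in K] = [set x + D x | x in K].
  congr (image K); apply/funext => -[[a b] c].
  by rewrite -[RHS]/(pt (a + 0) (b + h (a, c)) (c + 0)) !addr0.
have C0 : 0 <= C.
  have := hh (1, 0) (0, 0); rewrite [`|(1, 0) - _|]prod_normE /= !subr0 normr1 normr0.
  by rewrite max_l // mulr1; apply: le_trans.
apply: (@lip_map_isotopy _ _ C) => t [[a b] c] [[a' b'] c'] _.
rewrite /D norm3_le /= !subrr normr0 mulr_ge0 //= andbT.
apply: le_trans (hh _ _) _; rewrite ler_wpM2l //.
set w := (_ + t *: _) - _; have : `|w| <= `|w| by [].
rewrite {1}norm3_le /w /= !scaler0 !addr0 => /and3P[h1 _ h3].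
by rewrite norm2_le /= h1.
Qed.

(** Diagrams are projected along the last coordinate. The cyclic permutation is a rotation, whereas
    exchanging two coordinates would give the mirror image. *)
Definition rotate x : space R := pt x.1.2 x.2 x.1.1.

(* The linear maps (1 - t) + t * rotate are invertible, of determinant
   (1 - t)^3 + t^3 >= 1/4. *)
Lemma rotate_isotopy K : ambient_isotopic K [set rotate x | x in K].
Proof.
pose D x := rotate x - x.
have -> : [set rotate x | x in K] = [set x + D x | x in K].
  by congr (image K); apply/funext => x; rewrite /D addrC subrK.
apply: (@lip_map_isotopy _ _ 24) => t [[a b] c] [[a' b'] c'] /andP[t0 t1].
set w := (_ + t *: _) - _; set m := `|w|; have hw : `|w| <= m by [].
have m0 : 0 <= m by exact: normr_ge0.
have t' : 0 <= 1 - t by rewrite subr_ge0.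
rewrite norm3_le /w /D /rotate /pt /= /GRing.scale /= in hw.
move/and3P: hw => []; rewrite norm3_le /=.
pose u := a - a'; pose v := b - b'; pose z := c - c'.
have -> : a + t * (b - a) - (a' + t * (b' - a')) = (1 - t) * u + t * v by rewrite /u /v; ring.
have -> : b + t * (c - b) - (b' + t * (c' - b')) = (1 - t) * v + t * z by rewrite /z /v; ring.
have -> : c + t * (a - c) - (c' + t * (a' - c')) = (1 - t) * z + t * u by rewrite /z /u; ring.
have -> : b - a - (b' - a') = v - u by rewrite /v /u; ring.
have -> : c - b - (c' - b') = z - v by rewrite /v /z; ring.
have -> : a - c - (a' - c') = u - z by rewrite /u /z; ring.
have inv (p q r : R) : `|(1 - t) * p + t * q| <= m -> `|(1 - t) * q + t * r| <= m ->
    `|(1 - t) * r + t * p| <= m -> `|p| <= 12 * m.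
  move=> hp hq hr; set d := (1 - t) ^+ 3 + t ^+ 3.
  have d4 : 1 / 4 <= d.
    have -> : d = 1 / 4 + 3 * (t - 1 / 2) ^+ 2 by rewrite /d; field.
    by rewrite lerDl mulr_ge0 // sqr_ge0.
  (* A row of the adjugate of the circulant matrix; its entries have absolute value at most 1, so
     the inverse has constant 3 / (1/4) = 12. *)
  have e : d * p = (1 - t) ^+ 2 * ((1 - t) * p + t * q) - (1 - t) * t * ((1 - t) * q + t * r)
     + t ^+ 2 * ((1 - t) * r + t * p) by rewrite /d; ring.
  have c1 (k f : R) : 0 <= k <= 1 -> `|f| <= m -> `|k * f| <= m.
    move=> /andP[k0 k1] xm; rewrite normrM ger0_norm //; apply: le_trans xm.
    by rewrite ler_piMl.
  have : `|d * p| <= m + m + m.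
    rewrite e; apply: le_trans (ler_normD _ _) _; apply: lerD; last first.
      by apply: c1 => //; rewrite exprn_ge0 // exprn_ile1.
    apply: le_trans (ler_normB _ _) _; apply: lerD; apply: c1 => //.
      by rewrite exprn_ge0 // exprn_ile1 //; lra.
    by rewrite mulr_ge0 //= mulr_ile1 //; lra.
  rewrite normrM ger0_norm; last by lra.
  have : 1 / 4 * `|p| <= d * `|p| by rewrite ler_wpM2r.
  by lra.
move=> h1 h2 h3; have u1 := inv _ _ _ h1 h2 h3; have v1 := inv _ _ _ h2 h3 h1.
have z1 := inv _ _ _ h3 h1 h2.
have B (p q : R) : `|p| <= 12 * m -> `|q| <= 12 * m -> `|p - q| <= 24 * m.
  by move=> hp hq; apply: le_trans (ler_normB _ _) _; lra.
by rewrite !B.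
Qed.
End Folding.

(** * Points of the petal loop and their projections *)

Section PetalPoints.
Variables (R : realType) (n : nat) (s1 s2 : 'S_n).
Hypothesis n0 : (0 < n)%N.
Implicit Types (p q t u x z : R) (k : 'I_n).

Let n1 : 1 <= n%:R :> R. Proof. by rewrite ler1n. Qed.

(* The displacement in the y-direction that makes strand 0 cross the axis once more,
   on page 3/16. *)
Definition detour (a : R * R) : R :=
  5 / 8 * Num.max 0 (Num.min (- a.1) ((n%:R - a.2) / (2 * n%:R) - 1 - a.1)).

Definition petal_pt k p : space R :=
  rotate (shear detour (page_pt n p (petal_conf s1 s2 p k))).

Lemma detour_lip a b : `|detour a - detour b| <= 2 * `|a - b|.
Proof.
have n1' := n1; set m := `|a - b|; have hm : `|a - b| <= m by [].
rewrite norm2_le /= in hm; case/andP: hm => h1 h2; clearbody m.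
have lmin (x y x' y' : R) : `|x - x'| <= 2 * m -> `|y - y'| <= 2 * m ->
    `|Num.min x y - Num.min x' y'| <= 2 * m.
  by rewrite !ler_norml; case: (leP x y); case: (leP x' y'); lra.
have lmax (x x' : R) : `|x - x'| <= 2 * m ->
    `|Num.max 0 x - Num.max 0 x'| <= 2 * m.
  by rewrite !ler_norml; case: (leP 0 x); case: (leP 0 x'); lra.
rewrite /detour -mulrBr normrM (@ger0_norm _ (5 / 8)); last by lra.
suff : `|Num.max 0 (Num.min (- a.1) ((n%:R - a.2) / (2 * n%:R) - 1 - a.1)) -
         Num.max 0 (Num.min (- b.1) ((n%:R - b.2) / (2 * n%:R) - 1 - b.1))| <= 2 * m.
  have := normr_ge0 (Num.max 0 (Num.min (- a.1) ((n%:R - a.2) / (2 * n%:R) - 1 - a.1)) -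
         Num.max 0 (Num.min (- b.1) ((n%:R - b.2) / (2 * n%:R) - 1 - b.1))).
  by lra.
apply: lmax; apply: lmin; first by move: h1; rewrite !ler_norml; lra.
have -> : (n%:R - a.2) / (2 * n%:R) - 1 - a.1 - ((n%:R - b.2) / (2 * n%:R) - 1 - b.1) =
   - ((a.2 - b.2) / (2 * n%:R)) - (a.1 - b.1) by field; rewrite pnatr_eq0 -lt0n n0.
apply: le_trans (ler_normB _ _) _; rewrite normrN normrM.
have : `|a.2 - b.2| * `|(2 * n%:R)^-1| <= m * 1.
  apply: ler_pM => //; rewrite normfV ger0_norm ?mulr_ge0 //.
  by rewrite invf_le1; lra.
by lra.
Qed.

Lemma petal_set_isotopy :
  ambient_isotopic (loop_set (petal_conf s1 s2))
    [set petal_pt kp.1 kp.2 | kp in [set kp : 'I_n * R | 0 <= kp.2 <= 8]].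
Proof.
apply: ambient_isotopic_trans (shear_isotopy _ detour_lip) _.
have := rotate_isotopy [set shear detour x | x in loop_set (petal_conf s1 s2)].
congr ambient_isotopic; rewrite predeqE => x; split.
  by move=> [_ [_ [kp h <-] <-] <-]; exists kp.
by move=> [kp h <-]; do ![eexists]; [exact: h|..].
Qed.

Lemma clamp_le u v : u <= v -> clamp u <= clamp v.
Proof.
by move=> uv; case: (clampP u) => -[? ->]; case: (clampP v) => -[? ->]; lra.
Qed.

Definition regular k p : Prop := (k : nat) <> 0%N \/ 1 / 2 <= p.

Lemma petal_x_regular k p : regular k p -> 0 <= p <= 8 ->
  (petal_conf s1 s2 p k).1 =
  (s2 k)%:R * (clamp (2 * p) - clamp (2 * p - 1)) +
  (s1 k)%:R * (clamp (2 * p - 8) - clamp (2 * p - 9)).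
Proof.
move=> r /andP[p0 p8]; rewrite /petal_conf /=; case: eqP => [e|_]; last by ring.
case: r => // hp; rewrite (@clamp1 _ (8 * p)) ?(@clamp1 _ (8 * p - 2)) ?(@clamp1 _ (8 * p - 3))
  ?(@clamp1 _ (2 * p)); [ring|lra..].
Qed.

(** Strands leave position 0 only on pages parallel to the x-axis. In the projection along this axis
    the positions, and with them [s1] and [s2], disappear; they survive in the heights. *)
Lemma petal_x_page_y k p : 0 <= p <= 8 -> (petal_conf s1 s2 p k).1 * page_y p = 0.
Proof.
move=> hp; have /andP[p0 p8] := hp.
case: (pageP hp) => h; rewrite ?mulr0 //; rewrite (_ : (_).1 = 0) ?mul0r //;
  (rewrite petal_x_regular //; last by right; lra);
  by clamps; ring.
Qed.

Lemma petal_pt_proj k p : 0 <= p <= 8 -> (petal_pt k p).1 =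
  (1 / 2 + axis n p + detour ((n%:R + (n%:R - (petal_conf s1 s2 p k).1) * page_x p),
                              (petal_conf s1 s2 p k).2),
   (petal_conf s1 s2 p k).2).
Proof.
move=> hp; have := petal_x_page_y k hp; rewrite /petal_pt.
move: (petal_conf s1 s2 p k) => [x z] /= e; congr (_ + _, _).
by rewrite mulrBl e /axis; lra.
Qed.

Lemma petal_pt_height k p :
  (petal_pt k p).2 = n%:R + (n%:R - (petal_conf s1 s2 p k).1) * page_x p.
Proof. by []. Qed.

Lemma petal_pt_regular k p : regular k p -> 0 <= p <= 8 ->
  (petal_pt k p).1 = (1 / 2 + axis n p, slope k p * axis n p).
Proof.
move=> r hp; rewrite petal_pt_proj //; have /andP[p0 p8] := hp.
have -> : (petal_conf s1 s2 p k).2 = slope k p * axis n p.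
  rewrite /petal_conf /=; case: eqP => [e|_]; last by rewrite add0r.
  by case: r => // h; rewrite (@clamp1 _ (8 * p - 1)) ?(@clamp1 _ (8 * p - 2)); lra.
congr (_, _); rewrite -[RHS]addr0; congr (_ + _).
have [px _ _] := page_norm hp.
have x0 : 0 <= (petal_conf s1 s2 p k).1.
  rewrite petal_x_regular // addr_ge0 // mulr_ge0 // subr_ge0 clamp_le //; lra.
have xn : (petal_conf s1 s2 p k).1 <= n%:R.
  have [B [_ _ h _]] := petal_conf_loop R s1 s2.
  by have := h p k hp; lra.
move: px x0 xn; case: (petal_conf s1 s2 p k) => x z /=.
rewrite ler_norml => /andP[px1 px2] x0 xn.
have X0 : 0 <= n%:R + (n%:R - x) * page_x p.
  have : 0 <= (n%:R - x) * (page_x p + 1) by apply: mulr_ge0; lra.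
  by lra.
by rewrite /detour /= max_l ?mulr0 // ge_min oppr_le0 X0.
Qed.

(* The projection of the detour of strand 0, in units of [n] for the z-coordinate. *)
Variant detour_spec p : R -> R -> Prop :=
| Detour0 of 0 <= p <= 1 / 8 : detour_spec p (6 * p - 1 / 2) (- 1)
| Detour1 of 1 / 8 <= p <= 1 / 4 : detour_spec p (3 / 4 - 4 * p) (16 * p - 3)
| Detour2 of 1 / 4 <= p <= 3 / 8 : detour_spec p (p - 1 / 2) (3 - 8 * p)
| Detour3 of 3 / 8 <= p <= 1 / 2 : detour_spec p (p - 1 / 2) 0.

(** On page 1/8, at x = -1 and z = -n, the shift by 5/8 takes y from -3/8 to 1/4, across the axis.
    It fades as z rises to n on page 1/4, so y and z vanish together on page 3/16, where the
    projection has slope -4 n. *)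
Lemma petal_pt_detour k p : k = 0%N :> nat -> 0 <= p <= 1 / 2 ->
  exists y z, (petal_pt k p).1 = (1 / 2 + y, n%:R * z) /\ detour_spec p y z.
Proof.
move=> k0 /andP[p0 p1]; have hp : 0 <= p <= 8 by lra.
have nn : n%:R != 0 :> R by rewrite pnatr_eq0 -lt0n.
rewrite petal_pt_proj //.
have -> : page_x p = - 1 by rewrite /page_x; clamps; lra.
have -> : axis n p = p - 1 / 2 by apply: axis_01; lra.
have sl : slope k p = 0 by rewrite /slope k0; clamps; lra.
rewrite /petal_conf /= k0 sl eqxx mul0r addr0 /detour /=.
rewrite (@clamp0 _ (2 * p - 1)) ?(@clamp0 _ (2 * p - 8)) ?(@clamp0 _ (2 * p - 9)); [|lra..].
have D u : (n%:R - n%:R * u) / (2 * n%:R) = (1 - u) / 2 by field.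
rewrite D; have s0 : 0 <= (s2 k)%:R :> R by [].
have [h|/ltW h] := leP p (1 / 8).
  exists (6 * p - 1 / 2), (- 1); split; last by constructor; lra.
  clamps; congr (_, _); last by lra.
  by rewrite min_l ?max_r; lra.
have [h'|/ltW h'] := leP p (1 / 4).
  exists (3 / 4 - 4 * p), (16 * p - 3); split; last by constructor; lra.
  clamps; congr (_, _); last by lra.
  by rewrite min_r ?max_r; lra.
have [h2|/ltW h2] := leP p (3 / 8).
  exists (p - 1 / 2), (3 - 8 * p); split; last by constructor; lra.
  clamps; congr (_, _); last by lra.
  by rewrite max_l ?ge_min; [lra|apply/orP; right; lra].
exists (p - 1 / 2), 0; split; last by constructor; lra.
clamps; congr (_, _); last by lra.
have : 0 <= (s2 k)%:R * (8 * p - 3) by rewrite mulr_ge0 //; lra.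
by move=> ?; rewrite max_l ?ge_min; [lra|apply/orP; left; lra].
Qed.

Lemma petal_height_detour k : k = 0%N :> nat -> (petal_pt k (3 / 16)).2 = - 1.
Proof.
move=> k0; rewrite petal_pt_height /petal_conf /= k0 eqxx /page_x; clamps; lra.
Qed.

Lemma petal_height_top k : (petal_pt k (1 / 2)).2 = (s2 k)%:R.
Proof.
rewrite petal_pt_height petal_x_regular; [|by right; lra|by lra].
by rewrite /page_x; clamps; lra.
Qed.

Lemma petal_height_bottom k : (petal_pt k (9 / 2)).2 = 2 * n%:R - (s1 k)%:R.
Proof.
rewrite petal_pt_height petal_x_regular; [|by right; lra|by lra].
by rewrite /page_x; clamps; lra.
Qed.
End PetalPoints.

(** * Injectivity of the projection off the multi-crossing *)

Section PetalProjection.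
Variables (R : realType) (n : nat) (s1 s2 : 'S_n).
Hypothesis n0 : (0 < n)%N.
Implicit Types (p q t u x y z : R) (k l : 'I_n).

Notation petal := (petal_pt s1 s2).

Lemma axis_ge0 p : 1 / 2 <= p <= 9 / 2 -> 0 <= axis n p.
Proof.
move=> h; have hp : 0 <= p <= 8 by lra.
have nn := ler0n R n.
rewrite /axis; case: (pageP hp) => h'; try (by clear -h h' nn; lra).
- have : 0 <= n%:R * (p - 1) :> R by apply: mulr_ge0 => //; lra.
  by lra.
- have : 0 <= n%:R * (4 - p) :> R by apply: mulr_ge0 => //; lra.
  by lra.
Qed.

Lemma axis_le0 p : 0 <= p <= 1 / 2 \/ 9 / 2 <= p <= 8 -> axis n p <= 0.
Proof.
move=> h; have hp : 0 <= p <= 8 by case: h; lra.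
have nn := ler0n R n.
rewrite /axis; case: (pageP hp) => h'; case: h => h; try (by clear -h h' nn; lra).
- have : 0 <= n%:R * (p - 5) :> R by apply: mulr_ge0 => //; lra.
  by clear -h'; lra.
- have : 0 <= n%:R * (8 - p) :> R by apply: mulr_ge0 => //; lra.
  by clear -h'; lra.
Qed.

Lemma axis_monotone p q : p < q ->
  [/\ 0 <= p -> q <= 2 -> axis n p < axis n q,
      3 <= p -> q <= 6 -> axis n q < axis n p &
      7 <= p -> q <= 8 -> axis n p < axis n q].
Proof.
move=> pq; have M a b : 0 <= a -> 0 <= b -> 0 < a + b -> 0 < a + n%:R * b :> R.
  move=> a0 b0 ab; have : 0 <= (n%:R - 1) * b by rewrite mulr_ge0 // subr_ge0 ler1n.
  by clear -ab; lra.
have E x y : axis n y - axis n x =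
    page_y0 y - page_y0 x + n%:R * (page_y y - page_y x) by rewrite /axis; ring.
split=> h h'; rewrite -subr_gt0 E.
- have T x : 0 <= x -> x <= 2 -> [/\ page_y0 x = clamp x, page_y x = clamp (x - 1) &
      clamp x + clamp (x - 1) = x].
    clear -R => x0 x2; rewrite /page_y0 /page_y (@clamp0 _ (x - 4)) ?(@clamp0 _ (x - 3))
      ?(@clamp0 _ (x - 5)) ?(@clamp0 _ (x - 7)); [|lra..].
    by split; rewrite ?addr0 ?subr0 //; case: (clampP x) => -[? ->]; case: (clampP (x - 1)) => -[? ->]; lra.
  have [|-> -> e] := T p h; first lra; have [||-> -> e'] := T q; [lra..|].
  have := @clamp_le R p q (ltW pq); have := @clamp_le R (p - 1) (q - 1); rewrite lerD2r => /(_ (ltW pq)).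
  by clear E T => *; apply: M; lra.
- have T x : 3 <= x -> x <= 6 -> [/\ page_y0 x = 1 - clamp (x - 4),
      page_y x = 1 - clamp (x - 3) - clamp (x - 5) &
      clamp (x - 3) + clamp (x - 4) + clamp (x - 5) = x - 3].
    clear -R => x0 x2; rewrite /page_y0 /page_y (@clamp1 _ x) ?(@clamp1 _ (x - 1)) ?(@clamp0 _ (x - 7));
      [|lra..].
    split; rewrite ?addr0 //; case: (clampP (x - 3)) => -[? ->];
      case: (clampP (x - 4)) => -[? ->]; case: (clampP (x - 5)) => -[? ->]; lra.
  have [|-> -> e] := T p h; first lra; have [||-> -> e'] := T q; [lra..|].
  have := @clamp_le R (p - 3) (q - 3); rewrite lerD2r => /(_ (ltW pq)).
  have := @clamp_le R (p - 4) (q - 4); rewrite lerD2r => /(_ (ltW pq)).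
  have := @clamp_le R (p - 5) (q - 5); rewrite lerD2r => /(_ (ltW pq)).
  by clear E T => *; apply: M; lra.
- have T x : 7 <= x -> x <= 8 -> page_y0 x = 0 /\ page_y x = x - 8.
    by clear -R => x0 x2; rewrite /page_y0 /page_y; split; clamps; lra.
  have [|-> ->] := T p h; first lra; have [||-> ->] := T q; [lra..|].
  by clear E T; apply: M; lra.
Qed.

Lemma axis_at0 : axis n 0 = - (1 / 2) :> R.
Proof. by rewrite axis_01; lra. Qed.

Lemma axis_at8 : axis n 8 = - (1 / 2) :> R.
Proof. by rewrite /axis /page_y0 /page_y; clamps; lra. Qed.

Lemma axis_eq0 p : 0 <= p <= 8 -> axis n p = 0 -> p = 1 / 2 \/ p = 9 / 2.
Proof.
move=> hp; have nn : 1 <= n%:R :> R by rewrite ler1n.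
rewrite /axis; case: (pageP hp) => h e.
- by left; lra.
- have : 0 <= n%:R * (p - 1) :> R by apply: mulr_ge0 => //; lra.
  by lra.
- by lra.
- have : 0 <= n%:R * (4 - p) :> R by apply: mulr_ge0 => //; lra.
  by lra.
- by right; lra.
- have : 0 <= n%:R * (p - 5) :> R by apply: mulr_ge0 => //; lra.
  by lra.
- by lra.
- have : 0 <= n%:R * (8 - p) :> R by apply: mulr_ge0 => //; lra.
  by lra.
Qed.

(** [axis] is constant on pages 2 to 3 and 6 to 7, exactly where the slope moves; on the intervals
    on which the slope rests, [axis] is strictly monotone. *)
Lemma axis_inj p q : 0 <= p <= 8 -> 0 <= q <= 8 ->
  clamp (p - 2) + clamp (p - 6) = clamp (q - 2) + clamp (q - 6) ->
  axis n p = axis n q -> p = q.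
Proof.
wlog pq : p q / p < q => [hw hp hq e a|hp hq].
  by have [pq|qp|//] := ltgtP p q; [exact: hw|apply/esym; exact: hw].
have [h1 h2 h3] := axis_monotone pq => e a.
have [q2|q2] := leP q 2; first by have := h1 _ q2; rewrite a ltxx; lra.
have [p7|p7] := leP 7 p; first by have := h3 p7; rewrite a ltxx; lra.
have [p3|p3] := leP 3 p; last first.
  move: e; rewrite (@clamp0 _ (p - 6)); last by lra.
  have := clamp_ge0 (q - 6).
  by case: (clampP (p - 2)) => -[? ->]; case: (clampP (q - 2)) => -[? ->]; lra.
have [q6|q6] := leP q 6; first by have := h2 p3 q6; rewrite a ltxx; lra.
move: e; rewrite (@clamp1 _ (p - 2)) ?(@clamp1 _ (q - 2)); [|lra..].
by case: (clampP (p - 6)) => -[? ->]; case: (clampP (q - 6)) => -[? ->]; lra.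
Qed.

Lemma slope_bounds k p : 2 * k%:R <= slope k p <= 2 * k%:R + 2.
Proof.
rewrite /slope; have := clamp_ge0 (p - 2); have := clamp_ge0 (p - 6).
by have := clamp_le1 (p - 2); have := clamp_le1 (p - 6); lra.
Qed.

Lemma slope_lt k l p q : (k < l)%N -> slope k p = slope l q -> 7 <= p /\ q <= 2.
Proof.
move=> kl; have : k%:R + 1 <= l%:R :> R by rewrite natr1 ler_nat.
rewrite /slope; have := clamp_ge0 (q - 2); have := clamp_ge0 (q - 6).
have := clamp_le1 (p - 2); have := clamp_le1 (p - 6) => a b c d kl' e.
have : clamp (p - 6) = 1 by lra.
have : clamp (q - 2) = 0 by lra.
clear; case: (clampP (p - 6)) => -[? ->]; case: (clampP (q - 2)) => -[? ->] *; split; lra.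
Qed.

(** Different strands share a slope only between the end of one, where [axis] is below -1/2 before
    the closing page, and the beginning of another, where it is at least -1/2. *)
Lemma regular_inj k l p q : 0 <= p < 8 -> 0 <= q < 8 ->
  axis n p != 0 -> axis n p = axis n q ->
  slope k p * axis n p = slope l q * axis n q -> (k, p) = (l, q).
Proof.
move=> hp hq a0 a; rewrite -a => /(mulIf a0) e.
have no (k' l' : 'I_n) p' q' : 0 <= p' < 8 -> 0 <= q' < 8 -> axis n p' = axis n q' ->
    slope k' p' = slope l' q' -> (k' < l')%N -> False.
  move=> hp' hq' ea es kl; have [p7 q2] := slope_lt kl es.
  have [_ _ h] := @axis_monotone p' 8 (ltac:(lra)).
  have := h p7 (lexx _); rewrite axis_at8 ea.
  have [->|qn] := eqVneq q' 0; first by rewrite axis_at0 ltxx.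
  have [h' _ _] := @axis_monotone 0 q' (ltac:(rewrite lt_def qn; lra)).
  by have := h' (lexx _) q2; rewrite axis_at0; lra.
have [kl|lk|/val_inj kl] := ltngtP k l.
- by case: (no k l p q).
- by case: (no l k q p).
- move: e; rewrite kl /slope => /addrI e; congr (_, _).
  by apply: axis_inj => //; lra.
Qed.

Lemma regularVdetour k p : 0 <= p <= 8 -> regular k p \/ k = 0%N :> nat /\ 0 <= p < 1 / 2.
Proof.
move=> /andP[p0 p8]; rewrite /regular; have [->|/eqP k0] := eqVneq (k : nat) 0%N; last by left; left.
by have [h|h] := leP (1 / 2) p; [left; right|right; rewrite p0].
Qed.

(** Along z = -n the detour stays beyond the line of slope 2 n and meets it only at the end of
    strand n - 1, which is the same point of the curve. Later, at negative y it has z >= 0, where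
    regular strands have positive slopes; at positive y it has z < 0. *)
Lemma detour_regular k l p q y z : k = 0%N :> nat -> 0 <= p < 1 / 2 ->
  detour_spec p y z -> regular l q -> 0 <= q < 8 ->
  (petal k p).1 = (1 / 2 + y, n%:R * z) -> (petal k p).1 = (petal l q).1 ->
  (petal k p).1 = (1 / 2, 0).
Proof.
move=> k0 hp D r hq -> ; have hq' : 0 <= q <= 8 by lra.
rewrite petal_pt_regular // => -[/addrI ey ez]; have sb := slope_bounds l q.
have np : 0 < n%:R :> R by rewrite ltr0n.
have l0 : 0 <= l%:R :> R by [].
have s0 : 0 <= slope l q by lra.
have ll : l%:R + 1 <= n%:R :> R by rewrite natr1 ler_nat.
have spos : axis n q < 0 -> 0 < slope l q.
  move=> a0; rewrite lt_def s0 andbT; apply/eqP => es; move: r => [l1|q1].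
    by have : 1 <= l%:R :> R; [rewrite ler1n lt0n; apply/eqP|clear -es sb; lra].
  have [q2|q2] := leP q (9 / 2); first by have := @axis_ge0 q; rewrite q1 q2 => /(_ isT); lra.
  move: es; rewrite /slope (@clamp1 _ (q - 2)); last by lra.
  by have := clamp_ge0 (q - 6); clear -l0; lra.
clear k0; case: D ey ez hp => h ey ez hp; [exfalso| |exfalso|exfalso].
- have [q7|q7] := leP 7 q; last first.
    have : slope l q < 2 * n%:R.
      have cl : clamp (q - 6) < 1 by clear -q7; case: (clampP (q - 6)) => -[? ->]; lra.
      by rewrite /slope; have := clamp_le1 (q - 2); clear -ll cl; lra.
    have : 0 <= slope l q * (2 * axis n q + 1) by apply: mulr_ge0; lra.
    by clear -ez; lra.
  have q8 : q < 8 by case/andP: hq.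
  have [_ _ h'] := @axis_monotone q 8 q8.
  by have := h' q7 (lexx _); rewrite axis_at8 -ey; lra.
- have : (n%:R * 4 + slope l q) * (16 * p - 3) = 0 by move: ez; rewrite -ey; clear; lra.
  move/eqP; rewrite mulf_eq0 => /orP[/eqP e'|/eqP e']; first by exfalso; lra.
  by rewrite e' mulr0; congr (_, _); lra.
- have a0 : axis n q < 0 by lra.
  have : 0 <= n%:R * (3 - 8 * p) :> R by apply: mulr_ge0; lra.
  have : 0 < slope l q * - axis n q by rewrite mulr_gt0 ?spos // oppr_gt0.
  by lra.
- have a0 : axis n q < 0 by lra.
  have : 0 < slope l q * - axis n q by rewrite mulr_gt0 ?spos // oppr_gt0.
  by lra.
Qed.

Lemma detour_inj p q y z y' z' : detour_spec p y z -> detour_spec q y' z' ->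
  y = y' -> z = z' -> (y, z) <> (0, 0) -> p = q.
Proof.
move=> D D' ey ez nz; have nz' : y = 0 -> z = 0 -> False by move=> a b; apply: nz; rewrite a b.
by case: D ey ez nz' => h; case: D' => h' ey ez nz'; try lra;
  case: nz'; lra.
Qed.

Lemma petal_proj_inj k l p q : 0 <= p < 8 -> 0 <= q < 8 ->
  (petal k p).1 = (petal l q).1 -> (petal k p).1 <> (1 / 2, 0) -> (k, p) = (l, q).
Proof.
move=> hp hq e ne; have hp' : 0 <= p <= 8 by lra.
have hq' : 0 <= q <= 8 by lra.
have [rk|[k0 pd]] := regularVdetour k hp'; have [rl|[l0 qd]] := regularVdetour l hq'.
- move: e ne; rewrite !petal_pt_regular // => -[/addrI ea es] ne.
  apply: regular_inj => //; apply/eqP => a0; apply: ne.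
  by rewrite a0 mulr0 addr0.
- have [y [z [ey D]]] := petal_pt_detour s1 s2 n0 l0 (ltac:(lra) : 0 <= q <= 1 / 2).
  by case: ne; rewrite e; apply: (detour_regular l0 qd D rk hp ey); rewrite e.
- have [y [z [ey D]]] := petal_pt_detour s1 s2 n0 k0 (ltac:(lra) : 0 <= p <= 1 / 2).
  by case: ne; apply: (detour_regular k0 pd D rl hq ey).
- have [y [z [ey D]]] := petal_pt_detour s1 s2 n0 k0 (ltac:(lra) : 0 <= p <= 1 / 2).
  have [y' [z' [ey' D']]] := petal_pt_detour s1 s2 n0 l0 (ltac:(lra) : 0 <= q <= 1 / 2).
  have nn : n%:R != 0 :> R by rewrite pnatr_eq0 -lt0n.
  move: e ne; rewrite ey ey' => -[/addrI e1 /(mulfI nn) e2] ne.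
  congr (_, _); first by apply: val_inj; rewrite /= k0 l0.
  apply: detour_inj D D' e1 e2 _ => -[a b]; apply: ne.
  by rewrite a b mulr0 addr0.
Qed.

Lemma petal_center k p : 0 <= p < 8 -> (petal k p).1 = (1 / 2, 0) <->
  [\/ k = 0%N :> nat /\ p = 3 / 16, p = 1 / 2 | p = 9 / 2].
Proof.
move=> hp; have hp' : 0 <= p <= 8 by lra.
split; last first.
  case=> [[k0 ->]|->|->]; last 2 first.
  - rewrite petal_pt_regular; [|by right; lra|by lra].
    by rewrite axis_01 ?subrr ?mulr0 ?addr0 //; lra.
  - rewrite petal_pt_regular; [|by right; lra|by lra].
    by rewrite axis_45 ?subrr ?mulr0 ?addr0 //; lra.
  have [y [z [-> D]]] := petal_pt_detour s1 s2 n0 k0 (ltac:(lra) : 0 <= 3 / 16 <= 1 / 2).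
  have [-> ->] : y = 0 /\ z = 0 by case: D => h; split; lra.
  by rewrite mulr0 addr0.
have [r|[k0 pd]] := regularVdetour k hp'.
  rewrite petal_pt_regular // => -[e _].
  have : axis n p = 0 by lra.
  by move=> /(axis_eq0 hp')[->|->]; [constructor 2|constructor 3].
have [y [z [-> D]]] := petal_pt_detour s1 s2 n0 k0 (ltac:(lra) : 0 <= p <= 1 / 2).
have nn : n%:R != 0 :> R by rewrite pnatr_eq0 -lt0n.
move=> -[ey /eqP]; rewrite mulf_eq0 (negbTE nn) /= => /eqP ez.
constructor 1; split=> //; case: D ey ez => h ey ez; lra.
Qed.
End PetalProjection.

(** * Cones that separate the petals *)

Section Cones.
Variables (R : realType) (n : nat) (s1 s2 : 'S_n).
Hypothesis n0 : (0 < n)%N.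
Implicit Types (p q t u x y z : R) (k l : 'I_n).

Notation petal := (petal_pt s1 s2).

(* The normals of the half-planes that cut out a cone containing petal [j], seen
   from the multi-crossing: petal [2 k + 1] is the upper part of strand [k], and
   petal [2 k + 2] its lower part followed by the beginning of the next strand. *)
Definition cone_normals (j : nat) : seq (R * R) :=
  if j == 0%N then [:: (1, 0); (0, - 1); (4 * n%:R, 1)]
  else if j == (2 * n)%N then [:: (0, 1); (1 - j%:R, 1); (4 * n%:R, 1)]
  else if odd j then [:: (- 1, 0); (j%:R - 1, - 1); (- j%:R, 1)]
  else [:: (1, 0); (1 - j%:R, 1); (j%:R, - 1)].

Definition cone (j : nat) (v : R * R) : bool :=
  all (fun c : R * R => c.1 * (v.1 - 1 / 2) + c.2 * v.2 <= 0) (cone_normals j).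

Variant cone_spec (j : nat) y z : Prop :=
| Cone0 of j = 0%N & y <= 0 & 0 <= z & z <= - (4 * n%:R * y)
| ConeLast of j = (2 * n)%N & z <= 0 & z <= j%:R * y - y & z <= - (4 * n%:R * y)
| ConeTop of odd j & 0 <= y & j%:R * y - y <= z & z <= j%:R * y
| ConeBottom of (0 < j)%N & ~~ odd j & y <= 0 & z <= j%:R * y - y & j%:R * y <= z.

Lemma coneP j y z : cone j (1 / 2 + y, z) -> cone_spec j y z.
Proof.
rewrite /cone /cone_normals; have [->|j0] := eqVneq j 0%N.
  by rewrite /= andbT => /and3P[] a b c; constructor 1 => //; lra.
have [->|j1] := eqVneq j (2 * n)%N.
  by rewrite /= andbT => /and3P[] a b c; constructor 2 => //; lra.
have [od|od] := boolP (odd j); rewrite /= andbT => /and3P[] a b c.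
  by constructor 3 => //; lra.
by constructor 4 => //; rewrite ?lt0n //; lra.
Qed.

Lemma cone_disjoint j (l : nat) v : (j < l)%N -> (l <= 2 * n)%N -> cone j v -> cone l v ->
  v = (1 / 2, 0).
Proof.
move=> jl ln; have -> : v = (1 / 2 + (v.1 - 1 / 2), v.2) by case: v => a b /=; congr (_, _); lra.
move: (v.1 - 1 / 2) (v.2) => y z /coneP cj /coneP cl.
have [y0|y0|y0] := ltgtP y 0; last first.
- suff -> : z = 0 by rewrite y0 addr0.
  rewrite y0 in cj cl.
  case: cj => [*|e *|*|*]; [|by exfalso; move: jl; lia|..]; by case: cl => *; lra.
- exfalso; have [oj jy] : odd j /\ z <= j%:R * y.
    by case: cj => [_ h|e _ h1 h2|o _ _ h|_ _ h]; [lra|move: jl; lia|by []|lra].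
  have j1 : 1 <= j%:R :> R by rewrite ler1n; case: (j) oj.
  case: cl => [e|_ h1 h2 h3|o _ h _|_ _ h]; [by move: jl; rewrite e|..|lra].
    case: cj => [_ h|e|_ _ h _|_ _ h]; [lra|move: jl; lia| |lra].
    have : 0 <= (j%:R - 1) * y by apply: mulr_ge0; lra.
    have : 0 < n%:R * y by apply: mulr_gt0; rewrite ?ltr0n.
    by clear -h h3; lra.
  have jl2 : j%:R + 2 <= l%:R :> R by rewrite -natrD ler_nat; lia.
  have : 0 < (l%:R - 1 - j%:R) * y by apply: mulr_gt0; lra.
  by clear -jy h; lra.
- exfalso; have [ej jy] : ~~ odd j /\ (z < 0 -> j%:R * y <= z).
    case: cj => [->|e|_ h|_ o _ _ h]; [by split=> //; rewrite mul0r; lra|by move: jl; lia|by exfalso; lra|by []].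
  have [el ly] : ~~ odd l /\ z <= l%:R * y - y.
    by case: cl => [e|-> _ h _|_ h|_ o _ h _]; [move: jl; rewrite e|rewrite oddM|exfalso; lra|].
  have jl2 : j%:R + 2 <= l%:R :> R by rewrite -natrD ler_nat; lia.
  have j0 : 0 <= j%:R :> R by [].
  have zn : z < 0.
    have : 0 < (l%:R - 1) * - y by apply: mulr_gt0; lra.
    by clear -ly; lra.
  have : 0 < (l%:R - 1 - j%:R) * - y by apply: mulr_gt0; lra.
  by have := jy zn; clear -ly; lra.
Qed.

Lemma cone_top k p : 1 / 2 <= p <= 9 / 2 -> cone (2 * k + 1) (petal k p).1.
Proof.
move=> h; have hp : 0 <= p <= 8 by lra.
rewrite petal_pt_regular //; last by right; lra.
have a0 := axis_ge0 n h.
rewrite /cone /cone_normals addn1 /= eqn_leq; have -> : (2 * n <= (2 * k).+1)%N = false.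
  by apply/negbTE; have := ltn_ord k; rewrite -ltnNge; lia.
have -> : (2 * k).+1%:R = 2 * k%:R + 1 :> R by rewrite -natr1 natrM.
rewrite andbF oddM /= andbT.
have c6 : clamp (p - 6) = 0 by apply: clamp0; lra.
have : 0 <= clamp (p - 2) * axis n p by rewrite mulr_ge0 // clamp_ge0.
have : 0 <= (1 - clamp (p - 2)) * axis n p by rewrite mulr_ge0 // subr_ge0 clamp_le1.
by rewrite /slope c6 => A B; apply/and3P; split; lra.
Qed.

Lemma cone_bottom k p : 9 / 2 <= p <= 8 -> cone (2 * k + 2) (petal k p).1.
Proof.
move=> h; have hp : 0 <= p <= 8 by lra.
rewrite petal_pt_regular //; last by right; lra.
have a0 := axis_le0 n (or_intror h).
have E : (2 * k).+2%:R = 2 * k%:R + 2 :> R by rewrite -addn2 natrD natrM.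
rewrite /cone /cone_normals addn2 /= oddM /= E.
have c2 : clamp (p - 2) = 1 by apply: clamp1; lra.
have : 0 <= clamp (p - 6) * - axis n p by rewrite mulr_ge0 ?oppr_ge0 // clamp_ge0.
have : 0 <= (1 - clamp (p - 6)) * - axis n p by rewrite mulr_ge0 ?oppr_ge0 // subr_ge0 clamp_le1.
have : 0 <= k%:R * - axis n p by rewrite mulr_ge0 ?oppr_ge0.
have : 0 <= n%:R * - axis n p by rewrite mulr_ge0 ?oppr_ge0.
by rewrite /slope c2 => A B C D; case: eqP => _ /=; apply/and4P; split => //; lra.
Qed.

Lemma cone_next k p : (0 < k)%N -> 0 <= p <= 1 / 2 -> cone (2 * k) (petal k p).1.
Proof.
move=> k0 h; have hp : 0 <= p <= 8 by lra.
rewrite petal_pt_regular //; last by left; apply/eqP; rewrite -lt0n.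
have a0 := axis_le0 n (or_introl h).
rewrite /cone /cone_normals; have -> : (2 * k == 0)%N = false by apply/negbTE; lia.
have -> : (2 * k == 2 * n)%N = false by apply/negbTE; have := ltn_ord k; lia.
have E : (2 * k)%N%:R = 2 * k%:R :> R by rewrite natrM.
rewrite oddM /= andbT E /slope !clamp0; [|lra..].
by apply/and3P; split; lra.
Qed.

Lemma cone_detour_start k p : k = 0%N :> nat -> 3 / 16 <= p <= 1 / 2 ->
  cone 0 (petal k p).1.
Proof.
move=> k0 h; have [y [z [-> D]]] := petal_pt_detour s1 s2 n0 k0 (ltac:(lra) : 0 <= p <= 1 / 2).
rewrite /cone /= andbT; clear k0; case: D => h'; try by exfalso; lra.
- have : 0 <= n%:R * (16 * p - 3) by apply: mulr_ge0 => //; lra.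
  by move=> ?; apply/and3P; split; lra.
- have : 0 <= n%:R * (3 - 8 * p) by apply: mulr_ge0 => //; lra.
  have : 0 <= n%:R * (4 * p - 1) by apply: mulr_ge0 => //; lra.
  by move=> *; apply/and3P; split; lra.
- have : 0 <= n%:R * (1 - 2 * p) by apply: mulr_ge0 => //; lra.
  by move=> ?; apply/and3P; split; lra.
Qed.

Lemma cone_detour_end k p : k = 0%N :> nat -> 0 <= p <= 3 / 16 ->
  cone (2 * n) (petal k p).1.
Proof.
move=> k0 h; have [y [z [-> D]]] := petal_pt_detour s1 s2 n0 k0 (ltac:(lra) : 0 <= p <= 1 / 2).
have n1 : 1 <= n%:R :> R by rewrite ler1n.
rewrite /cone /cone_normals eqxx; have -> : (2 * n == 0)%N = false by apply/negbTE; lia.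
have E : (2 * n)%N%:R = 2 * n%:R :> R by rewrite natrM.
rewrite /= andbT E; clear k0; case: D => h'; try by exfalso; lra.
- have : 0 <= n%:R * (1 - 8 * p) by apply: mulr_ge0 => //; lra.
  have : 0 <= (n%:R - 1) * p by apply: mulr_ge0 => //; lra.
  by move=> *; apply/and3P; split; lra.
- have : 0 <= n%:R * (3 / 16 - p) by apply: mulr_ge0 => //; lra.
  have : 0 <= (n%:R - 1) * (3 / 16 - p) by apply: mulr_ge0 => //; lra.
  by move=> *; apply/and3P; split; lra.
Qed.

Lemma petal_detour_mid k p : k = 0%N :> nat -> 1 / 8 <= p <= 1 / 4 ->
  (petal k p).1 = (1 / 2 + (3 / 4 - 4 * p), n%:R * (16 * p - 3)).
Proof.
move=> k0 h; have [y [z [-> D]]] := petal_pt_detour s1 s2 n0 k0 (ltac:(lra) : 0 <= p <= 1 / 2).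
clear k0; suff [-> ->] : y = 3 / 4 - 4 * p /\ z = 16 * p - 3 by [].
by case: D => h'; split; lra.
Qed.

Lemma petal_near_top k p : 3 / 8 <= p <= 1 ->
  (petal k p).1 = (1 / 2 + (p - 1 / 2), 2 * k%:R * (p - 1 / 2)).
Proof.
move=> h; have [r|[k0 pd]] := regularVdetour k (ltac:(lra) : 0 <= p <= 8).
  rewrite petal_pt_regular //; last by lra.
  rewrite axis_01; last by lra.
  by rewrite /slope !clamp0; [rewrite !addr0|lra..].
have [y [z [-> D]]] := petal_pt_detour s1 s2 n0 k0 (ltac:(lra) : 0 <= p <= 1 / 2).
rewrite k0 mulr0 mul0r; clear k0; suff [-> ->] : y = p - 1 / 2 /\ z = 0 by rewrite mulr0.
by case: D => h'; split; lra.
Qed.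

Lemma petal_near_bottom k p : 4 <= p <= 5 ->
  (petal k p).1 = (1 / 2 + (9 / 2 - p), (2 * k%:R + 1) * (9 / 2 - p)).
Proof.
move=> h; rewrite petal_pt_regular; [|by right; lra|by lra].
rewrite axis_45 // /slope (@clamp1 _ (p - 2)) ?(@clamp0 _ (p - 6)); [|lra..].
by rewrite addr0.
Qed.
End Cones.

Section PlaneAndLine.
Variable R : realType.
Implicit Types (L : set (plane R)) (x v : plane R) (t : R).

(* From a point beyond the half-plane a ray escapes to infinity without meeting [L]. *)
Lemma inside_halfplane L (a b c : R) x : (a, b) != 0 ->
  (forall y, L y -> a * y.1 + b * y.2 <= c) -> inside L x -> a * x.1 + b * x.2 <= c.
Proof.
move=> ab hL [xL bx]; rewrite leNgt; apply/negP => cx.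
pose ray t : plane R := x + t *: (a, b).
have sq : 0 < a * a + b * b.
  have := sqr_ge0 a; have := sqr_ge0 b; rewrite !expr2 => b0 a0.
  rewrite lt_def addr_ge0 // andbT; apply: contra ab => /eqP e.
  have a1 : a * a = 0 by lra.
  have b1 : b * b = 0 by lra.
  move/eqP: a1; move/eqP: b1; rewrite !mulf_eq0 !orbb => /eqP-> /eqP->.
  by [].
have rayL t : 0 <= t -> ~ L (ray t).
  move=> t0 /hL; rewrite /ray /= /GRing.scale /=.
  by have := mulr_ge0 t0 (ltW sq); lra.
have cray : continuous ray.
  move=> t; apply: cvgD; first exact: cvg_cst.
  by apply: cvgZ; [exact: cvg_id|exact: cvg_cst].
have conn : connected [set ray t | t in `[0, +oo[].
  apply: connected_continuous_connected; last exact: continuous_subspaceT.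
  by apply/connected_intervalP; exact: interval_is_interval.
have sub : [set ray t | t in `[0, +oo[] `<=` connected_component (~` L) x.
  apply: connected_component_max => //.
    by exists 0; rewrite /= ?in_itv /= ?lexx // /ray scale0r addr0.
  by move=> _ [t ht <-]; apply: rayL; move: ht; rewrite /= in_itv /= andbT.
have [M [Mr hM]] := bx.
have m0 : 0 < `|(a, b)| by rewrite normr_gt0.
pose t := (`|M| + 1 + 1 + `|x|) / `|(a, b)|.
have t0 : 0 <= t by rewrite divr_ge0 // !addr_ge0.
have h : `|ray t| <= `|M| + 1.
  apply: (hM (`|M| + 1)); first by have := ler_norm M; lra.
  by apply: sub; exists t => //; rewrite /= in_itv /= t0.
have := lerB_dist (t *: (a, b)) (- x); rewrite opprK normrN normrZ (ger0_norm t0).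
move: h; rewrite /ray addrC /t divfK ?gt_eqF //; lra.
Qed.

Lemma is_derive_affine (f : R -> plane R) c v (t e : R) : 0 < e ->
  (forall s, `|s - t| < e -> f s = c + (s - t) *: v) -> is_derive t 1 f v.
Proof.
move=> e0 hf.
have lim : h^-1 *: ((f \o shift t) (h *: 1) - f t) @[h --> 0^'] --> v.
  apply: cvg_near_cst.
  near=> h.
  have h0 : h != 0 by near: h; exact: nbhs_dnbhs_neq.
  have he : `|h| < e by near: h; exact: dnbhs0_lt.
  rewrite /= (hf t) ?subrr ?normr0 // scale0r addr0.
  rewrite [h *: 1]mulr1 hf; last by rewrite addrK.
  by rewrite addrK addrC addKr scalerA mulVf // scale1r.
split; first by apply/cvg_ex; exists v.
exact: cvg_lim lim.
Unshelve. all: by end_near. Qed.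
End PlaneAndLine.

(** * The petal curve *)

Section Glue.
Variables (R : realType) (n : nat) (s1 s2 : 'S_n).
Hypothesis n0 : (0 < n)%N.
Implicit Types (p q t u x y z : R) (k l : 'I_n) (m : int).

Notation petal := (petal_pt s1 s2).

Lemma strand_at_subproof m : (`|(m %% n)%Z|%N < n)%N.
Proof.
by rewrite -ltz_nat gez0_abs ?modz_ge0 ?ltz_pmod //; apply/eqP => -[e]; move: n0; rewrite e.
Qed.

Definition strand_at m : 'I_n := Ordinal (strand_at_subproof m).

Lemma strand_at_nat (i : nat) : (i < n)%N -> strand_at i = i :> nat.
Proof. by move=> hi; rewrite /= modz_small. Qed.

Lemma strand_at_size : strand_at n = 0%N :> nat.
Proof. by rewrite /= modzz. Qed.

Lemma strand_atD m : strand_at (m + n) = strand_at m.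
Proof. by apply: val_inj; rewrite /= modzDr. Qed.

Lemma strand_at_inj m m' : `|m - m'| < n%:Z -> strand_at m = strand_at m' -> m = m'.
Proof.
move=> mm /(congr1 val) /= e; have n0' : n%:Z != 0 by apply/eqP => -[e']; move: n0; rewrite e'.
have /eqP : (m %% n)%Z = (m' %% n)%Z.
  by rewrite -[LHS]gez0_abs ?modz_ge0 // e gez0_abs ?modz_ge0.
rewrite eqz_mod_dvd => /dvdzP[k ek].
have [k0|k0] := eqVneq k 0.
  by move/eqP: ek; rewrite k0 mul0r subr_eq0 => /eqP.
move: mm; rewrite ek normrM => h; exfalso; have : 1 <= `|k| by rewrite -gtz0_ge1 normr_gt0.
nia.
Qed.

Lemma strand_at_succ m : cyc_perm n (strand_at m) = strand_at (m + 1).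
Proof.
apply: ord_inj; rewrite cyc_permE /=.
have hm := strand_at_subproof m.
have n0' : n%:Z != 0 by apply/eqP => -[e']; move: n0; rewrite e'.
rewrite -[in RHS]modzDml -[(m %% n)%Z]gez0_abs ?modz_ge0 //.
set r := `|(m %% n)%Z|%N in hm *.
have [e|ne] := eqVneq r.+1 n; first by rewrite addrC -intS e modzz.
by rewrite addrC -intS modz_small //=; lia.
Qed.

(** The page parameter unrolled along the knot: turn [m] occupies [8 m, 8 m + 8], on strand [m]
    modulo [n]. *)
Definition petal_track q : space R :=
  let m := Num.floor (q / 8) in petal (strand_at m) (q - 8 * m%:~R).

Lemma petal_close k : petal k (8 : R) = petal (cyc_perm n k) 0.
Proof.
have [B [_ _ _ e]] := petal_conf_loop R s1 s2.
rewrite /petal_pt /page_pt -e; congr (rotate (shear _ (pt _ _ _)));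
  by rewrite /page_x /page_y /page_y0; clamps; lra.
Qed.

Lemma petal_trackE m q : 8 * m%:~R <= q <= 8 * m%:~R + 8 ->
  petal_track q = petal (strand_at m) (q - 8 * m%:~R).
Proof.
move=> /andP[h1]; rewrite le_eqVlt => /orP[/eqP->|h2]; rewrite /petal_track.
  have -> : Num.floor ((8 * m%:~R + 8) / 8 : R) = m + 1.
    by apply: floor_def; rewrite !intrD; lra.
  rewrite -strand_at_succ intrD (_ : _ - _ = 0); last by lra.
  by rewrite -petal_close; congr petal_pt; lra.
by have -> : Num.floor (q / 8) = m by apply: floor_def; rewrite intrD; lra.
Qed.

Lemma petal_track_period q : petal_track (q + 8 * n%:R) = petal_track q.
Proof.
rewrite /petal_track; have -> : Num.floor ((q + 8 * n%:R) / 8) = Num.floor (q / 8) + n.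
  apply: floor_def; have /andP[] := floor_itv (q / 8); rewrite !intrD -pmulrn; lra.
by rewrite strand_atD intrD -pmulrn; congr petal_pt; lra.
Qed.

Lemma petal_lip : exists2 B, 0 <= B & forall k p q, 0 <= p <= 8 -> 0 <= q <= 8 ->
  `|petal k p - petal k q| <= B * `|p - q|.
Proof.
have [A [A0 hA _ _]] := petal_conf_loop R s1 s2.
have L k : exists2 B, 0 <= B & forall p q, 0 <= p <= 8 -> 0 <= q <= 8 ->
    `|petal k p - petal k q| <= B * `|p - q|.
  have lx : lip8 (fun p => (petal_conf s1 s2 p k).1).
    exists A => // p q hp hq; apply: le_trans (hA p q k hp hq).
    by rewrite [leRHS]prod_normE le_max lexx.
  have lz : lip8 (fun p => (petal_conf s1 s2 p k).2).
    exists A => // p q hp hq; apply: le_trans (hA p q k hp hq).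
    by rewrite [leRHS]prod_normE le_max lexx orbT.
  have lX : lip8 (fun p => n%:R + (n%:R - (petal_conf s1 s2 p k).1) * page_x p).
    apply: lip8D; first exact: lip8_cst.
    apply: lip8M; first by apply: lip8B => //; exact: lip8_cst.
    by rewrite /page_x; prove_lip8.
  have lY : lip8 (fun p => page_y0 p + (n%:R - (petal_conf s1 s2 p k).1) * page_y p).
    apply: lip8D; first by rewrite /page_y0; prove_lip8.
    apply: lip8M; first by apply: lip8B => //; exact: lip8_cst.
    by rewrite /page_y; prove_lip8.
  case: lX lY lz => [BX BX0 hX] [BY BY0 hY] [Bz Bz0 hz].
  exists (BY + 2 * (BX + Bz) + Bz + BX); first by rewrite !addr_ge0 ?mulr_ge0 ?addr_ge0.
  move=> p q hp hq; have dX := hX p q hp hq; have dY := hY p q hp hq; have dz := hz p q hp hq.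
  have d0 : 0 <= `|p - q| by [].
  have dd : `|detour n (n%:R + (n%:R - (petal_conf s1 s2 p k).1) * page_x p, (petal_conf s1 s2 p k).2) -
              detour n (n%:R + (n%:R - (petal_conf s1 s2 q k).1) * page_x q, (petal_conf s1 s2 q k).2)|
      <= 2 * (BX + Bz) * `|p - q|.
    apply: le_trans (detour_lip n0 _ _) _; rewrite -mulrA ler_wpM2l // norm2_le.
    have := mulr_ge0 BX0 d0; have := mulr_ge0 Bz0 d0 => a b.
    by apply/andP; split; rewrite [leRHS]mulrDl; [apply: le_trans dX _|apply: le_trans dz _]; lra.
  have := mulr_ge0 BX0 d0; have := mulr_ge0 Bz0 d0; have := mulr_ge0 BY0 d0 => a b c.
  rewrite norm3_le; apply/and3P; split.
  - have -> : (petal k p - petal k q).1.1 =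
      (page_y0 p + (n%:R - (petal_conf s1 s2 p k).1) * page_y p -
       (page_y0 q + (n%:R - (petal_conf s1 s2 q k).1) * page_y q)) +
      (detour n (n%:R + (n%:R - (petal_conf s1 s2 p k).1) * page_x p, (petal_conf s1 s2 p k).2) -
       detour n (n%:R + (n%:R - (petal_conf s1 s2 q k).1) * page_x q, (petal_conf s1 s2 q k).2)).
      by rewrite [RHS]addrACA -opprD.
    by apply: le_trans (ler_normD _ _) _; lra.
  - by apply: le_trans dz _; lra.
  - by apply: le_trans dX _; lra.
have [f hf] : exists f : 'I_n -> R, forall k, 0 <= f k /\ forall p q,
    0 <= p <= 8 -> 0 <= q <= 8 -> `|petal k p - petal k q| <= f k * `|p - q|.
  have ex' i : exists x, 0 <= x /\ forall p q, 0 <= p <= 8 -> 0 <= q <= 8 ->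
      `|petal i p - petal i q| <= x * `|p - q|.
    by have [x x0 h] := L i; exists x.
  by have [f] := choice ex'; exists f.
exists (\sum_k f k); first by apply: sumr_ge0 => k _; case: (hf k).
move=> k p q hp hq; case: (hf k) => _ /(_ p q hp hq) /le_trans; apply.
by rewrite ler_wpM2r // (bigD1 k) //= lerDl sumr_ge0 // => i _; case: (hf i).
Qed.

Lemma glue_lip (V : normedModType R) (f : R -> V) B : 0 <= B ->
  (forall m p q, 8 * m%:~R <= p -> p <= q -> q <= 8 * m%:~R + 8 ->
     `|f p - f q| <= B * (q - p)) ->
  forall p q, `|f p - f q| <= B * `|p - q|.
Proof.
move=> B0 h.
have join p q t : p <= q -> q <= t -> `|f p - f q| <= B * (q - p) ->
    `|f q - f t| <= B * (t - q) -> `|f p - f t| <= B * (t - p).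
  move=> _ _ h1 h2; rewrite -[f p](subrK (f q)) -addrA.
  by apply: le_trans (ler_normD _ _) _; lra.
have step p q : p <= q -> q <= p + 8 -> `|f p - f q| <= B * (q - p).
  move=> pq qp; pose m := Num.floor (p / 8).
  have /andP[] := floor_itv (p / 8); rewrite -/m intrD => m1 m2.
  have [qm|/ltW qm] := leP q (8 * m%:~R + 8); first by apply: (h m) => //; lra.
  apply: (join _ (8 * m%:~R + 8)) => //; first by lra.
    by apply: (h m); lra.
  by apply: (h (m + 1)); rewrite ?intrD //; lra.
suff S p q : p <= q -> `|f p - f q| <= B * (q - p).
  move=> p q; have [pq|/ltW qp] := leP p q; first by rewrite (distrC p) ger0_norm ?subr_ge0 // S.
  by rewrite distrC ger0_norm ?subr_ge0 // S.
have [N] : exists N : nat, q - p <= 8 * N%:R.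
  by exists (Num.truncn ((q - p) / 8)).+1; have := truncnS_gt ((q - p) / 8); lra.
elim: N p q => [|N IH] p q; first by rewrite mulr0 => ? ?; apply: step; lra.
rewrite -natr1 => qN pq; have [q8|/ltW q8] := leP q (p + 8); first exact: step.
apply: (join _ (p + 8)) => //; first by lra.
  by apply: step; lra.
by apply: IH; lra.
Qed.

Lemma petal_track_lip : exists2 B, 0 <= B &
  forall p q, `|petal_track p - petal_track q| <= B * `|p - q|.
Proof.
have [B B0 h] := petal_lip; exists B => //; apply: glue_lip => // m p q mp pq qm.
rewrite !(@petal_trackE m); [|lra..].
apply: le_trans (h _ _ _ _ _) _; [lra|lra|].
rewrite (_ : p - _ - _ = p - q); last by ring.
by rewrite distrC ger0_norm ?subr_ge0.
Qed.
End Glue.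

(** * Passages through the multi-crossing *)

Section Crossings.
Variables (R : realType) (n : nat) (s1 s2 : 'S_n).
Hypothesis n0 : (0 < n)%N.
Implicit Types (p q t u x y z : R) (k l : 'I_n) (i j : nat).

Notation petal := (petal_pt s1 s2).
Notation track := (petal_track s1 s2 n0).
Notation strand := (strand_at n0).

(* Crossing 0 is on the detour of strand 0; strand [k] meets crossing [2 k + 1] on
   page 1/2 and crossing [2 k + 2] on page 9/2. *)
Definition crossing j : R :=
  if j == 0%N then 3 / 16
  else if (j <= 2 * n)%N then 4 * j%:R - 7 / 2 else 8 * n%:R + 3 / 16.

(** The arguments after [j] are the time, strand, page, y-velocity and slope of the passage. *)
Variant crossing_spec j : R -> nat -> R -> R -> R -> Prop :=
| Crossing0 of j = 0%N : crossing_spec j (3 / 16) 0 (3 / 16) (- 4) (- (4 * n%:R))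
| CrossingTop i of j = (2 * i + 1)%N & (i < n)%N :
    crossing_spec j (8 * i%:R + 1 / 2) i (1 / 2) 1 (2 * i%:R)
| CrossingBottom i of j = (2 * i + 2)%N & (i < n)%N :
    crossing_spec j (8 * i%:R + 9 / 2) i (9 / 2) (- 1) (2 * i%:R + 1).

Lemma crossingP j : (j <= 2 * n)%N ->
  exists i p a b, crossing_spec j (crossing j) i p a b.
Proof.
move=> jn; have [->|j0] := eqVneq j 0%N; first by do 4!eexists; exact: Crossing0.
have e : crossing j = 4 * j%:R - 7 / 2 by rewrite /crossing (negbTE j0) jn.
pose i := (j.-1 %/ 2)%N; have hi : (i < n)%N by rewrite /i; lia.
have [oj|ej] := boolP (odd j).
  have ji : j = (2 * i + 1)%N by rewrite /i; lia.
  exists i, (1 / 2), 1, (2 * i%:R); rewrite (_ : crossing j = 8 * i%:R + 1 / 2); first exact: CrossingTop.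
  by rewrite e {1}ji natrD natrM; lra.
have ji : j = (2 * i + 2)%N by rewrite /i; lia.
exists i, (9 / 2), (- 1), (2 * i%:R + 1).
rewrite (_ : crossing j = 8 * i%:R + 9 / 2); first exact: CrossingBottom.
by rewrite e {1}ji natrD natrM; lra.
Qed.

Lemma crossing_top i : (i < n)%N -> crossing (2 * i + 1) = 8 * i%:R + 1 / 2.
Proof.
move=> hi; rewrite /crossing ifF; last by apply/negbTE; lia.
by rewrite ifT ?natrD ?natrM; [lra|lia].
Qed.

Lemma crossing_bottom i : (i < n)%N -> crossing (2 * i + 2) = 8 * i%:R + 9 / 2.
Proof.
move=> hi; rewrite /crossing ifF; last by apply/negbTE; lia.
by rewrite ifT ?natrD ?natrM; [lra|lia].
Qed.

Lemma crossing_last : crossing (2 * n + 1) = 8 * n%:R + 3 / 16.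
Proof. by rewrite /crossing ifF ?ifF //; apply/negbTE; lia. Qed.

Lemma crossing_lt j : (j <= 2 * n)%N -> crossing j < crossing j.+1.
Proof.
move=> jn; rewrite {2}/crossing /=; have [jn'|jn'] := leqP j.+1 (2 * n).
  by rewrite -[j.+1%:R]natr1 /crossing jn; case: eqP => [->|_]; rewrite ?mulr0n; lra.
have -> : j = (2 * n)%N by lia.
rewrite /crossing leqnn ifF ?natrM; last by apply/negbTE; lia.
have : 1 <= n%:R :> R by rewrite ler1n.
by lra.
Qed.

Lemma track_nat i q : 8 * i%:R <= q <= 8 * i%:R + 8 -> track q = petal (strand i) (q - 8 * i%:R).
Proof. by move=> h; rewrite (@petal_trackE _ _ s1 s2 n0 i) -?pmulrn. Qed.

Lemma track_split q : 3 / 16 <= q < 8 * n%:R + 3 / 16 ->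
  exists i p, [/\ 0 <= p < 8, q = 8 * i%:R + p, track q = petal (strand i) p &
    (i < n)%N \/ i = n /\ p < 3 / 16].
Proof.
move=> /andP[q0 qn]; pose i := Num.truncn (q / 8).
have /andP[h1 h2] : i%:R <= q / 8 < i.+1%:R by apply: truncn_itv; lra.
exists i, (q - 8 * i%:R); rewrite -[i.+1%:R]natr1 in h2; split; [lra|ring|apply: track_nat; lra|].
have : i%:R < n.+1%:R :> R by rewrite -natr1; lra.
rewrite ltr_nat ltnS leq_eqVlt => /orP[/eqP e|]; last by left.
by right; split => //; rewrite e; lra.
Qed.

Lemma track_split_uniq i i' p p' : 0 <= p < 8 -> 0 <= p' < 8 ->
  8 * i%:R + p = 8 * i'%:R + p' -> i = i' /\ p = p'.
Proof.
move=> hp hp' e; suff ii : i = i' by split=> //; move: e; rewrite ii; lra.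
have no (a b : nat) u v : 0 <= u < 8 -> 0 <= v < 8 -> 8 * a%:R + u = 8 * b%:R + v -> (a < b)%N -> False.
  move=> hu hv h ab; have : a%:R + 1 <= b%:R :> R by rewrite natr1 ler_nat.
  by clear ab; lra.
by have [h|h|//] := ltngtP i i'; [case: (no i i' p p')|case: (no i' i p' p)].
Qed.

Lemma strand_eq0 i : (i <= n)%N -> strand i = 0%N :> nat -> i = 0%N \/ i = n.
Proof.
rewrite leq_eqVlt => /orP[/eqP ->|hi]; first by right.
by rewrite strand_at_nat //; left.
Qed.

Lemma strand_inj i i' : (i < n)%N -> (i' < n)%N -> strand i = strand i' -> i = i'.
Proof. by move=> hi hi' /(congr1 (@nat_of_ord n)); rewrite !strand_at_nat. Qed.

Lemma track_center q : 3 / 16 <= q < 8 * n%:R + 3 / 16 ->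
  (track q).1 = (1 / 2, 0) <-> exists2 j, (j < 2 * n + 1)%N & q = crossing j.
Proof.
move=> hq; have [i [p [hp e -> hi]]] := track_split hq.
have hin : (i <= n)%N by case: hi => [/ltnW|[->]].
rewrite petal_center //; split.
  case=> [[/(strand_eq0 hin)[i0|ni] p3]|p1|p2].
  - by exists 0%N; [lia|rewrite e i0 p3 mulr0 add0r].
  - by case: hi => [|[_]]; rewrite ?ni ?ltnn // p3 ltxx.
  - case: hi => [hi|[_]]; last by rewrite p1; lra.
    by exists (2 * i + 1)%N; [lia|rewrite crossing_top // e p1].
  - case: hi => [hi|[_]]; last by rewrite p2; lra.
    by exists (2 * i + 2)%N; [lia|rewrite crossing_bottom // e p2].
case=> j jn ej; have [|i' [p' [a [b D]]]] := @crossingP j; first by lia.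
rewrite e in ej; case: D ej => [_|l _ ln|l _ ln] ej.
- have [|||i0 ->] := @track_split_uniq i 0 p (3 / 16); [by []|lra|by rewrite ej mulr0 add0r|].
  by constructor 1; rewrite i0 strand_at_nat.
- by have [|||_ ->] := @track_split_uniq i l p (1 / 2); [by []|lra|by []|constructor 2].
- by have [|||_ ->] := @track_split_uniq i l p (9 / 2); [by []|lra|by []|constructor 3].
Qed.

Lemma track_proj_inj q q' : 3 / 16 <= q < 8 * n%:R + 3 / 16 ->
  3 / 16 <= q' < 8 * n%:R + 3 / 16 -> (track q).1 = (track q').1 ->
  (track q).1 <> (1 / 2, 0) -> q = q'.
Proof.
move=> hq hq'; have [i [p [hp e -> hi]]] := track_split hq.
have [i' [p' [hp' e' -> hi']]] := track_split hq' => h1 h2.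
have ek := petal_proj_inj n0 hp hp' h1 h2.
have es := congr1 fst ek; have ep : p = p' := congr1 snd ek.
suff [ii] : i%:Z = i'%:Z by rewrite e e' ep ii.
apply: (@strand_at_inj _ n0 _ _ _ es).
(* Strands are equal modulo [n] only, but both times lie in one period of length 8 n. *)
have : `|i%:R - i'%:R| < n%:R :> R.
  by rewrite ltr_norml; move: hq hq'; rewrite e e' ep; lra.
by rewrite !pmulrn -intrB -intr_norm ltr_int.
Qed.

Lemma track_crossing j : (j <= 2 * n)%N -> exists i p a b,
  crossing_spec j (crossing j) i p a b /\ track (crossing j) = petal (strand i) p.
Proof.
move=> jn; have [i [p [a [b D]]]] := crossingP jn; exists i, p, a, b; split => //.
case: D => [_|l _ ln|l _ ln].
- by rewrite (@track_nat 0) ?mulr0 ?subr0 //; lra.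
- by rewrite (@track_nat l); [rewrite addrC addKr|lra].
- by rewrite (@track_nat l); [rewrite addrC addKr|lra].
Qed.

Lemma track_height_cases j : (j <= 2 * n)%N ->
  [\/ j = 0%N /\ (track (crossing j)).2 = - 1,
      exists i, [/\ j = (2 * i + 1)%N, (i < n)%N & (track (crossing j)).2 = (s2 (strand i))%:R] |
      exists i, [/\ j = (2 * i + 2)%N, (i < n)%N &
                    (track (crossing j)).2 = 2 * n%:R - (s1 (strand i))%:R]].
Proof.
move=> jn; have [i [p [a [b [D ->]]]]] := track_crossing jn.
case: D => [j0|k ek kn|k ek kn].
- constructor 1; split=> //; apply: petal_height_detour; exact: strand_at_nat.
- by constructor 2; exists k; split => //; exact: petal_height_top.
- by constructor 3; exists k; split => //; exact: petal_height_bottom.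
Qed.

(** The detour passes at -1, the tops at values of [s2] in [0, n - 1], and the bottoms at 2 n minus
    values of [s1], in [n + 1, 2 n]. *)
Lemma track_height j (l : nat) : (j <= 2 * n)%N -> (l <= 2 * n)%N ->
  (track (crossing j)).2 = (track (crossing l)).2 -> j = l.
Proof.
move=> jn ln; have h1 k : 0 <= (s2 k)%:R :> R by [].
have h2 k : (s2 k)%:R + 1 <= n%:R :> R by rewrite natr1 ler_nat.
have h3 k : (s1 k)%:R + 1 <= n%:R :> R by rewrite natr1 ler_nat.
have inj (s : 'S_n) i i' : (i < n)%N -> (i' < n)%N ->
    (s (strand i))%:R = (s (strand i'))%:R :> R -> i = i'.
  by move=> hi hi' /eqP; rewrite eqr_nat => /eqP/val_inj/perm_inj/strand_inj; exact.
case: (track_height_cases jn) => [[-> ->]|[k [-> kn ->]]|[k [-> kn ->]]];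
  case: (track_height_cases ln) => [[-> ->]|[k' [-> kn' ->]]|[k' [-> kn' ->]]] //.
- by move=> e; exfalso; have := h1 (strand k'); lra.
- by move=> e; exfalso; have := h3 (strand k'); have := h2 (strand k'); have := h1 (strand k'); lra.
- by move=> e; exfalso; have := h1 (strand k); lra.
- by move=> /inj->.
- by move=> e; exfalso; have := h2 (strand k); have := h3 (strand k'); lra.
- by move=> e; exfalso; have := h3 (strand k); have := h2 (strand k); have := h1 (strand k); lra.
- by move=> e; exfalso; have := h2 (strand k'); have := h3 (strand k); lra.
- by move=> /addrI/oppr_inj/inj->.
Qed.

(** Petals of odd index stay within a turn. Those of positive even index continue past page 8 on the
    next strand, the last one on the detour of strand 0, where petal 0 then begins. *)
Lemma track_cone j q : (j <= 2 * n)%N -> crossing j <= q <= crossing j.+1 ->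
  cone n j (track q).1.
Proof.
move=> jn; have [j0|j0] := eqVneq j 0%N.
  have c1 : crossing 1 = 1 / 2 by rewrite (@crossing_top 0) // mulr0 add0r.
  have c0 : crossing 0 = 3 / 16 by [].
  rewrite j0 c0 c1 => h.
  rewrite (@track_nat 0) mulr0 ?subr0; [|lra..].
  by apply: cone_detour_start => //; rewrite ?strand_at_nat //; lra.
have [i [p [a [b D]]]] := crossingP jn.
case: D => [e|i0 -> hi|i0 -> hi]; first by rewrite e in j0.
  rewrite (_ : (2 * i0 + 1).+1 = 2 * i0 + 2)%N ?crossing_bottom //; last by lia.
  move=> h; rewrite (@track_nat i0); last by lra.
  have := @cone_top R n s1 s2 n0 (strand i0) (q - 8 * i0%:R).
  by rewrite strand_at_nat //; apply; lra.
move=> /andP[h1 h2]; have [q8|/ltW q8] := leP q (8 * i0%:R + 8).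
  rewrite (@track_nat i0); last by lra.
  have := @cone_bottom R n s1 s2 (strand i0) (q - 8 * i0%:R).
  by rewrite strand_at_nat //; apply; lra.
have [hi'|hi'] := ltnP i0.+1 n.
  move: h2; rewrite (_ : (2 * i0 + 2).+1 = 2 * i0.+1 + 1)%N ?crossing_top //; last by lia.
  rewrite -[i0.+1%:R]natr1 => h2; rewrite (@track_nat i0.+1) -[i0.+1%:R]natr1; last by lra.
  have := @cone_next R n s1 s2 n0 (strand i0.+1) (q - 8 * (i0%:R + 1)).
  rewrite strand_at_nat // (_ : 2 * i0.+1 = 2 * i0 + 2)%N; last by lia.
  by apply => //; lra.
have en : i0.+1 = n by lia.
move: h2; rewrite (_ : (2 * i0 + 2).+1 = 2 * n + 1)%N ?crossing_last; last by lia.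
have en' : n%:R = i0%:R + 1 :> R by rewrite natr1 en.
rewrite en' => h2; rewrite (@track_nat n) en'; last by lra.
rewrite (_ : 2 * i0 + 2 = 2 * n)%N; last by lia.
by apply: cone_detour_end => //; [exact: strand_at_size|lra].
Qed.

Lemma track_velocity j : (j <= 2 * n)%N -> exists i p a b,
  crossing_spec j (crossing j) i p a b /\
  forall q, `|q - crossing j| < 1 / 16 ->
    (track q).1 = (1 / 2, 0) + (q - crossing j) *: (a, a * b).
Proof.
move=> jn; have [i [p [a [b D]]]] := crossingP jn; exists i, p, a, b; split => // q.
case: D => [_|l _ ln|l _ ln]; rewrite ltr_norml => h.
- rewrite (@track_nat 0) ?mulr0 ?subr0; last by lra.
  rewrite petal_detour_mid ?strand_at_nat //; last by lra.
  by congr (_, _); rewrite /= /GRing.scale /=; lra.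
- rewrite (@track_nat l); last by lra.
  rewrite petal_near_top ?strand_at_nat //; last by lra.
  by congr (_, _); rewrite /= /GRing.scale /=; lra.
- rewrite (@track_nat l); last by lra.
  rewrite petal_near_bottom ?strand_at_nat //; last by lra.
  by congr (_, _); rewrite /= /GRing.scale /=; lra.
Qed.
End Crossings.

(** * The petal diagram and the bound *)

Section PetalCurve.
Variables (R : realType) (n : nat) (s1 s2 : 'S_n).
Hypothesis n0 : (0 < n)%N.
Implicit Types (p q t u x y z s : R) (k : 'I_n) (i j : nat).

Notation track := (petal_track s1 s2 n0).

Definition petal_curve s : space R := track (8 * n%:R * s + 3 / 16).

Definition petal_time j : R := (crossing R n j - 3 / 16) / (8 * n%:R).

Let n8 : 0 < 8 * n%:R :> R. Proof. by rewrite mulr_gt0 ?ltr0n. Qed.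

Lemma petal_timeK j : 8 * n%:R * petal_time j + 3 / 16 = crossing R n j.
Proof. by rewrite /petal_time mulrC divfK ?subrK // gt_eqF. Qed.

Lemma petal_curve_time j : petal_curve (petal_time j) = track (crossing R n j).
Proof. by rewrite /petal_curve petal_timeK. Qed.

Lemma petal_time0 : petal_time 0 = 0.
Proof. by rewrite /petal_time /crossing /= subrr mul0r. Qed.

Lemma petal_time_last : petal_time (2 * n + 1) = 1.
Proof. by rewrite /petal_time crossing_last // addrK divff ?gt_eqF. Qed.

Lemma petal_curve_range :
  range petal_curve = [set petal_pt s1 s2 kp.1 kp.2 | kp in [set kp : 'I_n * R | 0 <= kp.2 <= 8]].
Proof.
rewrite predeqE => x; split=> [[s _ <-]|[[k p] /= hp <-]].
  rewrite /petal_curve; set q := _ + _; pose m := Num.floor (q / 8).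
  exists (strand_at n0 m, q - 8 * m%:~R) => //=.
  by have /andP[] := floor_itv (q / 8); rewrite -/m intrD => a b; apply/andP; split; lra.
exists ((8 * k%:R + p - 3 / 16) / (8 * n%:R)) => //.
rewrite /petal_curve mulrC divfK ?subrK ?gt_eqF // (@track_nat R n s1 s2 n0 k); last by lra.
have -> : strand_at n0 k = k by apply: ord_inj; rewrite strand_at_nat.
by rewrite [8 * _ + p]addrC addrK.
Qed.

Lemma petal_domain s : 0 <= s < 1 ->
  3 / 16 <= 8 * n%:R * s + 3 / 16 < 8 * n%:R + 3 / 16.
Proof.
move=> /andP[s0 s1']; have h0 : 0 <= 8 * n%:R * s by rewrite mulr_ge0 // ltW.
have h1 : 8 * n%:R * s < 8 * n%:R * 1 by rewrite ltr_pM2l.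
by lra.
Qed.

Lemma petal_curve_simple : simple_closed_curve petal_curve.
Proof.
split.
- have [B B0 h] := petal_track_lip R s1 s2 n0.
  apply: (@lip_continuous _ _ _ _ (B * (8 * n%:R))) => s s'.
  apply: le_trans (h _ _) _.
  have -> : 8 * n%:R * s + 3 / 16 - (8 * n%:R * s' + 3 / 16) = 8 * n%:R * (s - s') by ring.
  by rewrite normrM ger0_norm ?mulrA // ltW.
- move=> s; rewrite /petal_curve -[RHS]petal_track_period.
  have -> : 8 * n%:R * (s + 1) + 3 / 16 = 8 * n%:R * s + 3 / 16 + 8 * n%:R by ring.
  by [].
- move=> s s'; rewrite !inE /= !in_itv /= => hs hs' e.
  have hq := petal_domain hs; have hq' := petal_domain hs'.
  suff : 8 * n%:R * s + 3 / 16 = 8 * n%:R * s' + 3 / 16.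
    by move/addIr; apply: mulfI; rewrite gt_eqF.
  have [c|c] := pselect ((petal_curve s).1 = (1 / 2, 0)); last first.
    by apply: (track_proj_inj hq hq' (congr1 fst e)).
  have [j jn ej] := (track_center s1 s2 n0 hq).1 c.
  have c' : (petal_curve s').1 = (1 / 2, 0) by rewrite -e.
  have [l ln el] := (track_center s1 s2 n0 hq').1 c'.
  rewrite ej el; congr crossing.
  apply: (@track_height R n s1 s2 n0); [lia|lia|].
  by rewrite -ej -el -/(petal_curve s) e.
Qed.

Definition petal_velocity j : plane R :=
  xget 0 [set v | is_derive (petal_time j) 1 (fun s => (petal_curve s).1) v].

Lemma petal_velocityP j : (j <= 2 * n)%N -> exists i p a b,
  [/\ crossing_spec n j (crossing R n j) i p a b,
      is_derive (petal_time j) 1 (fun s => (petal_curve s).1) (petal_velocity j) &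
      petal_velocity j = (8 * n%:R * a, 8 * n%:R * (a * b))].
Proof.
move=> jn; have [i [p [a [b [D h]]]]] := track_velocity R s1 s2 n0 jn.
have d : is_derive (petal_time j) 1 (fun s => (petal_curve s).1)
    (8 * n%:R * a, 8 * n%:R * (a * b)).
  apply: (@is_derive_affine _ _ (1 / 2, 0) _ _ (1 / 16 / (8 * n%:R))).
    by rewrite divr_gt0 //; lra.
  move=> s hs; have e : 8 * n%:R * s + 3 / 16 - crossing R n j = 8 * n%:R * (s - petal_time j).
    by rewrite -petal_timeK; ring.
  rewrite /petal_curve h e.
    by congr (_, _); rewrite /= /GRing.scale /=; ring.
  by rewrite normrM ger0_norm ?(ltW n8) // mulrC -ltr_pdivlMr.
have dv : is_derive (petal_time j) 1 (fun s => (petal_curve s).1) (petal_velocity j).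
  exact: (@xgetI _ 0 [set v | is_derive (petal_time j) 1 (fun s => (petal_curve s).1) v] _ d).
exists i, p, a, b; split=> //.
have [_ <-] := d; by have [_ <-] := dv.
Qed.

Lemma petal_slopes j l i p a b i' p' a' b' (q q' : R) :
  crossing_spec n j q i p a b -> crossing_spec n l q' i' p' a' b' -> j <> l ->
  [/\ a != 0, a' != 0 & b != b'].
Proof.
move=> D D' jl.
have n1 : 1 <= n%:R :> R by rewrite ler1n.
have slope j' q0 i0 p0 (a0 b0 : R) : crossing_spec n j' q0 i0 p0 a0 b0 ->
    a0 != 0 /\ (j' = 0%N /\ b0 < 0 \/ (0 < j')%N /\ b0 = j'%:R - 1).
  case=> [->|k -> kn|k -> kn]; split.
  - by rewrite oppr_eq0 pnatr_eq0.
  - by left; split=> //; lra.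
  - exact: oner_neq0.
  - by right; split; [lia|rewrite natrD natrM; lra].
  - by rewrite oppr_eq0 oner_neq0.
  - by right; split; [lia|rewrite natrD natrM; lra].
have [a0 hb] := slope _ _ _ _ _ _ D; have [a0' hb'] := slope _ _ _ _ _ _ D'; split=> //.
case: hb => [[j0 h]|[j0 h]]; case: hb' => [[l0 h']|[l0 h']].
- by case: jl; rewrite j0 l0.
- by rewrite h' lt_eqF // (lt_le_trans h) // subr_ge0 ler1n.
- by rewrite h eq_sym lt_eqF // (lt_le_trans h') // subr_ge0 ler1n.
- by rewrite h h' (inj_eq (addIr _)) eqr_nat; apply/eqP.
Qed.

Lemma petal_inside j (x : plane R) : (j <= 2 * n)%N ->
  inside [set (petal_curve s).1 | s in `[petal_time j, petal_time j.+1]] x -> cone n j x.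
Proof.
move=> jn ix; have L (y : plane R) : [set (petal_curve s).1 | s in `[petal_time j, petal_time j.+1]] y -> cone n j y.
  move=> [s /=]; rewrite in_itv /= => /andP[h1 h2] <-.
  apply: track_cone => //; rewrite -!petal_timeK !lerD2r !ler_pM2l //.
  by rewrite h1.
apply/allP => c hc; have c0 : c != 0.
  move: hc; rewrite /cone_normals; do !case: ifP => _; rewrite !inE => /or3P[] /eqP->;
    by apply/eqP => -[]; (try by move/eqP; rewrite ?oppr_eq0 oner_eq0);
       (try by move=> _ /eqP; rewrite ?oppr_eq0 oner_eq0).
have h : c.1 * x.1 + c.2 * x.2 <= c.1 * (1 / 2).
  apply: (inside_halfplane _ _ ix); first by rewrite -surjective_pairing.
  by move=> y /L/allP/(_ c hc); lra.
by lra.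
Qed.

Lemma crossing_domain j : (j <= 2 * n)%N ->
  3 / 16 <= crossing R n j < 8 * n%:R + 3 / 16.
Proof.
have n1 : 1 <= n%:R :> R by rewrite ler1n.
move=> /crossingP-/(_ R n0)[i [p [a [b []]]]] => [_|k _ kn|k _ kn]; first by lra.
  have : k%:R + 1 <= n%:R :> R by rewrite natr1 ler_nat.
  by have := ler0n R k; lra.
have : k%:R + 1 <= n%:R :> R by rewrite natr1 ler_nat.
by have := ler0n R k; lra.
Qed.

Theorem petal_curve_diagram : petal_diagram (2 * n + 1) petal_curve.
Proof.
split; first exact: petal_curve_simple.
split; first by lia.
have lt (j : nat) : (j < 2 * n + 1)%N -> (j <= 2 * n)%N by rewrite addn1 ltnS.
exists (1 / 2, 0), petal_time, petal_velocity; rewrite petal_time0 petal_time_last add0r; split.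
- split=> // k /lt kn; rewrite /petal_time ltr_pM2r ?invr_gt0 // ltrD2r.
  exact: crossing_lt.
- move=> s; rewrite inE /= in_itv /= => hs.
  rewrite /petal_curve track_center; last exact: petal_domain.
  split=> -[k kn e]; exists k => //; first by rewrite /petal_time -e addrK mulrC mulKf // gt_eqF.
  by rewrite e petal_timeK.
- move=> s s'; rewrite !inE /= !in_itv /= => hs hs' e ne.
  have := track_proj_inj (petal_domain hs) (petal_domain hs') e ne.
  by move/addIr; apply: mulfI; rewrite gt_eqF.
- by move=> k /lt /petal_velocityP[i [p [a [b []]]]].
- move=> k l /lt kn /lt ln kl; split.
  + have [i [p [a [b [D _ ->]]]]] := petal_velocityP kn.
    have [i' [p' [a' [b' [D' _ ->]]]]] := petal_velocityP ln.
    have [a0 a0' bb] := petal_slopes D D' kl.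
    rewrite /= (_ : _ - _ = (8 * n%:R) ^+ 2 * (a * a') * (b' - b)); last by ring.
    apply: mulf_neq0; last by rewrite subr_eq0 eq_sym.
    by apply: mulf_neq0; [rewrite expf_neq0 // gt_eqF|exact: mulf_neq0].
  + rewrite !petal_curve_time; apply/eqP => /track_height h.
    by apply: kl; exact: h.
  (* A common interior point lies in two cones, hence is the multi-crossing; but this lies on the
     petal, and [inside] excludes the curve. *)
  + rewrite -subset0 => x [/[dup] xk /(petal_inside kn) ck /[dup] xl /(petal_inside ln) cl].
    have ex : x = (1 / 2, 0).
      have [lt_kl|lt_lk|//] := ltngtP k l.
        exact: (cone_disjoint n0 lt_kl ln ck cl).
      exact: (cone_disjoint n0 lt_lk kn cl ck).
    case: xk => + _; apply; rewrite ex.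
    exists (petal_time k).
      by rewrite /= in_itv /= lexx /petal_time ler_pM2r ?invr_gt0 // lerD2r ltW // crossing_lt.
    rewrite petal_curve_time; apply/(track_center s1 s2 n0); first exact: crossing_domain.
    by exists k => //; rewrite addn1 ltnS.
Qed.
End PetalCurve.

(** The numbers of petals are natural numbers, so the exhibited diagram gives the minimum as well as
    its bound. *)
Lemma minimal_petal_number (R : realType) (K : set (space R)) N :
  has_petal_diagram K N -> exists2 p, is_petal_number K p & (p <= N)%N.
Proof.
move=> h; pose P p := `[< has_petal_diagram K p >].
have ex : exists p, P p by exists N; apply/asboolP.
have [p /asboolP hp hmin] := ex_minnP ex.
exists p; last by apply: hmin; apply/asboolP.
by split=> // q hq; apply: hmin; apply/asboolP.
Qed.

Lemma sorted_petal_isotopy (R : realType) n (s1 s2 : 'S_n) (n0 : (0 < n)%N) :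
  ambient_isotopic (path_closure (sorted_path R s1 s2)) (range (petal_curve s1 s2 n0 : R -> space R)).
Proof.
have [_ g] := @lifted_path_good_quads R n s1 s2 n0.
have [e /(_ g)[a _]] := peq_isotopy (lifted_hooked_peq R s1 s2 n0) (cyc_perm n).
rewrite petal_curve_range.
apply: ambient_isotopic_trans (sorted_lifted_isotopy R s1 s2 n0) _.
apply: ambient_isotopic_trans a _.
apply: ambient_isotopic_trans (hooked_petal_isotopy n0 (e.1 g)) _.
exact: petal_set_isotopy.
Qed.

Theorem theorem1p1 (R : realType) (n : nat) (hn : (1 <= n)%N) (pi1 pi2 : 'S_n) :
  exists2 p : nat,
    is_petal_number
      (braid_closure R
        (delta n * (br pi1)^-1 * (br (pi1^-1))^-1 * br (pi2^-1) * br pi2)%g) p &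
    (p <= 2 * n + 1)%N.
Proof.
apply: minimal_petal_number; exists (petal_curve pi1 pi2 hn : R -> space R).
  exact: petal_curve_diagram.
rewrite /braid_closure; set b := (_ * br pi2)%g.
have [_ eq_path] := braid_word_path R hn (braid_of_repr b).
have [e /(_ _)] := peq_isotopy eq_path (cyc_perm n).
(* Goodness is checked on the sorted path, and [peq] carries it back to the path of the word. *)
have g := e.2 (sorted_path_good R pi1 pi2 hn).
move=> /(_ g)[a _].
apply: ambient_isotopic_trans (word_closure_isotopy R (generic_quotient.repr b)) _.
have size_path : (size (word_path R (generic_quotient.repr b))).-1 = (2 * size (generic_quotient.repr b))%N.
  by rewrite size_word_path.
(* The closure runs through the whole word on pages 0 to 1; the moves on paths use the uniform time
   change. *)
have r : ambient_isotopic (path_set (word_path R (generic_quotient.repr b)) (strip_param (2 * size (generic_quotient.repr b))))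
    (path_closure (word_path R (generic_quotient.repr b))).
  by apply: reparam g _ _; rewrite size_path; [exact: strip_paramP|exact: std_paramP].
apply: ambient_isotopic_trans r _.
apply: ambient_isotopic_trans a _.
exact: sorted_petal_isotopy.
Qed.
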